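(* There is a universal constant $C>0$ such that the following holds. Let $n\ge 1$ and let $X=(X_1,\ldots,X_n)$ be a random vector in $\mathbb R^n$ distributed according to a density $f:\mathbb R^n\to[0,\infty)$ such that: (A) $f$ is log-concave; (B) $f$ is unconditional; (C) $\mathbb E X_i^2=1$ for $i=1,\ldots,n$. Then $$\sup_{\alpha\le\beta}\left|\mathbb P\left(\alpha\le \frac1{\sqrt n}\sum_{i=1}^n X_i\le\beta\right)-\frac1{\sqrt{2\pi}}\int_\alpha^\beta e^{-t^2/2}\,dt\right|\le \frac Cn .$$ Moreover, for any $\theta_1,\ldots,\theta_n\in\mathbb R$ with $\sum_{i=1}^n\theta_i^2=1$, $$\sup_{\alpha\le\beta}\left|\mathbb P\left(\alpha\le \sum_{i=1}^n \theta_iX_i\le\beta\right)-\frac1{\sqrt{2\pi}}\int_\alpha^\beta e^{-t^2/2}\,dt\right|\le C\sum_{i=1}^n\theta_i^4 .$$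
   Context: A density $f:\mathbb R^n\to[0,\infty)$ is log-concave if $f=e^{-H}$ with $H:\mathbb R^n\to(-\infty,\infty]$ convex. It is unconditional if $f(x_1,\ldots,x_n)=f(\delta_1x_1,\ldots,\delta_nx_n)$ for all $(x_1,\ldots,x_n)\in\mathbb R^n$ and all signs $(\delta_1,\ldots,\delta_n)\in\{\pm1\}^n$. The suprema are over real numbers $\alpha\le\beta$. A universal constant is an absolute number, not depending on $n$, the distribution of $X$, or the $\theta_i$. *)

(* Defs.v *)
From HB Require Import structures.
From mathcomp Require Import all_boot all_order all_algebra.
From mathcomp Require Import all_classical all_reals all_analysis.

Set Implicit Arguments.
Unset Strict Implicit.
Unset Printing Implicit Defensive.

Import Order.TTheory GRing.Theory Num.Theory.
Import numFieldNormedType.Exports.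

Local Open Scope classical_set_scope.
Local Open Scope ring_scope.

(* R^n is [n.-tuple R] with the product (= Borel) sigma-algebra. *)

Section lebesgue_cons.
Context {R : realType} (n : nat).

Definition consT (p : measurableTypeR R * n.-tuple R) : n.+1.-tuple R :=
  [the n.+1.-tuple R of (p.1 : R) :: p.2].

Lemma measurable_consT :
  measurable_fun [set: measurableTypeR R * n.-tuple R] consT.
Proof.
apply: (@measurable_cons _ _ _ R (fun p => p.1 : R) n (fun p => p.2)).
  exact: measurable_fst.
exact: measurable_snd.
Qed.

Variable mu : {sigma_finite_measure set (n.-tuple R) -> \bar R}.

Definition lebesgue_cons : set (n.+1.-tuple R) -> \bar R :=
  pushforward (@lebesgue_measure R \x mu)%E consT.

Let lebesgue_cons0 : lebesgue_cons set0 = 0%E.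
Proof. by rewrite /lebesgue_cons /pushforward preimage_set0 measure0. Qed.

Let lebesgue_cons_ge0 A : (0 <= lebesgue_cons A)%E.
Proof. by rewrite /lebesgue_cons /pushforward measure_ge0. Qed.

Let measurable_consT_preimage A :
  measurable A -> measurable (consT @^-1` A).
Proof. by move=> mA; rewrite -[X in measurable X]setTI; exact: measurable_consT. Qed.

Let lebesgue_cons_sigma_additive : semi_sigma_additive lebesgue_cons.
Proof.
move=> F mF tF mUF; rewrite /lebesgue_cons /pushforward preimage_bigcup.
apply: measure_semi_sigma_additive.
- by move=> k; exact: measurable_consT_preimage.
- apply/trivIsetP => /= i j _ _ ij; rewrite -preimage_setI.
  by move/trivIsetP : tF => /(_ _ _ _ _ ij) ->//; rewrite preimage_set0.
- by rewrite -preimage_bigcup; exact: measurable_consT_preimage.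
Qed.

HB.instance Definition _ := isMeasure.Build _ _ _ lebesgue_cons
  lebesgue_cons0 lebesgue_cons_ge0 lebesgue_cons_sigma_additive.

Lemma lebesgue_consE (A : set R) (B : set (n.-tuple R)) :
  measurable A -> measurable B ->
  lebesgue_cons [set x | A (thead x) /\ B [tuple of behead x]] =
  (lebesgue_measure A * mu B)%E.
Proof.
move=> mA mB; rewrite -product_measure1E// /lebesgue_cons /pushforward.
have beheadK (x : R) (y : n.-tuple R) : [tuple of behead [tuple of x :: y]] = y.
  exact: val_inj.
congr (_ _); apply/seteqP; split => -[x y] /=;
  by rewrite /consT theadE/= beheadK.
Qed.

Let lebesgue_cons_sigma_finite : sigma_finite setT lebesgue_cons.
Proof.
have /sigma_finiteP[F [TF ndF Foo]] := sigma_finiteT (@lebesgue_measure R).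
have /sigma_finiteP[G [TG ndG Goo]] := sigma_finiteT mu.
exists (fun k => [set x | F k (thead x) /\ G k [tuple of behead x]]).
  apply/seteqP; split => // x _.
  have : [set: R] (thead x) by [].
  rewrite TF => -[i _ Fi].
  have : [set: n.-tuple R] [tuple of behead x] by [].
  rewrite TG => -[j _ Gj].
  exists (maxn i j) => //; split.
    by apply: (subsetPset _ _ (ndF _ _ (leq_maxl i j))).
  by apply: (subsetPset _ _ (ndG _ _ (leq_maxr i j))).
move=> k; have [mF Fk] := Foo k; have [mG Gk] := Goo k; split.
  apply: measurableI.
    rewrite -[X in measurable X]setTI.
    by apply: (@measurable_tnth _ R n.+1 ord0).
  rewrite -[X in measurable X]setTI.
  by apply: (@measurable_behead _ R n).
by rewrite lebesgue_consE// lte_mul_pinfty// ge0_fin_numE.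
Qed.

HB.instance Definition _ := Measure_isSigmaFinite.Build _ _ _ lebesgue_cons
  lebesgue_cons_sigma_finite.

End lebesgue_cons.

Fixpoint lebesgue_tuple {R : realType} (n : nat) :
    {sigma_finite_measure set (n.-tuple R) -> \bar R} :=
  if n is m.+1 then lebesgue_cons (lebesgue_tuple m) else dirac [tuple].

(* The value on boxes characterizes the Lebesgue measure. *)
Lemma lebesgue_tuple_box {R : realType} (n : nat) (A : 'I_n -> set R) :
  (forall i, measurable (A i)) ->
  lebesgue_tuple n [set x | forall i, A i (tnth x i)] =
  (\prod_(i < n) lebesgue_measure (A i))%E.
Proof.
elim: n A => [|n IHn] A mA.
  rewrite big_ord0 /= diracE mem_set//=.
  by case.
rewrite big_ord_recl -(IHn (fun i => A (lift ord0 i)))//=.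
rewrite -lebesgue_consE//.
  congr (lebesgue_cons _ _); apply/seteqP; split => x /=.
    move=> Ax; split; first exact: Ax.
    by move=> i; rewrite tnth_behead (_ : inord _ = lift ord0 i)//;
      apply/val_inj; rewrite /= inordK// ltnS.
  move=> [A0 Ax] i; have [j ->|->] := unliftP ord0 i; last exact: A0.
  by have := Ax j; rewrite tnth_behead (_ : inord _ = lift ord0 j)//;
    apply/val_inj; rewrite /= inordK// ltnS.
rewrite [X in measurable X](_ : _ =
    \bigcap_(i in [set: 'I_n]) ((@tnth n R)^~ i @^-1` A (lift ord0 i))).
  apply: fin_bigcap_measurable => // i _.
  by rewrite -[X in measurable X]setTI; exact: measurable_tnth.
by apply/seteqP; split => x /= Ax i; [move=> _|]; exact: Ax.
Qed.

Section vectors.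
Context {R : realType} (n : nat).

(* [t *: x + (1 - t) *: y]; tuples carry no lmodType structure. *)
Definition conv_tuple (t : R) (x y : n.-tuple R) : n.-tuple R :=
  [tuple t * tnth x i + (1 - t) * tnth y i | i < n].

(* [0 * +oo = 0], so the inequality at [t = 0] and [t = 1] is trivial even when
   [H] is infinite at [x] or [y]. *)
Definition econvex (H : n.-tuple R -> \bar R) : Prop :=
  forall (x y : n.-tuple R) (t : R), 0 <= t <= 1 ->
    (H (conv_tuple t x y) <= t%:E * H x + (1 - t)%:E * H y)%E.

Definition log_concave (f : n.-tuple R -> R) : Prop :=
  exists H : n.-tuple R -> \bar R,
    [/\ forall x, H x != -oo%E, econvex H &
        forall x, (f x)%:E = expeR (- H x)].

Definition unconditional (f : n.-tuple R -> R) : Prop :=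
  forall (x : n.-tuple R) (delta : 'I_n -> R),
    (forall i, delta i = 1 \/ delta i = -1) ->
    f x = f [tuple delta i * tnth x i | i < n].

End vectors.

Section random_vectors.
Context d (T : measurableType d) {R : realType} (P : probability T R).

(* Borel measurability of [f] costs no generality in the log-concave case:
   setting [f] to 0 outside the interior of its support makes it Borel,
   changes it on a null set only, and preserves log-concavity and symmetry. *)
Definition has_density (n : nat) (X : {RV P >-> n.-tuple R})
    (f : n.-tuple R -> R) : Prop :=
  [/\ measurable_fun [set: n.-tuple R] f, forall x, 0 <= f x &
      forall A, measurable A ->
        distribution P X A = (\int[lebesgue_tuple n]_(x in A) (f x)%:E)%E].

Definition gauss_mass (a b : R) : \bar R :=
  ((Num.sqrt (2 * pi))^-1%:E *
    \int[lebesgue_measure]_(t in `[a, b]) (expR (- (t ^+ 2) / 2)%R)%:E)%E.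

(* The supremum is taken in [\bar R], hence is never a default value. *)
Definition gauss_discrepancy (Y : T -> R) : \bar R :=
  ereal_sup [set `|P [set w | (ab.1 <= Y w <= ab.2)%R]
                   - gauss_mass ab.1 ab.2|
            | ab in [set ab : R * R | (ab.1 <= ab.2)%R]]%E.

End random_vectors.

(* Main.v *)
Require Import Defs.
From HB Require Import structures.
From mathcomp Require Import all_boot all_order all_algebra.
From mathcomp Require Import all_classical all_reals all_analysis.
From mathcomp Require Import measurable_realfun ring lra.

Set Implicit Arguments.
Unset Strict Implicit.
Unset Printing Implicit Defensive.

Import Order.TTheory GRing.Theory Num.Theory.
Import numFieldNormedType.Exports.

Local Open Scope classical_set_scope.
Local Open Scope ring_scope.

(** Write S for the linear form sum theta_i X_i, F for its distribution function, G for the Gaussian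
    one, and kappa for sum theta_i^4. Two quantities must be of order kappa: the difference of the
    characteristic functions, and the loss in returning from characteristic functions to
    distribution functions.

    Characteristic functions. By unconditionality E cos(t S) is the expectation of the product of
    the cos(u_i), u_i = t theta_i X_i. This product is compared with q = exp(-M), where M is the sum
    of max(0, u_i^2/2 - u_i^4): q dominates it in absolute value and differs from it by at most 4 q
    sum u_i^4. Jensen's inequality gives E q >= exp(-t^2/2). An unconditional log-concave density
    decreases in each |x_i|, hence satisfies f(x) f(y) <= f(z)^2 when z is the mean of x and y in
    the coordinates sqrt |x_i|. In these coordinates Lebesgue measure acquires the density 2y in
    each variable, whose strict log-concavity is a gain in the Prekopa-Leindler inequality, recorded
    by [sqrt_weight]. The result, [expectation_sqrt_mean], says E exp(-g) E exp(r) <= 1 as soon as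
    exp(r(y) - g(x)) is at most the product of the weights. With g = 2M and r = sum (u_i^2 - K
    u_i^4), which [cut_exponent_transport] allows, Jensen's inequality for r yields E q^2 <=
    exp(-t^2 + O(kappa t^4)). Hence the characteristic functions differ by O(kappa t^4 exp(-t^2/4))
    for t^2 up to order 1/kappa ([characteristic_function_bound],
    [characteristic_function_linear_form]). Moments of order 4 and 8 are bounded by Prekopa-Leindler
    for midpoints.

    Smoothing. At scale h of order sqrt kappa, the averages of F and of G against a band-limited
    Jackson kernel differ by O(kappa) ([smoothed_cdf_diff]). Undoing the average would in general
    cost a term of order h. Here F is log-concave, again by Prekopa-Leindler, so around a point
    where F - G is nearly minimal its second differences of step u are bounded above by O(u^2);
    since the kernel has a finite second moment, the cost is of order h^2, that is of order kappa
    ([near_extremum_le]). The identities F(-x) = 1 - F(x) and G(-x) = 1 - G(x) reduce maxima to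
    minima. The bound in 1/n is the case of equal coefficients. *)

(** * Lebesgue measure on the line: affine maps and the layer-cake formula *)

Lemma lebesgue_measure_affine (R : realType) (a b : R) (A : set R) :
  0 < a -> measurable A ->
  (lebesgue_measure ((fun x => a * x + b)%R @^-1` A) =
   a^-1%:E * lebesgue_measure A)%E.
Proof.
move=> a0 mA.
have mf : measurable_fun [set: measurableTypeR R]
    ((fun x => a * x + b) : measurableTypeR R -> measurableTypeR R).
  by apply: measurable_funD => //; exact: measurable_funM.
pose f := (fun x => a * x + b) : measurableTypeR R -> measurableTypeR R.
pose nu' := mscale (NngNum (ltW a0)) (pushforward (@lebesgue_measure R) f).
pose nu := nu' mf.
have -> : lebesgue_measure A = nu A.
  apply: lebesgue_measure_unique => //= _ [[c e]] _ <-.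
  have E : (fun x => a * x + b) @^-1` `]c, e]%classic = `](c - b) / a, (e - b) / a]%classic.
    apply/seteqP; split => x /=; rewrite !in_itv/= ltr_pdivrMr// ler_pdivlMr//;
      by rewrite ltrBlDr lerBrDr (mulrC x).
  transitivity (a%:E * lebesgue_measure `]((c - b) / a)%R, ((e - b) / a)%R]%classic)%E; last first.
    by rewrite -E.
  rewrite !lebesgue_measure_itv/= !lte_fin ltr_pM2r ?invr_gt0// ltrD2r.
  case: ifP => _; last by rewrite mule0.
  rewrite -!EFinD -EFinM -mulrBl opprB addrA subrK mulrCA divff ?mulr1//.
  by rewrite gt_eqF.
rewrite /nu /nu' /mscale /pushforward/= muleA -EFinM mulVf ?mul1e//.
by rewrite gt_eqF.
Qed.

(** Tonelli's theorem for the region under the graph, the set [S] of pairs (x, s) with 0 < s < f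
    x. *)
Lemma layer_cake d (T : measurableType d) (R : realType)
    (mu : {sigma_finite_measure set T -> \bar R}) (f : T -> \bar R) :
  measurable_fun [set: T] f -> (forall x, 0 <= f x)%E ->
  (\int[mu]_x f x =
   \int[lebesgue_measure]_(s in `]0%R, +oo[) mu [set x | s%:E < f x])%E.
Proof.
move=> mf f0.
pose S := [set p : T * measurableTypeR R | (0 < p.2%:E)%E /\ (p.2%:E < f p.1)%E].
have mS : measurable S.
  have m1 : measurable_fun [set: T * measurableTypeR R]
      (fun p : T * measurableTypeR R => f p.1).
    by apply: measurableT_comp => //; exact: measurable_fst.
  have m2 : measurable_fun [set: T * measurableTypeR R]
      (fun p : T * measurableTypeR R => p.2%:E : \bar R).
    by apply/measurable_EFinP; exact: measurable_snd.
  have -> : S = [set p | (0 < p.2%:E)%E] `&` [set p | (p.2%:E < f p.1)%E] by [].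
  apply: measurableI.
    rewrite -[X in measurable X]setTI.
    have := measurable_lte (@measurableT _ (T * measurableTypeR R)%type)
      (@measurable_cst _ _ _ _ setT 0%E) m2.
    by rewrite setTI.
  by have := measurable_lte measurableT m2 m1; rewrite setTI.
have mI : measurable_fun [set: T * measurableTypeR R]
    (fun p => (\1_S p)%:E : \bar R).
  by apply/measurable_EFinP; exact: measurable_indic.
transitivity (\int[mu]_x \int[@lebesgue_measure R]_s (\1_S (x, s))%:E)%E.
  apply: eq_integral => x _.
  have -> : (fun s => (\1_S (x, s))%:E) =
      (fun s : R => (\1_[set t : R | (0 < t%:E < f x)%E] s)%:E) :> (R -> \bar R).
    apply/funext => s; congr (_%:E); rewrite !indicE; congr (_%:R).
    congr nat_of_bool.
    by apply/idP/idP; rewrite !inE /S/=; [move=> [-> ->]|move/andP].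
  have -> : [set t : R | (0 < t%:E < f x)%E] =
      [set` Interval (BRight 0) (if f x is r%:E then BLeft r else +oo%O)].
    have := f0 x; case: (f x) => [r| |]//= _; apply/seteqP; split => t /=;
      by rewrite in_itv/= ?lte_fin ?ltry.
  rewrite integral_indic//= setIT lebesgue_measure_itv/=.
  have := f0 x; case: (f x) => [r| |]//=; rewrite ?lte_fin.
    rewrite lee_fin le_eqVlt => /orP[/eqP <-|r0]; first by rewrite ltxx.
    by rewrite r0 -EFinD subr0.
  by rewrite ltry oppr0 addye.
rewrite (fubini_tonelli (fun p => (\1_S p)%:E : \bar R))//.
rewrite [RHS]integral_mkcond; apply: eq_integral => s _.
have e1 : (fun x => (\1_S (x, s))%:E) = (fun x => (\1_(ysection S s) x)%:E) :> (T -> \bar R).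
  apply/funext => x; congr (_%:E); rewrite !indicE.
  by have -> : ((x, s) \in S) = (x \in ysection S s) by rewrite mem_ysection.
rewrite e1 integral_indic//=; last exact: measurable_ysection.
rewrite setIT patchE; case: ifPn => hs.
  congr (mu _); apply/seteqP; split => x; rewrite /ysection/= inE /S/=; first by case.
  by move=> sf; split => //; move: hs; rewrite inE/= in_itv/= andbT lte_fin.
have -> : ysection S s = set0; last by rewrite measure0.
rewrite -subset0 => x; rewrite /ysection/= inE /S/= => -[s0 _].
by move: hs; rewrite notin_setE/= in_itv/= andbT; apply; rewrite -lte_fin.
Qed.

Lemma measurable_superlevel d (T : measurableType d) (R : realType)
    (mu : {sigma_finite_measure set T -> \bar R}) (f : T -> \bar R) :
  measurable_fun [set: T] f ->
  measurable_fun [set: R] (fun s : R => mu [set x | s%:E < f x]%E).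
Proof.
move=> mf.
pose S := [set p : T * measurableTypeR R | (p.2%:E < f p.1)%E].
have mS : measurable S.
  have m1 : measurable_fun [set: T * measurableTypeR R]
      (fun p : T * measurableTypeR R => f p.1).
    by apply: measurableT_comp => //; exact: measurable_fst.
  have m2 : measurable_fun [set: T * measurableTypeR R]
      (fun p : T * measurableTypeR R => p.2%:E : \bar R).
    by apply/measurable_EFinP; exact: measurable_snd.
  by have := measurable_lte measurableT m2 m1; rewrite setTI.
have := measurable_fun_ysection mu mS.
congr measurable_fun; apply/funext => s /=; congr (mu _).
by apply/seteqP; split => x; rewrite /ysection/= inE.
Qed.

(** * Brunn-Minkowski inequality on the line *)

Section midpoint_prekopa_leindler.
Context {R : realType}.
Local Notation mu := (@lebesgue_measure R).

Lemma lebesgue_measure_shift (b : R) (A : set R) : measurable A ->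
  mu ((fun x => x + b) @^-1` A) = mu A.
Proof.
move=> mA; have := lebesgue_measure_affine b (@ltr01 R) mA.
rewrite invr1 mul1e => <-; congr (mu _).
by apply/seteqP; split => x /=; rewrite mul1r.
Qed.

(** Translate [K] by min L and [L] by max K: both copies lie in K + L, hence in 2C, and they can
    meet only in the point max K + min L, so their measures add up. *)
Let brunn_minkowski_compact (K L C : set R) :
  compact K -> compact L -> measurable C -> K !=set0 -> L !=set0 ->
  (forall a b, K a -> L b -> C ((a + b) / 2)) ->
  (mu K + mu L <= 2%:E * mu C)%E.
Proof.
move=> cK cL mC K0 L0 KLC.
have mK : measurable K by apply: closed_measurable; apply: compact_closed.
have mL : measurable L by apply: closed_measurable; apply: compact_closed.
have [a1 Ka1 a1max] : exists2 a, K a & forall x, K x -> x <= a.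
  have [a Ka ha] := compact_EVT_max K0 cK (continuous_subspaceT (fun=> cvg_id)).
  by exists a; [move: Ka; rewrite inE|move=> x Kx; apply: ha; rewrite inE].
have [b0 Lb0 b0min] : exists2 b, L b & forall x, L x -> b <= x.
  have [b Lb hb] := compact_EVT_min L0 cL (continuous_subspaceT (fun=> cvg_id)).
  by exists b; [move: Lb; rewrite inE|move=> x Lx; apply: hb; rewrite inE].
pose K1 := (fun x => x - b0) @^-1` K; pose L1 := (fun x => x - a1) @^-1` L.
have mK1 : measurable K1.
  by rewrite -[X in measurable X]setTI; exact: measurable_funD.
have mL1 : measurable L1.
  by rewrite -[X in measurable X]setTI; exact: measurable_funD.
pose D := (fun x => 2^-1 * x + 0) @^-1` C.
have <- : mu D = (2%:E * mu C)%E by rewrite lebesgue_measure_affine// invrK.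
rewrite -(lebesgue_measure_shift (- b0) mK) -(lebesgue_measure_shift (- a1) mL).
rewrite -/K1 -/L1.
have sing : K1 `&` L1 `<=` [set a1 + b0].
  move=> x [/a1max h1 /b0min h2] /=.
  by apply/eqP; rewrite eq_le; apply/andP; split; lra.
have IK0 : mu (L1 `&` K1) = 0%E.
  apply/eqP; rewrite -measure_le0 -(lebesgue_measure_set1 (a1 + b0)).
  apply: le_measure; rewrite ?inE//; last by rewrite setIC.
  exact: measurableI.
rewrite (measureDI mu mL1 mK1) [X in (_ + (_ + X))%E]IK0 adde0 -measureU//; last 2 first.
- exact: measurableD.
- by rewrite setDIK.
apply: le_measure; rewrite ?inE.
- by apply: measurableU => //; exact: measurableD.
- by rewrite -[X in measurable X]setTI; apply: measurable_funD => //; exact: measurable_funM.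
- move=> x [K1x|[L1x _]]; rewrite /D/=.
    rewrite addr0 mulrC; have -> : x / 2 = ((x - b0) + b0) / 2 by rewrite subrK.
    exact: KLC.
  rewrite addr0 mulrC; have -> : x / 2 = (a1 + (x - a1)) / 2 by rewrite subrKC.
  exact: KLC.
Qed.

(** Reduction to compact sets by inner regularity; the points [a] and [b] are adjoined to the
    compact subsets to keep them nonempty. *)
Lemma brunn_minkowski_midpoint (A B C : set R) :
  measurable A -> measurable B -> measurable C -> A !=set0 -> B !=set0 ->
  (forall a b, A a -> B b -> C ((a + b) / 2)) ->
  (mu A + mu B <= 2%:E * mu C)%E.
Proof.
move=> mA mB mC [a Aa] [b Bb] ABC.
have [->|Cfin] := eqVneq (mu C) +oo%E; first by rewrite mulry gtr0_sg// mul1e leey.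
have {}Cfin : (2%:E * mu C)%E \is a fin_num.
  by rewrite fin_numM// ge0_fin_numE// ltey.
have KL K L : compact K -> K `<=` A -> compact L -> L `<=` B ->
    (mu K + mu L <= 2%:E * mu C)%E.
  move=> cK KA cL LB.
  have cK' : compact (K `|` [set a]) by apply: compactU => //; exact: compact_set1.
  have cL' : compact (L `|` [set b]) by apply: compactU => //; exact: compact_set1.
  apply: (@le_trans _ _ (mu (K `|` [set a]) + mu (L `|` [set b]))%E).
    apply: leeD; apply: le_measure; rewrite ?inE;
      by [apply: closed_measurable; apply: compact_closed|move=> x; left].
  apply: brunn_minkowski_compact => //.
  - by exists a; right.
  - by exists b; right.
  - by move=> x y [/KA Ax|->] [/LB By|->]; apply: ABC.
have c0 : compact (@set0 R) by exact: compact0.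
have KL1 K : compact K -> K `<=` A -> (mu K + mu B <= 2%:E * mu C)%E.
  move=> cK KA; have muK : mu K \is a fin_num.
    rewrite ge0_fin_numE//; apply: le_lt_trans (_ : 2%:E * mu C < +oo)%E; last by rewrite ltey_eq Cfin.
    by have := KL K set0 cK KA c0 (@sub0set _ _); rewrite measure0 adde0.
  rewrite addeC -leeBrDr//.
  rewrite (lebesgue_regularity_inner_sup mB); apply: ge_ereal_sup => _ [L [cL LB] <-].
  by rewrite leeBrDr// addeC; exact: KL.
have muB : mu B \is a fin_num.
  rewrite ge0_fin_numE//; apply: le_lt_trans (_ : 2%:E * mu C < +oo)%E; last by rewrite ltey_eq Cfin.
  by have := KL1 set0 c0 (@sub0set _ _); rewrite measure0 add0e.
rewrite -leeBrDr//.
rewrite (lebesgue_regularity_inner_sup mA); apply: ge_ereal_sup => _ [K [cK KA] <-].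
by rewrite leeBrDr//; exact: KL1.
Qed.

End midpoint_prekopa_leindler.

(** * Prekopa-Leindler inequality on the line *)

Section prekopa_leindler_line.
Context {R : realType}.
Local Notation mu := (@lebesgue_measure R).

(** When [f] and [g] both have supremum 1, their superlevel sets at heights s < 1 are nonempty and
    Brunn-Minkowski applies to them; integrating over s gives an additive form of the inequality. *)
Let pl_normalized (f g h : R -> \bar R) :
  measurable_fun [set: R] f -> measurable_fun [set: R] g ->
  measurable_fun [set: R] h ->
  (forall x, 0 <= f x <= 1)%E -> (forall x, 0 <= g x <= 1)%E ->
  (forall x, 0 <= h x)%E ->
  (forall s : R, s < 1 -> exists x, (s%:E < f x)%E) ->
  (forall s : R, s < 1 -> exists x, (s%:E < g x)%E) ->
  (forall (s : R) x y, 0 < s ->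
    (s%:E < f x -> s%:E < g y -> s%:E < h ((x + y) / 2)%R)%E) ->
  (\int[mu]_x f x + \int[mu]_x g x <= 2%:E * \int[mu]_x h x)%E.
Proof.
move=> mf mg mh f01 g01 h0 f1 g1 fgh.
have f0 x : (0 <= f x)%E by have /andP[] := f01 x.
have g0 x : (0 <= g x)%E by have /andP[] := g01 x.
rewrite (layer_cake mu mf f0) (layer_cake mu mg g0) (layer_cake mu mh h0).
have msl (k : R -> \bar R) : measurable_fun [set: R] k ->
    measurable_fun (`]0, +oo[%classic : set R) (fun s : R => mu [set x | s%:E < k x]%E).
  by move=> mk; apply: measurable_funTS; exact: measurable_superlevel.
rewrite -ge0_integralD//; [|exact: msl..].
rewrite -ge0_integralZl//; [|exact: msl..].
apply: ge0_le_integral => //.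
- by move=> s _; rewrite adde_ge0.
- by apply: emeasurable_funD; exact: msl.
- by apply: emeasurable_funM => //; exact: msl.
move=> s; rewrite /= in_itv/= andbT => s0.
have mS (k : R -> \bar R) : measurable_fun [set: R] k -> measurable [set x | s%:E < k x]%E.
  by move=> mk; rewrite -[X in measurable X]setTI; exact: emeasurable_fun_o_infty.
have [s1|s1] := ltP s 1.
  apply: brunn_minkowski_midpoint; [exact: mS..| | | ].
  - exact: f1.
  - exact: g1.
  - by move=> a b /=; exact: fgh.
have -> : [set x | s%:E < f x]%E = set0.
  rewrite -subset0 => x /=; apply/negP; rewrite -leNgt.
  by have /andP[_ /le_trans->//] := f01 x; rewrite lee_fin.
have -> : [set x | s%:E < g x]%E = set0.
  rewrite -subset0 => x /=; apply/negP; rewrite -leNgt.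
  by have /andP[_ /le_trans->//] := g01 x; rewrite lee_fin.
by rewrite !measure0 adde0 mule_ge0.
Qed.

Lemma ge0_integral_min_le d (T : measurableType d)
    (nu : {measure set T -> \bar R}) (f : T -> \bar R) (e : \bar R) :
  measurable_fun [set: T] f -> (forall x, 0 <= f x)%E ->
  (forall k : nat, \int[nu]_x mine (f x) k%:R%:E <= e)%E ->
  (\int[nu]_x f x <= e)%E.
Proof.
move=> mf f0 le_e.
have <- : limn (fun k : nat => \int[nu]_x mine (f x) k%:R%:E)%E = (\int[nu]_x f x)%E.
  rewrite -monotone_convergence//.
  - apply: eq_integral => x _; apply/cvg_lim => //.
    case fx : (f x) => [r| |]; last by have := f0 x; rewrite fx.
      apply: cvg_near_cst; near=> k; rewrite /mine; case: ifPn => //.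
      rewrite -leNgt lee_fin => kr; exfalso.
      have : r < k%:R by near: k; exact: nbhs_infty_gtr.
      by rewrite ltNge kr.
    under eq_fun do rewrite /mine ltNge leey/=.
    by apply/(cvgenyP id); exact: cvg_id.
  - by move=> k; apply: measurable_mine.
  - by move=> k x _; rewrite le_min f0 lee_fin ler0n.
  - move=> x _ j k jk; rewrite le_min ge_min lexx/= ge_min.
    by rewrite lee_fin ler_nat jk orbT.
apply: lime_le; last by near=> k.
apply: ereal_nondecreasing_is_cvgn => j k jk; apply: ge0_le_integral => //.
- by move=> x _; rewrite le_min f0 lee_fin ler0n.
- by apply: measurable_mine.
- by apply: measurable_mine.
- move=> x _; rewrite le_min ge_min lexx/= ge_min.
  by rewrite lee_fin ler_nat jk orbT.
Unshelve. all: by end_near. Qed.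

Lemma ge0_integral_min_mulr_le d (T : measurableType d)
    (nu : {measure set T -> \bar R}) (f : T -> \bar R) (c e : \bar R) :
  measurable_fun [set: T] f -> (forall x, 0 <= f x)%E -> (0 <= c)%E ->
  (forall k : nat, (\int[nu]_x mine (f x) k%:R%:E) * c <= e)%E ->
  ((\int[nu]_x f x) * c <= e)%E.
Proof.
move=> mf f0 c0 le_e.
have m0 (k : nat) x : (0 <= mine (f x) k%:R%:E)%E.
  by rewrite le_min f0 lee_fin ler0n.
have [->|cN0] := eqVneq c 0%E.
  by rewrite mule0; apply: le_trans (le_e 0%N); rewrite mule_ge0// integral_ge0.
have {cN0} c0 : (0 < c)%E by rewrite lt_def cN0.
case: c c0 le_e => [c| |]// c0 le_e.
  rewrite -lee_pdivlMr//; apply: ge0_integral_min_le => // k.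
  by rewrite lee_pdivlMr.
have [->|eoo] := eqVneq e +oo%E; first by rewrite leey.
suff -> : (\int[nu]_x f x = 0)%E.
  rewrite mul0e; apply: le_trans (le_e 0%N).
  by rewrite mule_ge0// integral_ge0.
apply/eqP; rewrite eq_le integral_ge0// andbT; apply: ge0_integral_min_le => // k.
rewrite leNgt; apply/negP => I0; have := le_e k.
by rewrite gt0_muley// leye_eq (negbTE eoo).
Qed.

(** Dividing [f] and [g] by their suprema [a] and [b], finite by boundedness, and [h] by sqrt(a b)
    reduces to the normalized case; the arithmetic-geometric mean inequality turns the sum of the
    integrals into their product. *)
Let pl_bounded (f g h : R -> \bar R) (M : R) :
  measurable_fun [set: R] f -> measurable_fun [set: R] g ->
  measurable_fun [set: R] h ->
  (forall x, 0 <= f x <= M%:E)%E -> (forall x, 0 <= g x <= M%:E)%E ->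
  (forall x, 0 <= h x)%E ->
  (forall x y, f x * g y <= h ((x + y) / 2)%R * h ((x + y) / 2)%R)%E ->
  ((\int[mu]_x f x) * (\int[mu]_x g x) <= (\int[mu]_x h x) * \int[mu]_x h x)%E.
Proof.
move=> mf mg mh f0M g0M h0 fgh.
have f0 x : (0 <= f x)%E by have /andP[] := f0M x.
have g0 x : (0 <= g x)%E by have /andP[] := g0M x.
have H0 : (0 <= \int[mu]_x h x)%E by apply: integral_ge0.
have HH0 : (0 <= (\int[mu]_x h x) * \int[mu]_x h x)%E by rewrite mule_ge0.
have key (k : R -> \bar R) : (forall x, 0 <= k x <= M%:E)%E ->
    (\int[mu]_x k x = 0)%E \/ exists a : R, [/\ 0 < a,
      (forall x, 0 <= a^-1%:E * k x <= 1)%E &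
      forall s : R, s < 1 -> exists x, (s%:E < a^-1%:E * k x)%E].
  move=> k0M; have [k0|] := pselect (forall x, k x = 0%E).
    by left; rewrite (eq_integral (cst 0%E))// integral0.
  move=> /existsNP[x0 /eqP kx0]; right.
  pose S := ereal_sup (range k).
  have S0 : (0 < S)%E.
    apply: (@lt_le_trans _ _ (k x0)); last by apply: ereal_sup_ubound; exists x0.
    by rewrite lt_def kx0; have /andP[] := k0M x0.
  have SM : (S <= M%:E)%E.
    by apply: ge_ereal_sup => _ [x _ <-]; have /andP[] := k0M x.
  have SE : S = (fine S)%:E.
    by rewrite fineK// ge0_fin_numE ?(ltW S0)// (le_lt_trans SM)// ltry.
  have a0 : 0 < fine S by rewrite -lte_fin -SE.
  exists (fine S); split => //.
    move=> x; have /andP[kx0' kxM] := k0M x.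
    rewrite mule_ge0 ?lee_fin ?invr_ge0 ?(ltW a0)//=.
    rewrite muleC lee_pdivrMr// mul1e -SE; apply: ereal_sup_ubound; by exists x.
  move=> s s1.
  have : ((s * fine S)%:E < S)%E by rewrite SE lte_fin -[ltRHS]mul1r ltr_pM2r.
  move=> /ereal_sup_gt[_ [x _ <-]] hx; exists x.
  by rewrite muleC lte_pdivlMr// -EFinM.
have [->|[a [a0 fa1 fa2]]] := key f f0M; first by rewrite mul0e.
have [->|[b [b0 gb1 gb2]]] := key g g0M; first by rewrite mule0.
pose c := Num.sqrt (a * b).
have c0 : 0 < c by rewrite sqrtr_gt0 mulr_gt0.
have cab : c ^+ 2 = a * b by rewrite sqr_sqrtr// mulr_ge0// ltW.
have := @pl_normalized (fun x => a^-1%:E * f x)%E (fun x => b^-1%:E * g x)%E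
   (fun x => c^-1%:E * h x)%E.
move=> /(_ _ _ _ fa1 gb1 _ fa2 gb2)/=.
rewrite !ge0_integralZl//; try by rewrite lee_fin invr_ge0 ltW.
move=> pl.
have {}pl : (a^-1%:E * \int[mu]_x f x + b^-1%:E * \int[mu]_x g x <=
    2%:E * (c^-1%:E * \int[mu]_x h x))%E.
  apply: pl.
  - by apply: emeasurable_funM.
  - by apply: emeasurable_funM.
  - by apply: emeasurable_funM.
  - by move=> x; rewrite mule_ge0// lee_fin invr_ge0 ltW.
  move=> s x y s0; rewrite (muleC a^-1%:E) (muleC b^-1%:E) (muleC c^-1%:E).
  rewrite !lte_pdivlMr// -!EFinM => sf sg.
  rewrite ltNge; apply/negP => hs.
  have := fgh x y; apply/negP; rewrite -ltNge.
  apply: (@le_lt_trans _ _ ((s * c)%:E * (s * c)%:E)%E).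
    by apply: lee_pmul.
  have -> : ((s * c)%:E * (s * c)%:E = (s * a)%:E * (s * b)%:E)%E.
    rewrite -!EFinM; congr (_%:E).
    by rewrite mulrACA -[c * c]expr2 cab mulrACA.
  by apply: lte_pmul; rewrite // lee_fin mulr_ge0// ltW.
have [->|Hoo] := eqVneq (\int[mu]_x h x)%E +oo%E; first by rewrite mulyy leey.
move: pl H0 Hoo.
have : (0 <= \int[mu]_x f x)%E by apply: integral_ge0.
have : (0 <= \int[mu]_x g x)%E by apply: integral_ge0.
case: (\int[mu]_x h x)%E => [H| |]//.
have aoo : (a^-1%:E * +oo = +oo)%E by rewrite gt0_muley// lte_fin invr_gt0.
have boo : (b^-1%:E * +oo = +oo)%E by rewrite gt0_muley// lte_fin invr_gt0.
case: (\int[mu]_x f x)%E => [F| |]//; case: (\int[mu]_x g x)%E => [G| |]// + +;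
  rewrite ?aoo ?boo ?addye ?addey ?leye_eq// => G0 F0.
rewrite -!EFinM -!EFinD !lee_fin => pl H0 _.
move: G0 F0; rewrite !lee_fin => G0 F0.
have e1 : (a^-1 * F + b^-1 * G) ^+ 2 <= (2 * (c^-1 * H)) ^+ 2.
  by rewrite ler_sqr// nnegrE ?addr_ge0 ?mulr_ge0// ?invr_ge0 ltW.
have e2 : 4 * (a^-1 * F) * (b^-1 * G) <= (a^-1 * F + b^-1 * G) ^+ 2.
  by rewrite -subr_ge0; have := sqr_ge0 (a^-1 * F - b^-1 * G); nra.
have : 4 * (a^-1 * F) * (b^-1 * G) * (a * b) <= (2 * (c^-1 * H)) ^+ 2 * c ^+ 2.
  by rewrite cab ler_pM2r ?mulr_gt0//; exact: le_trans e1.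
have -> : 4 * (a^-1 * F) * (b^-1 * G) * (a * b) = 4 * (F * G).
  by field; rewrite !gt_eqF.
have -> : (2 * (c^-1 * H)) ^+ 2 * c ^+ 2 = 4 * (H * H).
  by field; rewrite !gt_eqF.
by rewrite ler_pM2l.
Qed.

(** Truncating [f] and [g] at integer heights preserves the hypothesis, and monotone convergence
    removes the truncation from one factor at a time. *)
Lemma prekopa_leindler_line (f g h : R -> \bar R) :
  measurable_fun [set: R] f -> measurable_fun [set: R] g ->
  measurable_fun [set: R] h ->
  (forall x, 0 <= f x)%E -> (forall x, 0 <= g x)%E -> (forall x, 0 <= h x)%E ->
  (forall x y, f x * g y <= h ((x + y) / 2)%R * h ((x + y) / 2)%R)%E ->
  ((\int[mu]_x f x) * (\int[mu]_x g x) <= (\int[mu]_x h x) * \int[mu]_x h x)%E.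
Proof.
move=> mf mg mh f0 g0 h0 fgh.
apply: ge0_integral_min_mulr_le => //; first exact: integral_ge0.
move=> j; rewrite muleC; apply: ge0_integral_min_mulr_le => //.
  by apply: integral_ge0 => x _; rewrite le_min f0 lee_fin ler0n.
move=> k; rewrite muleC; apply: (@pl_bounded _ _ _ (maxn j k)%:R) => //.
- exact: measurable_mine.
- exact: measurable_mine.
- move=> x; rewrite le_min f0 lee_fin ler0n/= ge_min lee_fin ler_nat.
  by rewrite leq_maxl orbT.
- move=> x; rewrite le_min g0 lee_fin ler0n/= ge_min lee_fin ler_nat.
  by rewrite leq_maxr orbT.
move=> x y; apply: le_trans (fgh x y); apply: lee_pmul.
- by rewrite le_min f0 lee_fin ler0n.
- by rewrite le_min g0 lee_fin ler0n.
- by rewrite ge_min lexx.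
- by rewrite ge_min lexx.
Qed.

End prekopa_leindler_line.

(** * Weighted Prekopa-Leindler inequalities and their tensorization *)

(** Means are a relation, so that one pair may have several means, such as a point and its
    reflection. A weight above 1 weakens the pointwise hypothesis and is thus a gain. *)
Definition prekopa_leindler_property d (T : measurableType d) (R : realType)
    (mu : {measure set T -> \bar R}) (mean : T -> T -> T -> Prop)
    (w : T -> T -> R) : Prop :=
  forall f g h : T -> \bar R,
  measurable_fun [set: T] f -> measurable_fun [set: T] g ->
  measurable_fun [set: T] h ->
  (forall x, 0 <= f x)%E -> (forall x, 0 <= g x)%E -> (forall x, 0 <= h x)%E ->
  (forall x y z, mean x y z -> f x * g y <= (w x y)%:E * (h z * h z))%E ->
  ((\int[mu]_x f x) * (\int[mu]_x g x) <= (\int[mu]_x h x) * \int[mu]_x h x)%E.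

Section tensorization.
Context {R : realType}.

Lemma ge0_integral_lebesgue_tupleS (n : nat) (f : n.+1.-tuple R -> \bar R) :
  measurable_fun [set: n.+1.-tuple R] f -> (forall x, 0 <= f x)%E ->
  (\int[lebesgue_tuple n.+1]_x f x =
   \int[@lebesgue_measure R]_a \int[lebesgue_tuple n]_t f (consT (a, t)))%E.
Proof.
move=> mf f0; rewrite [LHS]ge0_integral_pushforward//; last exact: measurable_consT.
rewrite preimage_setT.
rewrite (fubini_tonelli1 (f \o @consT R n))//.
- by apply: measurableT_comp => //; exact: measurable_consT.
- by move=> x; exact: f0.
Qed.

Lemma measurable_lebesgue_tupleS_section (n : nat) (f : n.+1.-tuple R -> \bar R) :
  measurable_fun [set: n.+1.-tuple R] f -> forall a : R,
  measurable_fun [set: n.-tuple R] (fun t => f (consT (a, t))).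
Proof.
move=> mf a; apply: measurableT_comp => //.
apply: (measurableT_comp (@measurable_consT R n)).
exact: measurable_pair1.
Qed.

Lemma measurable_integral_lebesgue_tupleS (n : nat) (f : n.+1.-tuple R -> \bar R) :
  measurable_fun [set: n.+1.-tuple R] f -> (forall x, 0 <= f x)%E ->
  measurable_fun [set: R] (fun a => \int[lebesgue_tuple n]_t f (consT (a, t)))%E.
Proof.
move=> mf f0.
have := @measurable_fun_fubini_tonelli_F _ _ (measurableTypeR R) (n.-tuple R) R
  (lebesgue_tuple n) (f \o @consT R n).
apply => //; first by apply: measurableT_comp => //; exact: measurable_consT.
by move=> x; exact: f0.
Qed.

Definition tuple_mean (mean : R -> R -> R -> Prop) n (x y z : n.-tuple R) :=
  forall i, mean (tnth x i) (tnth y i) (tnth z i).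

Definition tuple_weight (w : R -> R -> R) n (x y : n.-tuple R) :=
  \prod_(i < n) w (tnth x i) (tnth y i).

(** Induction on the dimension: with first coordinates a, b and c fixed, the inductive hypothesis is
    applied to the sections, [h] being multiplied by sqrt (w a b). The integrals over the other
    coordinates then satisfy the one-dimensional hypothesis. *)
Lemma prekopa_leindler_tuple (mean : R -> R -> R -> Prop) (w : R -> R -> R) :
  (forall a b, 0 <= w a b) ->
  prekopa_leindler_property (@lebesgue_measure R) mean w ->
  forall n, prekopa_leindler_property (lebesgue_tuple n)
    (@tuple_mean mean n) (@tuple_weight w n).
Proof.
move=> w0 PL; elim=> [|n IHn] f g h mf mg mh f0 g0 h0 fgh.
  rewrite /= !integral_dirac// !diracT !mul1e.
  have := fgh [tuple] [tuple] [tuple].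
  rewrite /tuple_weight big_ord0 mul1e; apply.
  by case.
rewrite !ge0_integral_lebesgue_tupleS//.
apply: PL => //; try exact: measurable_integral_lebesgue_tupleS.
- by move=> a; exact: integral_ge0.
- by move=> a; exact: integral_ge0.
- by move=> a; exact: integral_ge0.
move=> a b c abc.
have sq : (Num.sqrt (w a b))%:E \is a fin_num by [].
have -> : ((w a b)%:E * (\int[lebesgue_tuple n]_t h (consT (c, t)) *
      \int[lebesgue_tuple n]_t h (consT (c, t))) =
   (\int[lebesgue_tuple n]_t ((Num.sqrt (w a b))%:E * h (consT (c, t)))) *
   (\int[lebesgue_tuple n]_t ((Num.sqrt (w a b))%:E * h (consT (c, t)))))%E.
  rewrite !ge0_integralZl_EFin//; last exact: measurable_lebesgue_tupleS_section.
  by rewrite muleACA -EFinM -expr2 sqr_sqrtr.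
apply: IHn.
- exact: measurable_lebesgue_tupleS_section.
- exact: measurable_lebesgue_tupleS_section.
- by apply: emeasurable_funM => //; exact: measurable_lebesgue_tupleS_section.
- by move=> t.
- by move=> t.
- by move=> t; rewrite mule_ge0// lee_fin sqrtr_ge0.
move=> x y z xyz; rewrite muleACA -EFinM -expr2 sqr_sqrtr//.
rewrite !muleA -EFinM -muleA (mulrC (tuple_weight _ _ _)).
have -> : w a b * tuple_weight w x y =
    tuple_weight w (consT (a, x)) (consT (b, y)).
  rewrite /tuple_weight big_ord_recl; congr (_ * _).
  apply: eq_bigr => i _; congr w.
    by rewrite /consT !(tnth_nth 0)/=.
  by rewrite /consT !(tnth_nth 0)/=.
apply: fgh => i; have [j ->|->] := unliftP ord0 i; last by rewrite /consT.
by have := xyz j; rewrite /consT !(tnth_nth 0)/=.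
Qed.

End tensorization.

Lemma prekopa_leindler_midpoint (R : realType) n :
  prekopa_leindler_property (@lebesgue_tuple R n)
    (@tuple_mean R (fun a b c => c = (a + b) / 2) n) (fun _ _ => 1).
Proof.
move=> f g h mf mg mh f0 g0 h0 fgh.
apply: (@prekopa_leindler_tuple R (fun a b c => c = (a + b) / 2) (fun _ _ => 1)) => //.
  move=> {}f {}g {}h {}mf {}mg {}mh {}f0 {}g0 {}h0 {}fgh.
  apply: prekopa_leindler_line => // x y.
  by have := fgh x y _ erefl; rewrite mul1e.
move=> x y z xyz; have := fgh x y z xyz.
by rewrite /tuple_weight big1.
Qed.

(** * Integration against a measure with a density *)

Section measure_with_density.
Local Open Scope ereal_scope.
Context d (T : measurableType d) (R : realType).
Variables (mu : {measure set T -> \bar R}) (p : T -> R).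
Hypotheses (mp : measurable_fun [set: T] p) (p0 : forall x, (0 <= p x)%R).

Definition density_measure (A : set T) : \bar R := \int[mu]_(x in A) (p x)%:E.

Let pE0 x : 0 <= (p x)%:E. Proof. by rewrite lee_fin. Qed.

Let mpE : measurable_fun [set: T] (EFin \o p).
Proof. exact/measurable_EFinP. Qed.

Let density_measure0 : density_measure set0 = 0.
Proof. by rewrite /density_measure integral_set0. Qed.

Let density_measure_ge0 A : 0 <= density_measure A.
Proof. exact: integral_ge0. Qed.

Let density_measure_sigma_additive : semi_sigma_additive density_measure.
Proof.
move=> F mF tF mUF; rewrite /density_measure ge0_integral_bigcup//; last first.
  exact: measurable_funTS.
by apply: is_cvg_ereal_nneg_natsum_cond => n _ _; exact: integral_ge0.
Qed.

HB.instance Definition _ := isMeasure.Build _ _ _ density_measure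
  density_measure0 density_measure_ge0 density_measure_sigma_additive.

Definition density_measure_pack : {measure set T -> \bar R} := density_measure.

Import HBNNSimple.

Lemma ge0_integral_density (nu : {measure set T -> \bar R}) (f : T -> \bar R) :
  (forall A, measurable A -> nu A = \int[mu]_(x in A) (p x)%:E) ->
  measurable_fun [set: T] f -> (forall x, 0 <= f x) ->
  \int[nu]_x f x = \int[mu]_x (f x * (p x)%:E).
Proof.
move=> nuE mf f0.
pose f_ := nnsfun_approx measurableT mf.
have f_cvg x : EFin \o f_ ^~ x @ \oo --> f x by exact: cvg_nnsfun_approx.
have nd_f x : nondecreasing_seq (fun n => (f_ n x)%:E).
  by move=> m n mn; rewrite lee_fin; exact/lefP/nd_nnsfun_approx.
transitivity (limn (fun n => \int[nu]_x (f_ n x)%:E)).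
  rewrite -monotone_convergence//.
  - by apply: eq_integral => x _; apply/esym/cvg_lim => //; exact: f_cvg.
  - by move=> n; exact/measurable_EFinP.
  - by move=> n x _; rewrite lee_fin.
have mfp n : measurable_fun [set: T] (fun x => (f_ n x)%:E * (p x)%:E).
  by apply: emeasurable_funM => //; exact/measurable_EFinP.
transitivity (limn (fun n => \int[mu]_x ((f_ n x)%:E * (p x)%:E))); last first.
  rewrite -monotone_convergence//.
  - by apply: eq_integral => x _; apply/cvg_lim => //; apply: cvgeZr => //; exact: f_cvg.
  - by move=> n x _; rewrite mule_ge0// lee_fin.
  - by move=> x _ m n mn; rewrite lee_wpmul2r//; exact: nd_f.
congr (limn _); apply/funext => n.
transitivity (\sum_(k \in range (f_ n))
    \int[nu]_x (k * \1_(f_ n @^-1` [set k]) x)%:E).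
  under eq_integral do rewrite fimfunE -fsumEFin//.
  rewrite ge0_integral_fsum//.
  - by move=> y; exact/measurable_EFinP/measurable_funM.
  - by move=> y x _; rewrite nnfun_muleindic_ge0.
transitivity (\sum_(k \in range (f_ n))
    \int[mu]_x ((k * \1_(f_ n @^-1` [set k]) x)%:E * (p x)%:E)).
  apply: eq_fsbigr => r; rewrite inE => -[x _ fx].
  have r0 : (0 <= r)%R by rewrite -fx.
  rewrite integralZl_indic_nnsfun// integral_indic// setIT nuE//.
  under [RHS]eq_integral do rewrite EFinM -muleA.
  rewrite ge0_integralZl_EFin//.
  - congr (_ * _); rewrite integral_mkcond; apply: eq_integral => y _.
    by rewrite patchE indicE; case: ifP => _; rewrite ?mul1e ?mul0e.
  - by move=> y _; rewrite mule_ge0// lee_fin.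
  - by apply: emeasurable_funM => //; exact/measurable_EFinP.
rewrite -ge0_integral_fsum//.
- apply: eq_integral => x _; rewrite [in RHS]fimfunE -fsumEFin//.
  by rewrite ge0_mule_fsuml// => r; rewrite nnfun_muleindic_ge0.
- move=> r; apply: emeasurable_funM => //.
  exact/measurable_EFinP/measurable_funM.
- by move=> r x _; rewrite mule_ge0// nnfun_muleindic_ge0.
Qed.

End measure_with_density.

(** * The change of variables x = y^2 on the positive half-line *)

Section square_substitution.
Context {R : realType}.
Local Notation mu := (@lebesgue_measure R).

Let sq (y : measurableTypeR R) : measurableTypeR R := (y : R) ^+ 2.
Let jac (y : measurableTypeR R) : R := 2 * Num.max (y : R) 0.

Let mjac : measurable_fun [set: measurableTypeR R] jac.
Proof. by apply: measurable_funM => //; exact: measurable_maxr. Qed.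

Let jac0 x : 0 <= jac x.
Proof. by rewrite mulr_ge0// le_max lexx orbT. Qed.

Let msq : measurable_fun [set: measurableTypeR R] sq.
Proof. exact: measurable_funX. Qed.

Let jac_itv (a b : R) :
  (\int[mu]_(y in sq @^-1` `]a, b]%classic) (jac y)%:E =
   (Num.max (Num.max b 0 - Num.max a 0) 0)%:E)%E.
Proof.
pose c := Num.sqrt a; pose e := Num.sqrt b.
have cE : c ^+ 2 = Num.max a 0.
  by rewrite /c; case: (leP a 0) => [/ler0_sqrtr->|/ltW/sqr_sqrtr//]; rewrite expr0n.
have eE : e ^+ 2 = Num.max b 0.
  by rewrite /e; case: (leP b 0) => [/ler0_sqrtr->|/ltW/sqr_sqrtr//]; rewrite expr0n.
have c0 : 0 <= c by exact: sqrtr_ge0.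
have e0 : 0 <= e by exact: sqrtr_ge0.
transitivity (\int[mu]_(y in `]c, e]%classic) (2 * y)%:E)%E.
  rewrite integral_mkcond [RHS]integral_mkcond; apply: eq_integral => y _.
  rewrite !patchE /jac; have [y0|y0] := leP y 0.
    rewrite mulr0 if_same memNset//= in_itv/=; apply/negP.
    by rewrite negb_and -leNgt (le_trans y0).
  have -> : (y \in sq @^-1` `]a, b]%classic) = (y \in `]c, e]%classic).
    have hc : (c < y) = (a < y ^+ 2).
      by rewrite -ltr_sqr ?nnegrE ?(ltW y0)// cE gt_max exprn_gt0// andbT.
    have he : (y <= e) = (y ^+ 2 <= b).
      by rewrite -ler_sqr ?nnegrE ?(ltW y0)// eE le_max [_ <= 0]leNgt exprn_gt0// orbF.
    by apply/idP/idP; rewrite !inE/= !in_itv/= hc he.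
  by [].
rewrite -cE -eE; have [ce|ec] := ltP c e; last first.
  rewrite set_itv_ge ?integral_set0; last by rewrite bnd_simp -leNgt.
  by rewrite max_r// subr_le0 ler_sqr.
rewrite max_l; last by rewrite subr_ge0 ler_sqr// ltW.
rewrite integral_itv_obnd_cbnd; last first.
  by apply: measurable_funTS; apply/measurable_EFinP; exact: measurable_funM.
rewrite (@continuous_FTC2 _ _ (fun x => x ^+ 2))//.
- by apply: continuous_subspaceT; exact: mulrl_continuous.
- split.
  + by move=> x _; exact: exprn_derivable.
  + by apply: cvg_at_right_filter; exact: exprn_continuous.
  + by apply: cvg_at_left_filter; exact: exprn_continuous.
- by move=> x _; rewrite exp_derive1 expr1.
Qed.

(** Follows from the uniqueness of Lebesgue measure: its restriction to the nonpositive half-line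
    plus the image under squaring of the measure of density 2 max(y, 0) gives each interval its
    length. *)
Lemma ge0_integral_square_substitution (f : R -> \bar R) :
  measurable_fun [set: R] f -> (forall x, 0 <= f x)%E ->
  (\int[mu]_(x in `]0%R, +oo[) f x =
   \int[mu]_(y in `]0%R, +oo[) (f (y ^+ 2)%R * (2 * y)%:E))%E.
Proof.
move=> mf f0.
pose dm := density_measure_pack mu mjac jac0.
have mN : measurable (`]-oo, 0]%classic : set (measurableTypeR R)) by exact: measurable_itv.
pose nu' := measure_add (mrestr mu mN) (pushforward dm sq).
pose nu := nu' msq.
have nuE A : measurable A -> mu A = nu A.
  apply: lebesgue_measure_unique => //= _ [[a b]] _ <-.
  transitivity (mu (`]a, b]%classic `&` `]-oo, 0%R]%classic) +
    \int[mu]_(y in sq @^-1` `]a, b]%classic) (jac y)%:E)%E; last first.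
    by rewrite [RHS](measure_addE _ _ _).
  rewrite jac_itv.
  have -> : (`]a, b]%classic `&` `]-oo, 0]%classic : set R) = `]a, Num.min b 0]%classic.
    apply/seteqP; split => x /=; rewrite !in_itv/= le_min.
      by move=> [/andP[-> ->] ->].
    by move=> /and3P[-> -> ->].
  rewrite !lebesgue_measure_itv/= !lte_fin -!EFinD.
  case: (ltP b 0) => b0; case: (ltP a 0) => a0; case: (ltP a b) => ab;
    rewrite ?add0e -?EFinD; congr EFin; rewrite /Order.max; case: ltP; lra.
have E : (\int[mu]_x ((f \_ `]0%R, +oo[) x) = \int[nu]_x ((f \_ `]0%R, +oo[) x))%E.
  by apply: eq_measure_integral => A mA _; exact: nuE.
rewrite [LHS]integral_mkcond [LHS]E.
have f0' x : (0 <= (f \_ `]0%R, +oo[) x)%E by rewrite patchE; case: ifP.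
have mf' : measurable_fun [set: R] (f \_ `]0%R, +oo[).
  by apply/(measurable_restrictT _ _).1 => //; exact: measurable_funTS.
have E2 : (\int[nu]_x ((f \_ `]0%R, +oo[) x) =
    \int[mrestr mu mN]_x ((f \_ `]0%R, +oo[) x) +
    \int[dm]_y ((f \_ `]0%R, +oo[) \o sq) y)%E.
  rewrite -[X in (_ + X)%E](ge0_integral_pushforward msq dm measurableT mf')//.
  exact: ge0_integral_measure_add.
rewrite E2 (@ge0_integral_density _ _ _ mu jac mjac jac0 dm); last 2 first.
- exact: (measurableT_comp mf' msq).
- by move=> y; exact: f0'.
rewrite [X in (X + _)%E](_ : _ = 0%E) ?add0e.
  rewrite [RHS]integral_mkcond; apply: eq_integral => y _.
  rewrite /= !patchE /jac /sq; have [y0|y0] := leP y 0.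
    by rewrite mulr0 mule0 memNset//= in_itv/= andbT ltNge y0.
  by rewrite !mem_set//= in_itv/= andbT ?exprn_gt0.
have : ae_eq (mrestr mu mN) [set: R] (f \_ `]0%R, +oo[) (cst 0%E).
  exists `]0%R, +oo[%classic; split => //.
    transitivity (mu (`]0%R, +oo[%classic `&` `]-oo, 0%R]%classic)) => //.
    rewrite (_ : _ `&` _ = set0) ?measure0//.
    rewrite -subset0 => x /=; rewrite !in_itv/= andbT => -[x0].
    by rewrite leNgt x0.
  by move=> x /= /not_implyP[_]; rewrite patchE; case: ifPn => //; rewrite inE.
by move=> h; rewrite (ge0_ae_eq_integral _ _ _ _ _ h)// integral0.
by [].
Qed.

End square_substitution.

(** * Prekopa-Leindler inequality for means taken in the variables sqrt |x| *)

Section square_root_mean.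
Context {R : realType}.
Local Notation mu := (@lebesgue_measure R).

(** The sign of [c] is left free. Zero values of [a] and [b], a null set, are excluded because the
    denominator of [sqrt_weight] vanishes there. *)
Definition sqrt_mean (a b c : R) : Prop :=
  [/\ a != 0, b != 0 & `|c| = ((Num.sqrt `|a| + Num.sqrt `|b|) / 2) ^+ 2].

(* In the variables y = sqrt |x| the Lebesgue measure has density 2 y; the
   weight is the square of the ratio of the arithmetic and the geometric mean
   of these densities. *)
Definition sqrt_weight (a b : R) : R :=
  (Num.sqrt `|a| + Num.sqrt `|b|) ^+ 2 / (4 * (Num.sqrt `|a| * Num.sqrt `|b|)).

Lemma sqrt_weight_ge0 a b : 0 <= sqrt_weight a b.
Proof. by rewrite divr_ge0// ?sqr_ge0// mulr_ge0// mulr_ge0// sqrtr_ge0. Qed.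

Lemma ge0_integral_symmetrize (f : R -> \bar R) :
  measurable_fun [set: R] f -> (forall x, 0 <= f x)%E ->
  (\int[mu]_x f x = \int[mu]_(x in `]0%R, +oo[) f x +
                    \int[mu]_(x in `]0%R, +oo[) f (- x)%R)%E.
Proof.
move=> mf f0.
have mfN : measurable_fun [set: R] (f \o -%R).
  by apply: measurableT_comp => //; exact: measurable_oppr.
have -> : [set: R] = `]0, +oo[%classic `|` `]-oo, 0]%classic.
  apply/seteqP; split => x //= _; rewrite !in_itv/= andbT.
  by case: (ltP 0 x) => x0; [left|right].
rewrite ge0_integral_setU//=; last 2 first.
- exact: measurable_funTS.
- apply/disj_setPS => x [/=]; rewrite !in_itv/= andbT => x0.
  by rewrite leNgt x0.
congr (_ + _)%E.
rewrite integral_itv_obnd_cbnd; last exact: measurable_funTS.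
rewrite (@ge0_integration_by_substitution0 _ (f \o -%R))//=.
by apply: eq_integral => x _; rewrite opprK.
Qed.

(** On half-lines of given signs, the substitution x = y^2 turns the square-root mean into the
    midpoint. The weight is exactly the ratio of the squared Jacobian at the midpoint to the product
    of the Jacobians at the two ends. *)
Let pl_signs (s t e : R) (f g h : R -> \bar R) :
  `|s| = 1 -> `|t| = 1 -> `|e| = 1 ->
  measurable_fun [set: R] f -> measurable_fun [set: R] g ->
  measurable_fun [set: R] h ->
  (forall x, 0 <= f x)%E -> (forall x, 0 <= g x)%E -> (forall x, 0 <= h x)%E ->
  (forall x y z, sqrt_mean x y z -> f x * g y <= (sqrt_weight x y)%:E * (h z * h z))%E ->
  ((\int[mu]_(x in `]0%R, +oo[) f (s * x)%R) * (\int[mu]_(x in `]0%R, +oo[) g (t * x)%R) <=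
   (\int[mu]_(x in `]0%R, +oo[) h (e * x)%R) * \int[mu]_(x in `]0%R, +oo[) h (e * x)%R)%E.
Proof.
move=> s1 t1 e1 mf mg mh f0 g0 h0 fgh.
have msc (k : R -> \bar R) (r : R) : measurable_fun [set: R] k ->
    measurable_fun [set: R] (fun x => k (r * x)).
  by move=> mk; apply: measurableT_comp => //; exact: measurable_funM.
pose F (k : R -> \bar R) (r : R) : R -> \bar R :=
  (fun y => k (r * y ^+ 2)%R * (2 * y)%:E)%E \_ `]0, +oo[%classic.
have FE (k : R -> \bar R) (r : R) : measurable_fun [set: R] k -> (forall x, 0 <= k x)%E ->
    (\int[mu]_(y in `]0%R, +oo[) k (r * y)%R = \int[mu]_y F k r y)%E.
  move=> mk k0; rewrite [LHS](ge0_integral_square_substitution (msc k r mk))//.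
  by rewrite [LHS]integral_mkcond.
rewrite !FE//.
have Fy (k : R -> \bar R) (r y : R) : 0 < y -> F k r y = (k (r * y ^+ 2)%R * (2 * y)%:E)%E.
  by move=> y0; rewrite /F patchE mem_set//= in_itv/= y0.
have F0 k r : (forall x, 0 <= k x)%E -> forall y, (0 <= F k r y)%E.
  move=> k0 y; rewrite /F patchE; case: ifPn => //; rewrite inE/= in_itv/= andbT => y0.
  by rewrite mule_ge0// lee_fin mulr_ge0// ltW.
have mF k r : measurable_fun [set: R] k -> measurable_fun [set: R] (F k r).
  move=> mk; apply/(measurable_restrictT _ _).1 => //; apply: measurable_funTS.
  apply: emeasurable_funM.
    exact: (measurableT_comp (msc k r mk) (measurable_funX 2 (@measurable_id _ R setT))).
  by apply/measurable_EFinP; exact: measurable_funM.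
apply: prekopa_leindler_line; [exact: mF..|exact: F0|exact: F0|exact: F0|].
move=> x y; have HH : (0 <= F h e ((x + y) / 2)%R * F h e ((x + y) / 2)%R)%E.
  by rewrite mule_ge0//; exact: F0.
have [x0|x0] := leP x 0.
  by rewrite {1}/F patchE memNset ?mul0e//= in_itv/= andbT ltNge x0.
have [y0|y0] := leP y 0.
  by rewrite [F g t y]patchE memNset ?mule0//= in_itv/= andbT ltNge y0.
have xy0 : 0 < (x + y) / 2 by rewrite divr_gt0// addr_gt0.
rewrite !Fy// muleACA [leRHS]muleACA -!EFinM.
have nsq (r z : R) : `|r| = 1 -> 0 < z -> Num.sqrt `|r * z ^+ 2| = z.
  by move=> r1 z0; rewrite normrM r1 mul1r normrX sqrtr_sqr normr_id gtr0_norm.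
have := fgh (s * x ^+ 2) (t * y ^+ 2) (e * ((x + y) / 2) ^+ 2).
have nz (r z : R) : `|r| = 1 -> 0 < z -> r * z ^+ 2 != 0.
  move=> r1 z0; apply: mulf_neq0; first by rewrite -normr_gt0 r1.
  by rewrite expf_neq0// gt_eqF.
rewrite /sqrt_weight !nsq// => H.
have M : sqrt_mean (s * x ^+ 2) (t * y ^+ 2) (e * ((x + y) / 2) ^+ 2).
  split; [exact: nz|exact: nz|].
  by rewrite !nsq// normrM e1 mul1r normrX gtr0_norm.
have {M}H := H M.
have -> : 2 * ((x + y) / 2) * (2 * ((x + y) / 2)) =
    (x + y) ^+ 2 / (4 * (x * y)) * (2 * x * (2 * y)).
  by field; rewrite !gt_eqF.
rewrite [X in (_ <= _ * X)%E]EFinM muleA (muleC (h _ * h _)%E).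
by apply: lee_wpmul2r => //; rewrite lee_fin !mulr_ge0// ltW.
Qed.

(** Each product of a half of the integral of [f] and a half of that of [g] is at most the square of
    either half of the integral of [h], hence also at most the product of these halves. The four
    bounds add up to the square of the whole. *)
Lemma prekopa_leindler_sqrt :
  prekopa_leindler_property mu sqrt_mean sqrt_weight.
Proof.
move=> f g h mf mg mh f0 g0 h0 fgh.
rewrite (ge0_integral_symmetrize mf f0) (ge0_integral_symmetrize mg g0).
rewrite (ge0_integral_symmetrize mh h0).
pose I (k : R -> \bar R) (r : R) := (\int[mu]_(x in `]0%R, +oo[) k (r * x)%R)%E.
have I1 k : (\int[mu]_(x in `]0%R, +oo[) k x)%E = I k 1.
  by apply: eq_integral => x _; rewrite mul1r.
have IN k : (\int[mu]_(x in `]0%R, +oo[) k (- x)%R)%E = I k (-1).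
  by apply: eq_integral => x _; rewrite mulN1r.
rewrite (I1 f) (I1 g) (I1 h) !IN.
have I0 k r : (forall x, 0 <= k x)%E -> (0 <= I k r)%E.
  by move=> k0; apply: integral_ge0.
have N1 : `|1| = 1 :> R by rewrite normr1.
have NN1 : `|-1| = 1 :> R by rewrite normrN1.
have ineq (s t e : R) : `|s| = 1 -> `|t| = 1 -> `|e| = 1 ->
    (I f s * I g t <= I h e * I h e)%E.
  by move=> s1 t1 e1; exact: pl_signs.
have ineq' (s t : R) : `|s| = 1 -> `|t| = 1 -> (I f s * I g t <= I h 1%R * I h (-1)%R)%E.
  move=> s1 t1; have [h12|h21] := leP (I h 1) (I h (-1)).
    by apply: le_trans (ineq s t 1 s1 t1 N1) _; rewrite lee_wpmul2l// I0.
  by apply: le_trans (ineq s t (-1) s1 t1 NN1) _; rewrite lee_wpmul2r// ?I0// ltW.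
have gen (a1 a2 b1 b2 c1 c2 : \bar R) :
    (0 <= a1)%E -> (0 <= a2)%E -> (0 <= b1)%E -> (0 <= b2)%E ->
    (0 <= c1)%E -> (0 <= c2)%E ->
    (a1 * b1 <= c1 * c1)%E -> (a1 * b2 <= c1 * c2)%E ->
    (a2 * b1 <= c1 * c2)%E -> (a2 * b2 <= c2 * c2)%E ->
    ((a1 + a2) * (b1 + b2) <= (c1 + c2) * (c1 + c2))%E.
  move=> a10 a20 b10 b20 c10 c20 h1 h2 h3 h4.
  rewrite !ge0_muleDl ?ge0_muleDr ?adde_ge0//.
  by apply: leeD; apply: leeD => //; rewrite (muleC c2).
by apply: gen; rewrite ?I0//; [exact: ineq|exact: ineq'|exact: ineq'|exact: ineq].
Qed.

End square_root_mean.

(** * Log-concave unconditional functions *)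

Section log_concave_functions.
Context {R : realType} {n : nat}.
Variable f : n.-tuple R -> R.
Hypotheses (f0 : forall x, 0 <= f x) (lcf : log_concave f).

Lemma log_concave_midpoint (x y z : n.-tuple R) :
  (forall i, tnth z i = (tnth x i + tnth y i) / 2) -> f x * f y <= f z * f z.
Proof.
move=> zE; case: lcf => H [HNoo cH fE].
have -> : z = conv_tuple (2^-1) x y.
  by apply: eq_from_tnth => i; rewrite tnth_mktuple zE; field.
rewrite -lee_fin !EFinM !fE -!expeRD lee_expeR.
have h01 : 0 <= (2^-1 : R) <= 1 by apply/andP; split; lra.
have := cH x y (2^-1) h01; have -> : 1 - 2^-1 = 2^-1 :> R by field.
have := HNoo x; have := HNoo y; have := HNoo (conv_tuple (2^-1) x y).
case: (H x) => [a| |]//; case: (H y) => [b| |]//;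
  case: (H (conv_tuple _ _ _)) => [c| |]//= _ _ _; rewrite ?leey ?leNye//.
by rewrite -!EFinM -!EFinD !lee_fin; lra.
Qed.

Lemma log_concave_level (x y : n.-tuple R) (t : R) : 0 <= t <= 1 ->
  f x = f y -> f x <= f (conv_tuple t x y).
Proof.
move=> t01 fxy; case: lcf => H [HNoo cH fE].
have Hxy : H x = H y.
  by apply: oppe_inj; apply: expeR_inj; rewrite -!fE fxy.
rewrite -lee_fin !fE lee_expeR leeN2; apply: le_trans (cH x y t t01) _.
rewrite -Hxy; have := HNoo x; case: (H x) => [a _| |]//; last by rewrite leey.
by rewrite -!EFinM -EFinD lee_fin; lra.
Qed.

Hypothesis uf : unconditional f.

(** Coordinates are replaced one at a time: the new point lies on the segment from the current point
    to its reflection in that coordinate, and [f] takes equal values at the two ends. *)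
Lemma unconditional_log_concave_anti (x y : n.-tuple R) :
  (forall i, `|tnth y i| <= `|tnth x i|) -> f x <= f y.
Proof.
move=> yx.
pose z (k : nat) : n.-tuple R := [tuple if (i < k)%N then tnth y i else tnth x i | i < n].
suff H k : (k <= n)%N -> f x <= f (z k).
  have -> : y = z n by apply: eq_from_tnth => i; rewrite tnth_mktuple ltn_ord.
  exact: H.
elim: k => [_|k IHk kn].
  suff -> : z 0%N = x by [].
  by apply: eq_from_tnth => i; rewrite tnth_mktuple.
apply: le_trans (IHk (ltnW kn)) _.
pose delta (i : 'I_n) : R := if i == k :> nat then -1 else 1.
pose xk := tnth x (Ordinal kn); pose yk := tnth y (Ordinal kn).
(* Solves t xk - (1 - t) xk = yk. For xk = 0 the quotient is 0 by convention, and yk is then 0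
   too. *)
pose t := (1 + yk / xk) / 2.
have q1 : `|yk / xk| <= 1.
  rewrite normrM normfV; have [->|xk0] := eqVneq xk 0; first by rewrite normr0 invr0 mulr0.
  by rewrite ler_pdivrMr ?normr_gt0// mul1r; exact: yx.
have -> : z k.+1 = conv_tuple t (z k) [tuple delta i * tnth (z k) i | i < n].
  apply: eq_from_tnth => i; rewrite !tnth_mktuple /delta ltnS.
  have [ik|ik] := eqVneq (i : nat) k.
    have -> : i = Ordinal kn by apply: val_inj.
    rewrite /= leqnn ltnn -/xk -/yk mulN1r mulrN -mulrBl.
    have -> : t - (1 - t) = yk / xk by rewrite /t; move: (yk / xk) => q; field.
    have [x0|x0] := eqVneq xk 0; last by rewrite divfK.
    by rewrite x0 mulr0; apply/eqP; rewrite -normr_le0; have := yx (Ordinal kn); rewrite -/xk x0 normr0.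
  rewrite mul1r -mulrDl subrKC mul1r.
  by rewrite (ltn_neqAle i k) ik.
apply: log_concave_level.
  by move: q1; rewrite ler_norml /t => /andP[? ?]; apply/andP; split; lra.
by apply: uf => i; rewrite /delta; case: ifP => _; [right|left].
Qed.

(** The square-root mean of |x_i| and |y_i| is at most their arithmetic mean, so midpoint
    log-concavity combines with monotonicity in each |x_i|. *)
Lemma unconditional_log_concave_sqrt_mean (x y z : n.-tuple R) :
  tuple_mean (@sqrt_mean R) x y z -> f x * f y <= f z * f z.
Proof.
move=> xyz.
pose a (u : n.-tuple R) : n.-tuple R := [tuple `|tnth u i| | i < n].
have fa u : f u = f (a u).
  by apply/eqP; rewrite eq_le; apply/andP; split;
    apply: unconditional_log_concave_anti => i; rewrite tnth_mktuple normr_id.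
pose m : n.-tuple R := [tuple (`|tnth x i| + `|tnth y i|) / 2 | i < n].
apply: (@le_trans _ _ (f m * f m)).
  rewrite (fa x) (fa y); apply: log_concave_midpoint => i.
  by rewrite !tnth_mktuple.
have mz : f m <= f z.
  apply: unconditional_log_concave_anti => i; have [_ _ ->] := xyz i.
  rewrite tnth_mktuple [leRHS]ger0_norm ?divr_ge0 ?addr_ge0//.
  set b := tnth x i; set c := tnth y i.
  rewrite -[X in _ <= (X + _) / 2](@sqr_sqrtr _ `|b|)//.
  rewrite -[X in _ <= (_ + X) / 2](@sqr_sqrtr _ `|c|)//.
  rewrite -subr_ge0; set p := Num.sqrt _; set q := Num.sqrt _.
  have -> : (p ^+ 2 + q ^+ 2) / 2 - ((p + q) / 2) ^+ 2 = ((p - q) / 2) ^+ 2 by field.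
  exact: sqr_ge0.
by apply: ler_pM.
Qed.

End log_concave_functions.

(** * Invariance of Lebesgue measure under sign changes *)

Section sign_changes.
Context {R : realType}.

Definition sign_change n (delta : 'I_n -> R) (x : n.-tuple R) : n.-tuple R :=
  [tuple delta i * tnth x i | i < n].

Lemma tnth_consT_lift n (a : R) (t : n.-tuple R) (j : 'I_n) :
  tnth (consT (a, t)) (lift ord0 j) = tnth t j.
Proof. by rewrite /consT !(tnth_nth 0). Qed.

Lemma measurable_sign_change n (delta : 'I_n -> R) :
  measurable_fun [set: n.-tuple R] (sign_change delta).
Proof.
apply/measurable_fun_tnthP => i; rewrite (_ : _ \o _ = fun x => delta i * tnth x i).
  by apply: measurable_funM => //; exact: measurable_tnth.
by apply/funext => x /=; rewrite tnth_mktuple.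
Qed.

Lemma ge0_integral_lebesgueN (f : R -> \bar R) :
  measurable_fun [set: R] f -> (forall x, 0 <= f x)%E ->
  (\int[lebesgue_measure]_x f (- x)%R = \int[lebesgue_measure]_x f x)%E.
Proof.
move=> mf f0.
have mfN : measurable_fun [set: R] (fun x => f (- x)).
  by apply: measurableT_comp => //; exact: measurable_oppr.
rewrite (ge0_integral_symmetrize mf f0) (ge0_integral_symmetrize mfN)//.
by under [X in (_ + X)%E]eq_integral do rewrite opprK; rewrite addeC.
Qed.

Lemma ge0_integral_sign_change n (delta : 'I_n -> R) (f : n.-tuple R -> \bar R) :
  (forall i, delta i = 1 \/ delta i = -1) ->
  measurable_fun [set: n.-tuple R] f -> (forall x, 0 <= f x)%E ->
  (\int[lebesgue_tuple n]_x f (sign_change delta x) =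
   \int[lebesgue_tuple n]_x f x)%E.
Proof.
elim: n delta f => [|n IHn] delta f hdelta mf f0.
  by apply: eq_integral => x _; rewrite [sign_change _ _]tuple0 [in RHS]tuple0.
have mfd : measurable_fun [set: n.+1.-tuple R] (f \o sign_change delta).
  by apply: measurableT_comp => //; exact: measurable_sign_change.
rewrite (ge0_integral_lebesgue_tupleS mfd (fun x => f0 (sign_change delta x))).
rewrite [RHS](ge0_integral_lebesgue_tupleS mf f0).
pose G (a : R) := (\int[lebesgue_tuple n]_t f (consT (a, t)))%E.
transitivity (\int[@lebesgue_measure R]_a G (delta ord0 * a)%R)%E.
  apply: eq_integral => a _; rewrite /G.
  rewrite -[RHS](IHn (fun i => delta (lift ord0 i)))//.
  - apply: eq_integral => t _ /=; congr f; apply: eq_from_tnth => i.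
    rewrite /sign_change tnth_mktuple; have [j ->|->] := unliftP ord0 i; last by rewrite /consT.
    by rewrite !tnth_consT_lift !tnth_mktuple.
  - exact: measurable_lebesgue_tupleS_section.
have mG : measurable_fun [set: R] G by exact: measurable_integral_lebesgue_tupleS.
have G0 a : (0 <= G a)%E by exact: integral_ge0.
case: (hdelta ord0) => ->.
  by apply: eq_integral => a _; rewrite mul1r.
rewrite -(ge0_integral_lebesgueN mG G0).
by apply: eq_integral => a _; rewrite mulN1r.
Qed.

End sign_changes.

(** * Inequalities between expectations under a log-concave density *)

Section random_vector_with_density.
Context d (T : measurableType d) {R : realType} (P : probability T R) {n : nat}.
Variables (X : {RV P >-> n.-tuple R}) (f : n.-tuple R -> R).
Hypothesis Xf : has_density X f.

Let f0 x : 0 <= f x. Proof. by case: Xf. Qed.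

Let mf : measurable_fun [set: n.-tuple R] f. Proof. by case: Xf. Qed.

Lemma integral_has_density (phi : n.-tuple R -> \bar R) :
  measurable_fun [set: n.-tuple R] phi -> (forall x, 0 <= phi x)%E ->
  (\int[P]_w phi (X w) = \int[lebesgue_tuple n]_x (phi x * (f x)%:E))%E.
Proof.
move=> mphi phi0; rewrite -(ge0_integral_distribution X mphi phi0).
by apply: ge0_integral_density => //; case: Xf.
Qed.

Hypothesis lcf : log_concave f.

(** The density itself satisfies the midpoint hypothesis of Prekopa-Leindler, so it may be
    multiplied into all three functions. *)
Lemma expectation_midpoint (phi1 phi2 psi : n.-tuple R -> R) :
  measurable_fun [set: n.-tuple R] phi1 -> measurable_fun [set: n.-tuple R] phi2 ->
  measurable_fun [set: n.-tuple R] psi ->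
  (forall x, 0 <= phi1 x) -> (forall x, 0 <= phi2 x) -> (forall x, 0 <= psi x) ->
  (forall x y z, (forall i, tnth z i = (tnth x i + tnth y i) / 2) ->
    phi1 x * phi2 y <= psi z ^+ 2) ->
  ((\int[P]_w (phi1 (X w))%:E) * (\int[P]_w (phi2 (X w))%:E) <=
   (\int[P]_w (psi (X w))%:E) * (\int[P]_w (psi (X w))%:E))%E.
Proof.
move=> m1 m2 mpsi p1 p2 ppsi H.
have E (k : n.-tuple R -> R) : measurable_fun [set: n.-tuple R] k ->
    (forall x, 0 <= k x) ->
    (\int[P]_w (k (X w))%:E = \int[lebesgue_tuple n]_x ((k x)%:E * (f x)%:E))%E.
  move=> mk k0; apply: (integral_has_density (phi := EFin \o k)).
    exact/measurable_EFinP.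
  by move=> x; rewrite lee_fin.
rewrite !E//.
apply: prekopa_leindler_midpoint.
all: try by move=> x; rewrite mule_ge0 ?lee_fin.
all: try (by apply: emeasurable_funM; exact/measurable_EFinP).
move=> x y z xyz; rewrite mul1e -!EFinM lee_fin.
rewrite mulrACA [leRHS]mulrACA -expr2.
apply: ler_pM; rewrite ?mulr_ge0//; first exact: H.
exact: log_concave_midpoint.
Qed.

Hypothesis uf : unconditional f.

(** The square-root form of Prekopa-Leindler for exp(-g) f, exp(r) f and f, the last of mass 1. It
    is an inequality of the type of Maurey's property (tau), with the logarithm of the weight as
    cost. *)
Lemma expectation_sqrt_mean (g r : n.-tuple R -> R) :
  measurable_fun [set: n.-tuple R] g -> measurable_fun [set: n.-tuple R] r ->
  (forall x y, (forall i, tnth x i != 0) -> (forall i, tnth y i != 0) ->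
    expR (r y - g x) <= tuple_weight (@sqrt_weight R) x y) ->
  ((\int[P]_w (expR (- g (X w)))%:E) * (\int[P]_w (expR (r (X w)))%:E) <= 1)%E.
Proof.
move=> mg mr H.
have meg : measurable_fun [set: n.-tuple R] (fun x => expR (- g x)).
  by apply: measurableT_comp => //; exact: measurable_funN.
have mer : measurable_fun [set: n.-tuple R] (fun x => expR (r x)).
  exact: measurableT_comp.
rewrite (integral_has_density (phi := fun x => (expR (- g x))%:E)); last 2 first.
- exact/measurable_EFinP.
- by move=> x; rewrite lee_fin expR_ge0.
rewrite (integral_has_density (phi := fun x => (expR (r x))%:E)); last 2 first.
- exact/measurable_EFinP.
- by move=> x; rewrite lee_fin expR_ge0.
have I1 : (\int[lebesgue_tuple n]_x (f x)%:E = 1)%E.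
  case: Xf => _ _ /(_ _ measurableT) <-.
  by rewrite /distribution /pushforward preimage_setT probability_setT.
have : (1 = (\int[lebesgue_tuple n]_x (f x)%:E) * \int[lebesgue_tuple n]_x (f x)%:E)%E.
  by rewrite I1 mule1.
move=> ->.
apply: (@prekopa_leindler_tuple R (@sqrt_mean R) (@sqrt_weight R)).
- exact: sqrt_weight_ge0.
- exact: prekopa_leindler_sqrt.
- by apply: emeasurable_funM; exact/measurable_EFinP.
- by apply: emeasurable_funM; exact/measurable_EFinP.
- exact/measurable_EFinP.
- by move=> x; rewrite mule_ge0 ?lee_fin ?expR_ge0.
- by move=> x; rewrite mule_ge0 ?lee_fin ?expR_ge0.
- by move=> x; rewrite lee_fin.
move=> x y z xyz; rewrite -!EFinM lee_fin mulrACA -expRD addrC.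
apply: ler_pM; rewrite ?expR_ge0 ?mulr_ge0//.
  by apply: H => i; have [] := xyz i.
exact: unconditional_log_concave_sqrt_mean.
Qed.

Lemma integral_sign_change (delta : 'I_n -> R) (phi : n.-tuple R -> \bar R) :
  (forall i, delta i = 1 \/ delta i = -1) ->
  measurable_fun [set: n.-tuple R] phi -> (forall x, 0 <= phi x)%E ->
  (\int[P]_w phi (sign_change delta (X w)) = \int[P]_w phi (X w))%E.
Proof.
move=> hdelta mphi phi0.
have mphid : measurable_fun [set: n.-tuple R] (phi \o sign_change delta).
  by apply: measurableT_comp => //; exact: measurable_sign_change.
rewrite (integral_has_density mphi phi0) (integral_has_density mphid (fun x => phi0 (sign_change delta x))).
rewrite -[RHS](ge0_integral_sign_change hdelta)//.
- by apply: eq_integral => x _ /=; rewrite -(uf x hdelta).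
- by apply: emeasurable_funM => //; exact/measurable_EFinP.
- by move=> x; rewrite mule_ge0// lee_fin.
Qed.

End random_vector_with_density.

(** * Moments of the coordinates *)

Section moments.
Context d (T : measurableType d) {R : realType} (P : probability T R) {n : nat}.
Variables (X : {RV P >-> n.-tuple R}) (f : n.-tuple R -> R).
Hypotheses (Xf : has_density X f) (lcf : log_concave f).

Lemma measurable_coordinate (i : 'I_n) :
  measurable_fun [set: n.-tuple R] (fun x : n.-tuple R => tnth x i).
Proof. exact: measurable_tnth. Qed.

(* Log-concavity along pairs with one point in a strip of constant probability
   turns a moment of order k into one of order 2 k. *)
Lemma expectation_moment_double (i : 'I_n) (k : nat) (c : R) :
  (\int[P]_w (tnth (X w) i ^+ 2)%:E <= 1)%E ->
  (\int[P]_w (`|tnth (X w) i| ^+ k)%:E <= c%:E)%E ->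
  (\int[P]_w (`|tnth (X w) i| ^+ (k + k))%:E <=
    (4 ^+ k * (4 / 3 * (4 ^+ k * c ^+ 2) + 4 ^+ k))%:E)%E.
Proof.
move=> E2 Ek.
have mX : measurable_fun [set: T] (fun w => tnth (X w) i).
  exact: measurableT_comp (measurable_coordinate i) _.
(* If |y| <= 2 then the midpoint z of x and y has 2 |z| >= |x| - 2, so [cut] at x and [strip] at y
   are controlled by 2 |z|. *)
pose cut (r : R) : R := Num.max (`|r| - 2) 0.
pose strip (r : R) : R := if `|r| <= 2 then 1 else 0.
have cut0 r : 0 <= cut r by rewrite le_max lexx orbT.
have mcut : measurable_fun [set: R] cut.
  apply: measurable_maxr => //; apply: measurable_funB => //.
have mstrip : measurable_fun [set: R] strip.
  apply: measurable_fun_if => //.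
  by apply: measurable_fun_ler.
have ms : measurable_fun [set: T] (fun w => strip (tnth (X w) i)).
  exact: measurableT_comp.
(* Chebyshev's inequality at distance 2, the second moment being at most 1. *)
have strip34 : ((3 / 4)%:E <= \int[P]_w (strip (tnth (X w) i))%:E)%E.
  have : (1 <= \int[P]_w (strip (tnth (X w) i) + 4^-1 * tnth (X w) i ^+ 2)%:E)%E.
    have <- : (\int[P]_w (cst 1 w) = 1)%E.
      by rewrite integral_cst//= probability_setT mule1.
    apply: ge0_le_integral => //.
    - apply/measurable_EFinP; apply: measurable_funD => //.
      by apply: measurable_funM => //; exact: measurable_funX.
    - move=> w _; rewrite lee_fin /strip; case: ifPn => [_|].
        by rewrite lerDl mulr_ge0// sqr_ge0.
      rewrite -ltNge add0r -real_normK ?num_real// => h.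
      have : 2 ^+ 2 <= `|tnth (X w) i| ^+ 2 by rewrite ler_sqr ?nnegrE// ltW.
      lra.
  under eq_integral do rewrite EFinD.
  rewrite ge0_integralD//.
  - under [X in (_ + X)%E]eq_integral do rewrite EFinM.
    rewrite ge0_integralZl//.
    + move: E2; set I2 := (\int[P]_w (tnth (X w) i ^+ 2)%:E)%E => E2.
      move=> h; have {}h := le_trans h (leeD2l _ (lee_wpmul2l _ E2)).
      move: h; rewrite mule1 -leeBlDr// -EFinB => h; apply: le_trans (h _) => //.
      by rewrite lee_fin; lra.
    + by apply/measurable_EFinP; exact: measurable_funX.
    + by move=> w _; rewrite lee_fin sqr_ge0.
  - by move=> w _; rewrite lee_fin /strip; case: ifP.
  - exact/measurable_EFinP.
  - by move=> w _; rewrite lee_fin mulr_ge0// sqr_ge0.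
  - apply/measurable_EFinP.
    by apply: measurable_funM => //; exact: measurable_funX.
have key := @expectation_midpoint _ _ _ _ _ X f Xf lcf
  (fun x => cut (tnth x i) ^+ (k + k)) (fun x => strip (tnth x i))
  (fun x => (2 * `|tnth x i|) ^+ k).
have mc : measurable_fun [set: T] (fun w => cut (tnth (X w) i)).
  exact: measurableT_comp.
have c0 : 0 <= c.
  by rewrite -lee_fin; apply: le_trans Ek; apply: integral_ge0 => w _; rewrite lee_fin exprn_ge0.
have Ecut : (\int[P]_w (cut (tnth (X w) i) ^+ (k + k))%:E <= (4 / 3 * (4 ^+ k * c ^+ 2))%:E)%E.
  have {}key : ((\int[P]_w (cut (tnth (X w) i) ^+ (k + k))%:E) *
     (\int[P]_w (strip (tnth (X w) i))%:E) <=
     (\int[P]_w ((2 * `|tnth (X w) i|) ^+ k)%:E) *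
     (\int[P]_w ((2 * `|tnth (X w) i|) ^+ k)%:E))%E.
    apply: key.
    - by apply: measurable_funX; apply: measurableT_comp => //; exact: measurable_coordinate.
    - by apply: measurableT_comp => //; exact: measurable_coordinate.
    - apply: measurable_funX; apply: measurable_funM => //.
      by apply: measurableT_comp => //; exact: measurable_coordinate.
    - by move=> x; rewrite exprn_ge0.
    - by move=> x; rewrite /strip; case: ifP.
    - by move=> x; rewrite exprn_ge0// mulr_ge0.
    move=> x y z ->; rewrite /strip; case: ifPn => [y2|]; last first.
      by rewrite mulr0 sqr_ge0.
    rewrite mulr1 -exprM muln2 -addnn; apply: lerXn2r; rewrite ?nnegrE// ?mulr_ge0//.
    rewrite /cut ge_max mulr_ge0// andbT.
    have : `|tnth x i| <= `|tnth x i + tnth y i| + `|tnth y i|.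
      by rewrite -[X in `|X| <= _](addrK (tnth y i)); exact: ler_normB.
    rewrite normrM [X in 2 * (_ * X)]ger0_norm// mulrCA divff// mulr1.
    lra.
  have E2k : (\int[P]_w ((2 * `|tnth (X w) i|) ^+ k)%:E <= (2 ^+ k * c)%:E)%E.
    under eq_integral do rewrite exprMn EFinM.
    rewrite ge0_integralZl//; first by rewrite EFinM; apply: lee_wpmul2l.
    by apply/measurable_EFinP; apply: measurable_funX; exact: measurableT_comp.
  have I0 : (0 <= \int[P]_w (cut (tnth (X w) i) ^+ (k + k))%:E)%E.
    by apply: integral_ge0 => w _; rewrite lee_fin exprn_ge0.
  have h1 : ((\int[P]_w (cut (tnth (X w) i) ^+ (k + k))%:E) * (3 / 4)%:E <=
      (2 ^+ k * c)%:E * (2 ^+ k * c)%:E)%E.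
    apply: le_trans (lee_wpmul2l I0 strip34) _; apply: le_trans key _.
    by apply: lee_pmul => //; apply: integral_ge0 => w _; rewrite lee_fin exprn_ge0// mulr_ge0.
  have h2 : (\int[P]_w (cut (tnth (X w) i) ^+ (k + k))%:E <=
      (2 ^+ k * c)%:E * (2 ^+ k * c)%:E * ((3 / 4)^-1)%:E)%E.
    by rewrite lee_pdivlMr// divr_gt0.
  apply: le_trans h2 _; rewrite -!EFinM lee_fin.
  have -> : (4 : R) ^+ k = (2 ^+ k) ^+ 2 by rewrite -exprM mulnC exprM; congr (_ ^+ k); rewrite -natrX.
  by rewrite le_eqVlt; apply/orP; left; apply/eqP; field.
(* The cut is removed by distinguishing |x| <= 4 from |x| > 4, where |x| <= 2 (|x| - 2). *)
apply: (@le_trans _ _ (\int[P]_w (4 ^+ k * (cut (tnth (X w) i) ^+ (k + k) + 4 ^+ k))%:E)%E).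
  apply: ge0_le_integral => //.
  - by apply/measurable_EFinP; apply: measurable_funX; exact: measurableT_comp.
  - apply/measurable_EFinP; apply: measurable_funM => //; apply: measurable_funD => //.
    exact: measurable_funX.
  move=> w _; rewrite lee_fin; set x := tnth _ _.
  have -> : (4 : R) ^+ k = 2 ^+ (k + k).
    by rewrite addnn -mul2n exprM; congr (_ ^+ k); rewrite -natrX.
  have [x2|x2] := leP `|x| 2.
    apply: (@le_trans _ _ (2 ^+ (k + k) * 2 ^+ (k + k))); last first.
      by rewrite ler_wpM2l ?exprn_ge0// lerDr exprn_ge0.
    rewrite -exprMn; apply: lerXn2r; rewrite ?nnegrE//.
    by apply: le_trans x2 _; rewrite -natrM ler_nat.
  have [x4|x4] := leP `|x| 4.
    apply: (@le_trans _ _ (2 ^+ (k + k) * 2 ^+ (k + k))); last first.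
      by rewrite ler_wpM2l ?exprn_ge0// lerDr exprn_ge0.
    rewrite -exprMn; apply: lerXn2r; rewrite ?nnegrE//.
    by rewrite -natrM.
  apply: (@le_trans _ _ (2 ^+ (k + k) * cut x ^+ (k + k))); last first.
    by rewrite ler_wpM2l ?exprn_ge0// lerDl exprn_ge0.
  rewrite -exprMn; apply: lerXn2r; rewrite ?nnegrE// ?mulr_ge0//.
  apply: (@le_trans _ _ (2 * (`|x| - 2))); first lra.
  by rewrite ler_wpM2l// le_max lexx.
under eq_integral do rewrite EFinM.
rewrite ge0_integralZl//; last 2 first.
- apply/measurable_EFinP; apply: measurable_funD => //; exact: measurable_funX.
- by move=> w _; rewrite lee_fin addr_ge0// exprn_ge0.
rewrite EFinM; apply: lee_wpmul2l => //.
under eq_integral do rewrite EFinD.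
rewrite ge0_integralD//.
- rewrite EFinD; apply: leeD => //.
  by rewrite integral_cst//= probability_setT mule1.
- by move=> w _; rewrite lee_fin exprn_ge0.
- by apply/measurable_EFinP; exact: measurable_funX.
Qed.

End moments.

(** * A Gaussian-like majorant of the cosine and its transport cost *)

Section truncated_gaussian_exponent.
Context {R : realType}.

Lemma sin_mvt (v : R) : exists2 c : R, `|c| <= `|v| & sin v = v * cos c.
Proof.
wlog v0 : v / 0 <= v => [H|].
  have [|v0] := leP 0 v; first exact: H.
  have [|c cv sv] := H (- v); first by rewrite oppr_ge0 ltW.
  exists c; first by rewrite -(normrN v).
  by move: sv; rewrite sinN mulNr => /oppr_inj.
have [c] := @MVT_segment _ (@sin R) (@cos R) 0 v v0 (fun x _ => is_derive_sin x)
  (continuous_subspaceT (@continuous_sin R)).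
rewrite in_itv/= => /andP[c0 cv]; rewrite sin0 !subr0 mulrC => ->.
by exists c; rewrite ?ger0_norm.
Qed.

Lemma cos_ge_taylor2 (u : R) : 1 - u ^+ 2 / 2 <= cos u.
Proof.
have -> : cos u = 1 - 2 * sin (u / 2) ^+ 2.
  by rewrite {1}(_ : u = u / 2 + u / 2) ?cosD -?expr2 ?cos2sin2; field.
have [c _ ->] := sin_mvt (u / 2).
have : cos c ^+ 2 <= 1 by rewrite cos2sin2 gerBl sqr_ge0.
rewrite exprMn; have := sqr_ge0 u; set x := cos c ^+ 2.
have -> : (u / 2) ^+ 2 = u ^+ 2 / 4 by field.
nra.
Qed.

Lemma cos_le_taylor4 (u : R) : u ^+ 2 < 2^-1 -> cos u <= 1 - u ^+ 2 / 2 + u ^+ 4.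
Proof.
move=> u12.
have -> : cos u = 1 - 2 * sin (u / 2) ^+ 2.
  by rewrite {1}(_ : u = u / 2 + u / 2) ?cosD -?expr2 ?cos2sin2; field.
have [c cu ->] := sin_mvt (u / 2).
have c2 : c ^+ 2 <= u ^+ 2 / 4.
  have -> : u ^+ 2 / 4 = `|u / 2| ^+ 2 by rewrite real_normK ?num_real//; field.
  by rewrite -(real_normK (num_real c)) ler_sqr ?nnegrE.
have := cos_ge_taylor2 c; have := cos_le1 c; set x := cos c => x1 x2.
rewrite exprMn; have -> : (u / 2) ^+ 2 = u ^+ 2 / 4 by field.
have -> : u ^+ 4 = u ^+ 2 ^+ 2 by rewrite -exprM.
move: u12 c2; have := sqr_ge0 u; set y := u ^+ 2 => y0 y12 c2.
have x3 : 1 - y / 4 <= x ^+ 2 by nra.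
nra.
Qed.

(** Chosen so that exp(-cut_exponent u) dominates |cos u| on the whole line and differs from cos u
    by O(u^4). The maximum with 0 takes over exactly where u^2 >= 1/2. *)
Definition cut_exponent (u : R) : R := Num.max 0 (u ^+ 2 / 2 - u ^+ 4).

Lemma cut_exponent_ge0 u : 0 <= cut_exponent u.
Proof. by rewrite le_max lexx. Qed.

Lemma cut_exponent_le u : cut_exponent u <= u ^+ 2 / 2.
Proof. by rewrite ge_max divr_ge0 ?sqr_ge0//= gerBl exprn_even_ge0. Qed.

Lemma cut_exponent_ge u : u ^+ 2 / 2 - u ^+ 4 <= cut_exponent u.
Proof. by rewrite le_max lexx orbT. Qed.

Lemma cut_exponent_le16 u : cut_exponent u <= 16^-1.
Proof.
rewrite ge_max invr_ge0 ler0n/=.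
have := sqr_ge0 (u ^+ 2 - 4^-1); have -> : u ^+ 4 = (u ^+ 2) ^+ 2 by rewrite -exprM.
lra.
Qed.

Lemma expR_lt_inv1B (z : R) : z < 1 -> expR z <= (1 - z)^-1.
Proof.
move=> z1; rewrite -[expR z]invrK -expRN lef_pV2 ?posrE ?expR_gt0 ?subr_gt0//.
exact: expR_ge1Dx.
Qed.

Lemma norm_cos_le_cut u : `|cos u| <= expR (- cut_exponent u).
Proof.
have [h|h] := leP (u ^+ 2 / 2 - u ^+ 4) 0.
  rewrite /cut_exponent max_l// oppr0 expR0; exact: cos_max.
rewrite /cut_exponent max_r; last exact: ltW.
(* Positivity of the exponent places u in the range of the fourth-order bound on the cosine. *)
have u12 : u ^+ 2 < 2^-1.
  rewrite ltNge; apply/negP => h2; move: h.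
  have -> : u ^+ 4 = (u ^+ 2) * u ^+ 2 by rewrite -exprD.
  by move=> h; nra.
apply: le_trans _ (expR_ge1Dx _).
have := cos_le_taylor4 u12; have := cos_ge_taylor2 u.
by move=> c1 c2; rewrite ger0_norm; lra.
Qed.

Lemma expR_cut_sub_cos u : expR (- cut_exponent u) - cos u <= 2 * u ^+ 4.
Proof.
set m := cut_exponent u.
have m0 : 0 <= m := cut_exponent_ge0 u.
have m1 : m <= u ^+ 2 / 2 := cut_exponent_le u.
have m2 : u ^+ 2 / 2 - u ^+ 4 <= m := cut_exponent_ge u.
have e1 : expR (- m) <= 1 - m + m ^+ 2.
  apply: le_trans (expR_lt_inv1B (_ : - m < 1)) _; first lra.
  rewrite opprK -[leLHS]mul1r ler_pdivrMr; last lra.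
  have : 0 <= m ^+ 3 by rewrite exprn_ge0.
  nra.
have e2 : m ^+ 2 <= u ^+ 4.
  have -> : u ^+ 4 = u ^+ 2 ^+ 2 by rewrite -exprM.
  rewrite ler_sqr ?nnegrE ?sqr_ge0//; have := sqr_ge0 u; lra.
have := cos_ge_taylor2 u; lra.
Qed.

(** Rounded up from 1412 = 900 + 2 * 256 in [cut_exponent_transport]: 256 comes from p^8 <= 256 q^8
    for p <= 2q, and 900 from completing a square. *)
Definition tau_constant : R := 1500.

(* The cost paid by moving a point is the logarithm of the ratio of the
   arithmetic and geometric means of the square roots, which is of order
   (u - v)^2 / v^2; it absorbs the linear variation v |u - v| of the exponent
   up to v^4. *)
Lemma cut_exponent_transport (u v : R) : u != 0 -> v != 0 ->
  expR (2 * cut_exponent v - tau_constant * v ^+ 4 - 2 * cut_exponent u) <=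
  sqrt_weight u v.
Proof.
move=> u0 v0; rewrite /sqrt_weight.
pose p := Num.sqrt `|u|; pose q := Num.sqrt `|v|; rewrite -/p -/q.
have p0 : 0 < p by rewrite sqrtr_gt0 normr_gt0.
have q0 : 0 < q by rewrite sqrtr_gt0 normr_gt0.
have p0' : 0 <= p := ltW p0.
have q0' : 0 <= q := ltW q0.
have up : u ^+ 2 = p ^+ 4 by rewrite -real_normK ?num_real// -(@sqr_sqrtr _ `|u|)// -exprM.
have vq : v ^+ 2 = q ^+ 4 by rewrite -real_normK ?num_real// -(@sqr_sqrtr _ `|v|)// -exprM.
have u4 : u ^+ 4 = p ^+ 8 by rewrite (exprM _ 2 2) up -exprM.
have v4 : v ^+ 4 = q ^+ 8 by rewrite (exprM _ 2 2) vq -exprM.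
have mu := cut_exponent_ge u; have mv := cut_exponent_le v.
have mu0 := cut_exponent_ge0 u.
rewrite up u4 in mu; rewrite vq in mv; rewrite v4.
set z := _ - _ - _.
have wE : (p + q) ^+ 2 / (4 * (p * q)) = 1 + (p - q) ^+ 2 / (4 * (p * q)).
  by field; rewrite !gt_eqF.
rewrite wE.
have w0 : 0 <= (p - q) ^+ 2 / (4 * (p * q)).
  by rewrite divr_ge0 ?sqr_ge0// !mulr_ge0// ltW.
have [zle0|z0] := leP z 0.
  by apply: (@le_trans _ _ 1); rewrite ?lerDl// -[leRHS]expR0 ler_expR.
have q8 : q ^+ 8 = (q ^+ 4) ^+ 2 by rewrite -exprM.
have zq : z <= q ^+ 4 - tau_constant * q ^+ 8 by rewrite /z; lra.
have zs : z <= 16^-1.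
  apply: le_trans zq _; rewrite q8 /tau_constant.
  by have := sqr_ge0 (q ^+ 4 - 8^-1); have := sqr_ge0 (q ^+ 4); lra.
have ez : expR z <= 1 + 2 * z.
  apply: le_trans (expR_lt_inv1B _) _; first lra.
  by rewrite -[leLHS]mul1r ler_pdivrMr; nra.
apply: le_trans ez _; rewrite lerD2l.
have pq0 : 0 < 4 * (p * q) by rewrite !mulr_gt0.
rewrite ler_pdivlMr//.
(* For p <= 2q the exponent varies by at most 15 q^3 |p - q|; completing the square against (p -
   q)^2 leaves a multiple of q^8 = v^4. For p > 2q the cost (p - q)^2 / (4 p q) is at least 1/8,
   which already exceeds 2z. *)
have [pq|qp] := leP p (2 * q).
  have z1 : z <= q ^+ 4 - p ^+ 4 + 2 * p ^+ 8 - tau_constant * q ^+ 8.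
    by rewrite /z; lra.
  have p8 : p ^+ 8 <= 256 * q ^+ 8.
    have -> : 256 * q ^+ 8 = (2 * q) ^+ 8 by ring.
    by apply: lerXn2r => //; rewrite nnegrE// mulr_ge0.
  have d1 : q ^+ 4 - p ^+ 4 <= 15 * q ^+ 3 * `|p - q|.
    have -> : q ^+ 4 - p ^+ 4 = (q - p) * ((q + p) * (q ^+ 2 + p ^+ 2)) by ring.
    have h1 : (q + p) * (q ^+ 2 + p ^+ 2) <= (3 * q) * (5 * q ^+ 2).
      apply: ler_pM; first by rewrite addr_ge0.
      - by rewrite addr_ge0 ?sqr_ge0.
      - lra.
      - have : p ^+ 2 <= (2 * q) ^+ 2 by rewrite ler_sqr ?nnegrE ?mulr_ge0.
        by rewrite exprMn; lra.
    have h0 : 0 <= (q + p) * (q ^+ 2 + p ^+ 2).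
      by rewrite mulr_ge0 ?addr_ge0 ?sqr_ge0.
    apply: (@le_trans _ _ (`|p - q| * ((q + p) * (q ^+ 2 + p ^+ 2)))).
      by rewrite ler_wpM2r// distrC ler_norm.
    have -> : 15 * q ^+ 3 * `|p - q| = `|p - q| * (3 * q * (5 * q ^+ 2)) by ring.
    by rewrite ler_wpM2l.
  have z2 : 2 * z <= 30 * q ^+ 3 * `|p - q| - 1800 * q ^+ 8.
    move: z1 d1 p8; rewrite /tau_constant; have : 0 <= q ^+ 8 by rewrite exprn_ge0// ltW.
    lra.
  apply: (@le_trans _ _ (2 * z * (8 * q ^+ 2))).
    have z0' : 0 <= 2 * z by rewrite mulr_ge0// ltW.
    rewrite ler_wpM2l//.
    have -> : 8 * q ^+ 2 = 4 * (2 * q * q) by ring.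
    by rewrite ler_wpM2l// ler_wpM2r// ltW.
  apply: (@le_trans _ _ ((30 * q ^+ 3 * `|p - q| - 1800 * q ^+ 8) * (8 * q ^+ 2))).
    by rewrite ler_wpM2r// mulr_ge0// sqr_ge0.
  rewrite -[leRHS]real_normK ?num_real//.
  have -> : (30 * q ^+ 3 * `|p - q| - 1800 * q ^+ 8) * (8 * q ^+ 2) =
      `|p - q| ^+ 2 - (`|p - q| - 120 * q ^+ 5) ^+ 2 by ring.
  by rewrite gerBl sqr_ge0.
have z8 : 2 * z <= 8^-1 by lra.
apply: (@le_trans _ _ (8^-1 * (4 * (p * q)))).
  by rewrite ler_wpM2r// ltW.
nra.
Qed.

End truncated_gaussian_exponent.

(** * Real-valued expectations *)

Section real_expectation.
Context d (T : measurableType d) {R : realType} (P : probability T R).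
Implicit Types f g : T -> R.

Lemma bounded_integrable f (c : R) : measurable_fun [set: T] f ->
  (forall w, `|f w| <= c) -> P.-integrable [set: T] (EFin \o f).
Proof.
move=> mf fc; apply: measurable_bounded_integrable => //.
  by rewrite [ltLHS](@probability_setT _ _ _ P) ltry.
exists c; split; first exact: num_real.
by move=> x cx w _ /=; apply: le_trans (fc w) (ltW cx).
Qed.

Lemma ge0_integrable f (c : R) : measurable_fun [set: T] f ->
  (forall w, 0 <= f w) -> (\int[P]_w (f w)%:E <= c%:E)%E ->
  P.-integrable [set: T] (EFin \o f).
Proof.
move=> mf f0 fc; apply/integrableP; split; first exact/measurable_EFinP.
under eq_integral do rewrite /= ger0_norm//.
by apply: le_lt_trans fc _; rewrite ltry.
Qed.

Lemma RintegralEFin f : P.-integrable [set: T] (EFin \o f) ->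
  (\int[P]_w (f w)%:E = (\int[P]_w f w)%:E)%E.
Proof.
by move=> intf; rewrite /Rintegral fineK//; exact: integrable_fin_num.
Qed.

Lemma ge0_Rintegral_le f (c : R) : measurable_fun [set: T] f ->
  (forall w, 0 <= f w) -> (\int[P]_w (f w)%:E <= c%:E)%E ->
  \int[P]_w f w <= c.
Proof.
move=> mf f0 fc; rewrite -lee_fin -RintegralEFin//.
exact: ge0_integrable fc.
Qed.

Lemma integrable_sumr (I : Type) (s : seq I) (F : I -> T -> R) :
  (forall i, P.-integrable [set: T] (EFin \o F i)) ->
  P.-integrable [set: T] (EFin \o (fun w => \sum_(i <- s) F i w)).
Proof.
move=> intF; apply: (eq_integrable _ (fun w => \sum_(i <- s) (F i w)%:E)%E) => //.
  by move=> w _; rewrite /= sumEFin.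
by apply: integrable_sum => // i _; exact: intF.
Qed.

Lemma Rintegral_sum (I : Type) (s : seq I) (F : I -> T -> R) :
  (forall i, P.-integrable [set: T] (EFin \o F i)) ->
  \int[P]_w (\sum_(i <- s) F i w) = \sum_(i <- s) \int[P]_w F i w.
Proof.
move=> intF; elim: s => [|i s IHs].
  by rewrite big_nil; under eq_Rintegral do rewrite big_nil; rewrite Rintegral_cst// mul0r.
rewrite big_cons -IHs -RintegralD//; last exact: integrable_sumr.
by apply: eq_Rintegral => w _; rewrite big_cons.
Qed.

Lemma Rintegral_cst1 (c : R) : \int[P]_w c = c.
Proof.
by rewrite Rintegral_cst// [X in fine X](@probability_setT _ _ _ P) mulr1.
Qed.

Lemma integrable_cstr (c : R) : P.-integrable [set: T] (EFin \o cst c).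
Proof. by apply: (@bounded_integrable _ `|c|). Qed.

Lemma integrableZr_real f (k : R) : P.-integrable [set: T] (EFin \o f) ->
  P.-integrable [set: T] (EFin \o (fun w => k * f w)).
Proof. by move=> /(integrableZl measurableT k); apply: eq_integrable. Qed.

Lemma integrableD_real f g : P.-integrable [set: T] (EFin \o f) ->
  P.-integrable [set: T] (EFin \o g) ->
  P.-integrable [set: T] (EFin \o (fun w => f w + g w)).
Proof. by move=> intf /(integrableD measurableT intf); apply: eq_integrable. Qed.

Lemma integrableB_real f g : P.-integrable [set: T] (EFin \o f) ->
  P.-integrable [set: T] (EFin \o g) ->
  P.-integrable [set: T] (EFin \o (fun w => f w - g w)).
Proof. by move=> intf /(integrableB measurableT intf); apply: eq_integrable. Qed.

(** Integrates the tangent line of the exponential at [c]. *)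
Lemma Rintegral_jensen_expR f (c : R) :
  P.-integrable [set: T] (EFin \o f) ->
  P.-integrable [set: T] (EFin \o (expR \o f)) ->
  c <= \int[P]_w f w -> expR c <= \int[P]_w expR (f w).
Proof.
move=> intf intef cf.
have int1 : P.-integrable [set: T] (EFin \o (fun w => expR c * f w)).
  exact: integrableZr_real.
have int2 := integrable_cstr (expR c * (1 - c)).
have : \int[P]_w (expR c * f w + expR c * (1 - c)) <= \int[P]_w expR (f w).
  apply: le_Rintegral => //; first exact: integrableD_real.
  move=> w _; rewrite -mulrDr -[f w in leRHS](subrKC c) expRD ler_wpM2l ?expR_ge0//.
  by apply: le_trans (expR_ge1Dx _); lra.
rewrite RintegralD// RintegralZl// Rintegral_cst1; apply: le_trans.
have := expR_gt0 c; nra.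
Qed.

End real_expectation.

(** * The characteristic function of a linear form of an unconditional log-concave vector *)

(** For nonnegative c_i, with b = sum c_i and q = sum c_i y_i, nonnegativity of the left-hand side
    is the Cauchy-Schwarz inequality for q. *)
Lemma sum_mulr_sqrB (R : comNzRingType) (n : nat) (b q : R) (c y : 'I_n -> R) :
  \sum_(i < n) c i * (b * y i - q) ^+ 2 =
  b * (\sum_(i < n) (b * c i) * y i ^+ 2) - 2 * b * q * (\sum_(i < n) c i * y i) +
  (\sum_(i < n) c i) * q ^+ 2.
Proof.
rewrite !mulr_sumr mulr_suml -sumrB -big_split/=.
by apply: eq_bigr => i _; ring.
Qed.

Section unconditional_characteristic_function.
Context d (T : measurableType d) {R : realType} (P : probability T R) {n : nat}.
Variables (X : {RV P >-> n.-tuple R}) (f : n.-tuple R -> R).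
Hypotheses (Xf : has_density X f) (lcf : log_concave f) (uf : unconditional f).
Hypothesis E2 : forall i, (\int[P]_w (tnth (X w) i ^+ 2)%:E = 1)%E.

(** Output of [expectation_moment_double] when the order is doubled from 2 to 4, starting from
    second moment 1; [moment8] comes from a second doubling. *)
Definition moment4 : R := 4 ^+ 2 * (4 / 3 * (4 ^+ 2 * 1 ^+ 2) + 4 ^+ 2).
Definition moment8 : R := 4 ^+ 4 * (4 / 3 * (4 ^+ 4 * moment4 ^+ 2) + 4 ^+ 4).

Let mX i : measurable_fun [set: T] (fun w => tnth (X w) i).
Proof. exact: measurableT_comp (measurable_coordinate i) _. Qed.

Let norm_even (r : R) k : `|r| ^+ (k + k) = r ^+ (k + k).
Proof. by rewrite -normrX ger0_norm// addnn -mul2n mulnC exprM sqr_ge0. Qed.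

Let E4 i : (\int[P]_w (tnth (X w) i ^+ 4)%:E <= moment4%:E)%E.
Proof.
under eq_integral do rewrite -(norm_even _ 2).
apply: (expectation_moment_double Xf lcf (k := 2) (c := 1)); first by rewrite E2.
by under eq_integral do rewrite (norm_even _ 1); rewrite E2.
Qed.

Let E8 i : (\int[P]_w (tnth (X w) i ^+ 8)%:E <= moment8%:E)%E.
Proof.
under eq_integral do rewrite -(norm_even _ 4).
apply: (expectation_moment_double Xf lcf (k := 4) (c := moment4)); first by rewrite E2.
by under eq_integral do rewrite (norm_even _ 2); exact: E4.
Qed.

Let int2 i : P.-integrable [set: T] (EFin \o (fun w => tnth (X w) i ^+ 2)).
Proof.
apply: (@ge0_integrable _ _ _ _ _ 1); rewrite ?E2//.
  exact: measurable_funX.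
by move=> w; exact: sqr_ge0.
Qed.

Let int4 i : P.-integrable [set: T] (EFin \o (fun w => tnth (X w) i ^+ 4)).
Proof.
apply: ge0_integrable (E4 i); first exact: measurable_funX.
by move=> w; exact: exprn_even_ge0.
Qed.

Let int8 i : P.-integrable [set: T] (EFin \o (fun w => tnth (X w) i ^+ 8)).
Proof.
apply: ge0_integrable (E8 i); first exact: measurable_funX.
by move=> w; exact: exprn_even_ge0.
Qed.

Let Rint2 i : \int[P]_w (tnth (X w) i ^+ 2) = 1.
Proof. by rewrite /Rintegral E2. Qed.

Let Rint4 i : \int[P]_w (tnth (X w) i ^+ 4) <= moment4.
Proof.
apply: ge0_Rintegral_le (E4 i); first exact: measurable_funX.
by move=> w; exact: exprn_even_ge0.
Qed.

Let Rint8 i : \int[P]_w (tnth (X w) i ^+ 8) <= moment8.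
Proof.
apply: ge0_Rintegral_le (E8 i); first exact: measurable_funX.
by move=> w; exact: exprn_even_ge0.
Qed.

Variable a : 'I_n -> R.

Let A := \sum_(i < n) a i ^+ 2.
Let B := \sum_(i < n) a i ^+ 4.
(** The additional 2 pays for v^2 <= 2 cut_exponent v + 2 v^4, which lets [r] be a polynomial with
    computable expectation. *)
Let K : R := tau_constant + 2.
Let M (x : n.-tuple R) := \sum_(i < n) cut_exponent (a i * tnth x i).
Let r (x : n.-tuple R) :=
  \sum_(i < n) ((a i * tnth x i) ^+ 2 - K * (a i * tnth x i) ^+ 4).

Let mtnth i : measurable_fun [set: n.-tuple R] (fun x : n.-tuple R => a i * tnth x i).
Proof. by apply: measurable_funM => //; exact: measurable_coordinate. Qed.

Let mM : measurable_fun [set: n.-tuple R] M.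
Proof.
apply: measurable_sum => i; apply: measurable_maxr => //.
by apply: measurable_funB; [apply: measurable_funM => //|]; exact: measurable_funX.
Qed.

Let mr : measurable_fun [set: n.-tuple R] r.
Proof.
apply: measurable_sum => i; apply: measurable_funB; first exact: measurable_funX.
by apply: measurable_funM => //; exact: measurable_funX.
Qed.

Let sqrt_weight_ge1 (x y : R) : x != 0 -> y != 0 -> 1 <= sqrt_weight x y.
Proof.
move=> x0 y0; rewrite /sqrt_weight; set p := Num.sqrt _; set q := Num.sqrt _.
have p0 : 0 < p by rewrite sqrtr_gt0 normr_gt0.
have q0 : 0 < q by rewrite sqrtr_gt0 normr_gt0.
rewrite ler_pdivlMr ?mulr_gt0// mul1r; have := sqr_ge0 (p - q); nra.
Qed.

Let sqrt_weightM (c x y : R) : c != 0 ->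
  sqrt_weight (c * x) (c * y) = sqrt_weight x y.
Proof.
move=> c0; rewrite /sqrt_weight !normrM !sqrtrM// -mulrDr exprMn.
set s := Num.sqrt `|c|; have s0 : s != 0 by rewrite gt_eqF// sqrtr_gt0 normr_gt0.
set p := Num.sqrt _; set q := Num.sqrt _.
have -> : 4 * (s * p * (s * q)) = s ^+ 2 * (4 * (p * q)) by ring.
by rewrite -mulf_div divff ?mul1r// expf_neq0.
Qed.

Let expectation_r : A - K * moment4 * B <= \int[P]_w r (X w).
Proof.
rewrite /r Rintegral_sum; last first.
  move=> i; apply: integrableB_real.
    by under eq_fun do rewrite exprMn; exact: integrableZr_real.
  apply: integrableZr_real.
  by under eq_fun do rewrite exprMn; exact: integrableZr_real.
rewrite /A /B mulr_sumr -sumrB; apply: ler_sum => i _.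
under eq_Rintegral do rewrite !exprMn.
rewrite RintegralB//; last 2 first.
- exact: integrableZr_real.
- by apply: integrableZr_real; exact: integrableZr_real.
have -> : \int[P]_w (a i ^+ 2 * tnth (X w) i ^+ 2) = a i ^+ 2.
  by rewrite RintegralZl// Rint2 mulr1.
have -> : \int[P]_w (K * (a i ^+ 4 * tnth (X w) i ^+ 4)) =
    K * (a i ^+ 4 * \int[P]_w (tnth (X w) i ^+ 4)).
  by rewrite RintegralZl//; [rewrite RintegralZl|exact: integrableZr_real].
rewrite lerD2l lerN2 -mulrA ler_wpM2l//.
  by rewrite /K /tau_constant; lra.
by rewrite [leRHS]mulrC ler_wpM2l// exprn_even_ge0.
Qed.

(** The substitute for independence. [expectation_sqrt_mean] with g = 2M, checked coordinatewise by
    [cut_exponent_transport], bounds E exp(-2M) by the inverse of E exp(r); Jensen's inequality and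
    the moments of order 2 and 4 bound E exp(r) from below. *)
Lemma expectation_cut_exponent :
  (\int[P]_w (expR (- (2 * M (X w))))%:E <= (expR (- (A - K * moment4 * B)))%:E)%E.
Proof.
have mM2 : measurable_fun [set: n.-tuple R] (fun x => 2 * M x) by exact: measurable_funM.
have H := expectation_sqrt_mean Xf lcf uf mM2 mr.
have {}H : ((\int[P]_w (expR (- (2 * M (X w))))%:E) * (\int[P]_w (expR (r (X w)))%:E) <= 1)%E.
  apply: H => x y x0 y0; rewrite /r /M mulr_sumr -sumrB expR_sum /tuple_weight.
  apply: ler_prod => i _; rewrite expR_ge0/=.
  have [->|ai0] := eqVneq (a i) 0.
    by rewrite !mul0r /cut_exponent !expr0n/= !mul0r !mulr0 subrr maxxx mulr0 subr0 expR0 sqrt_weight_ge1.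
  rewrite -(sqrt_weightM (tnth x i) (tnth y i) ai0).
  apply: le_trans (cut_exponent_transport (mulf_neq0 ai0 (x0 i)) (mulf_neq0 ai0 (y0 i))).
  by rewrite ler_expR lerD2r /K; have := cut_exponent_ge (a i * tnth y i); lra.
have mrX : measurable_fun [set: T] (fun w => r (X w)) by exact: measurableT_comp.
(* Each term u^2 - K u^4 is at most 1, so exp(r) is bounded and therefore integrable. *)
have r_le w : r (X w) <= n%:R.
  have -> : n%:R = \sum_(i < n) 1 :> R by rewrite sumr_const card_ord.
  rewrite /r.
  apply: ler_sum => i _; set u := _ * _.
  have -> : u ^+ 4 = u ^+ 2 ^+ 2 by rewrite -exprM.
  by rewrite /K /tau_constant; have := sqr_ge0 (u ^+ 2 - 2^-1); have := sqr_ge0 (u ^+ 2); lra.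
have intr : P.-integrable [set: T] (EFin \o (fun w => r (X w))).
  apply: integrable_sumr => i; apply: integrableB_real.
    by under eq_fun do rewrite exprMn; exact: integrableZr_real.
  apply: integrableZr_real.
  by under eq_fun do rewrite exprMn; exact: integrableZr_real.
have intexpr : P.-integrable [set: T] (EFin \o (fun w => expR (r (X w)))).
  apply: (@bounded_integrable _ _ _ _ _ (expR n%:R)); first exact: measurableT_comp.
  by move=> w; rewrite ger0_norm ?expR_ge0// ler_expR.
have := Rintegral_jensen_expR intr intexpr expectation_r.
rewrite -lee_fin -RintegralEFin// => J.
have I0 : (0 <= \int[P]_w (expR (- (2 * M (X w))))%:E)%E.
  by apply: integral_ge0 => w _; rewrite lee_fin expR_ge0.
have := le_trans (lee_wpmul2l I0 J) H.
by rewrite -lee_pdivlMr ?expR_gt0// mul1e -expRN.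
Qed.

Hypothesis B0 : 0 < B.

Let S w := \sum_(i < n) a i * tnth (X w) i.
(** Half the exponent of [expectation_cut_exponent], so that E q^2 <= exp(2 beta). *)
Let beta := - A / 2 + K * moment4 * B / 2.
Let q w := expR (- M (X w)).
Let p w := \prod_(i < n) cos (a i * tnth (X w) i).
Let Q w := \sum_(i < n) (a i * tnth (X w) i) ^+ 4.

Let mMX : measurable_fun [set: T] (fun w => M (X w)).
Proof. exact: measurableT_comp. Qed.

Let M0 x : 0 <= M x.
Proof. by apply: sumr_ge0 => i _; exact: cut_exponent_ge0. Qed.

Let mq : measurable_fun [set: T] q.
Proof. by apply: measurableT_comp => //; exact: measurable_funN. Qed.

Let q0 w : 0 <= q w. Proof. exact: expR_ge0. Qed.

Let q1 w : q w <= 1. Proof. by rewrite /q -[leRHS]expR0 ler_expR oppr_le0. Qed.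

Let intq : P.-integrable [set: T] (EFin \o q).
Proof. by apply: (@bounded_integrable _ _ _ _ _ 1) => // w; rewrite ger0_norm. Qed.

Let mq2 : measurable_fun [set: T] (fun w => expR (- (2 * M (X w)))).
Proof.
by apply: measurableT_comp => //; apply: measurable_funN; exact: measurable_funM.
Qed.

Let intq2 : P.-integrable [set: T] (EFin \o (fun w => expR (- (2 * M (X w))))).
Proof.
by apply: ge0_integrable expectation_cut_exponent => // w; rewrite expR_ge0.
Qed.

Let Rintq2 : \int[P]_w expR (- (2 * M (X w))) <= expR (beta + beta).
Proof.
have -> : beta + beta = - (A - K * moment4 * B) by rewrite /beta; field.
by apply: ge0_Rintegral_le => //; exact: expectation_cut_exponent.
Qed.

Let q2E w : expR (- (2 * M (X w))) = q w ^+ 2.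
Proof. by rewrite /q expr2 -expRD; congr expR; ring. Qed.

(** Jensen's inequality, from M <= sum (a_i X_i)^2 / 2 and unit second moments. *)
Let Rintq_ge : expR (- A / 2) <= \int[P]_w q w.
Proof.
pose V w := \sum_(i < n) (- 2^-1 * a i ^+ 2) * tnth (X w) i ^+ 2.
have intV : P.-integrable [set: T] (EFin \o V).
  by apply: integrable_sumr => i; exact: integrableZr_real.
have VM w : V w <= - M (X w).
  rewrite /V /M -sumrN; apply: ler_sum => i _.
  have := cut_exponent_le (a i * tnth (X w) i); rewrite exprMn; lra.
have mV : measurable_fun [set: T] V.
  by apply: measurable_sum => i; apply: measurable_funM => //; exact: measurable_funX.
have intexpV : P.-integrable [set: T] (EFin \o (expR \o V)).
  apply: (@bounded_integrable _ _ _ _ _ 1); first exact: measurableT_comp.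
  move=> w; rewrite ger0_norm ?expR_ge0// -[leRHS]expR0 ler_expR.
  by apply: le_trans (VM w) _; rewrite oppr_le0.
apply: (@le_trans _ _ (\int[P]_w expR (V w))).
  apply: Rintegral_jensen_expR => //.
  rewrite /V Rintegral_sum; last by move=> i; exact: integrableZr_real.
  rewrite /A mulNr mulrC mulr_sumr -sumrN; apply: ler_sum => i _.
  by rewrite RintegralZl// Rint2 mulr1 mulNr.
apply: le_Rintegral => // w _; rewrite ler_expR; exact: VM.
Qed.

(** Cauchy-Schwarz against E q^2, in the form 2 b q <= b^2 + q^2 with b = exp(beta). *)
Let Rintq_le : \int[P]_w q w <= expR beta.
Proof.
have : \int[P]_w (2^-1 * expR beta + 2^-1 * expR (- beta) * expR (- (2 * M (X w)))) <= expR beta.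
  rewrite RintegralD//; [|exact: integrable_cstr|exact: integrableZr_real].
  rewrite Rintegral_cst1 RintegralZl//.
  have : 2^-1 * expR (- beta) * \int[P]_w expR (- (2 * M (X w))) <=
      2^-1 * expR (- beta) * expR (beta + beta).
    by rewrite ler_wpM2l// mulr_ge0// expR_ge0.
  have -> : 2^-1 * expR (- beta) * expR (beta + beta) = 2^-1 * expR beta.
    by rewrite -mulrA -expRD addKr.
  lra.
apply: le_trans; apply: le_Rintegral => //.
  by apply: integrableD_real; [exact: integrable_cstr|exact: integrableZr_real].
move=> w _; rewrite q2E expRN; set b := expR beta; have b0 : 0 < b := expR_gt0 _.
rewrite -subr_ge0.
have -> : 2^-1 * b + 2^-1 / b * q w ^+ 2 - q w = (b - q w) ^+ 2 / (2 * b).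
  by field; rewrite gt_eqF.
by rewrite divr_ge0 ?sqr_ge0// mulr_ge0// ltW.
Qed.

Let p_le w : p w <= q w.
Proof.
apply: le_trans (ler_norm _) _.
rewrite /p /q /M normr_prod -sumrN expR_sum; apply: ler_prod => i _.
by rewrite normr_ge0 norm_cos_le_cut.
Qed.

(** The difference of the two products telescopes. Each coordinate contributes at most 2 u^4, and
    restoring its own factor exp(-cut_exponent u) >= 1/2 doubles the constant. *)
Let sub_p_le w : q w - p w <= 4 * Q w * q w.
Proof.
rewrite /q /p /M -sumrN expR_sum /Q.
elim: (index_enum _) => [|i s IHs]; first by rewrite !big_nil subrr mulr0 mul0r.
rewrite !big_cons; set qi := expR _; set pi := cos _; set ui := _ * tnth _ _.
set qs := \prod_(j <- s) _; set ps := \prod_(j <- s) _; set Us := \sum_(j <- s) _.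
have qi0 : 0 < qi := expR_gt0 _.
have qs0 : 0 <= qs by apply: prodr_ge0 => j _; exact: expR_ge0.
have hqp : qi - pi <= 2 * ui ^+ 4 := expR_cut_sub_cos _.
have hq2 : 2^-1 <= qi.
  apply: le_trans (expR_ge1Dx _); have := cut_exponent_le16 ui; lra.
have hp : `|pi| <= qi := norm_cos_le_cut _.
have u4 : 0 <= ui ^+ 4 by rewrite exprn_even_ge0.
have Us0 : 0 <= Us by apply: sumr_ge0 => j _; rewrite exprn_even_ge0.
have -> : qi * qs - pi * ps = (qi - pi) * qs + pi * (qs - ps) by ring.
have hsp : 0 <= qs - ps.
  rewrite subr_ge0; apply: le_trans (ler_norm _) _; rewrite normr_prod.
  by apply: ler_prod => j _; rewrite normr_ge0 norm_cos_le_cut.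
have h1 : (qi - pi) * qs <= 4 * ui ^+ 4 * (qi * qs).
  rewrite mulrA ler_wpM2r//; apply: le_trans hqp _.
  have : 0 <= ui ^+ 4 * (qi - 2^-1) by rewrite mulr_ge0// subr_ge0.
  nra.
have h2 : pi * (qs - ps) <= 4 * Us * (qi * qs).
  apply: (@le_trans _ _ (qi * (qs - ps))).
    by rewrite ler_wpM2r//; apply: le_trans (ler_norm _) hp.
  by rewrite [leRHS]mulrCA ler_wpM2l// ltW.
have -> : 4 * (ui ^+ 4 + Us) * (qi * qs) =
    4 * ui ^+ 4 * (qi * qs) + 4 * Us * (qi * qs) by ring.
exact: lerD.
Qed.

Let mp : measurable_fun [set: T] p.
Proof.
apply: measurable_prod => i _; apply: (measurableT_comp (f := @cos R)).
  by apply: continuous_measurable_fun; exact: continuous_cos.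
exact: measurable_funM.
Qed.

Let intp : P.-integrable [set: T] (EFin \o p).
Proof.
apply: (@bounded_integrable _ _ _ _ _ 1) => // w; rewrite /p normr_prod.
by apply: prodr_ile1 => i _; rewrite normr_ge0 cos_max.
Qed.

Let RintQ2 : P.-integrable [set: T] (EFin \o (fun w => Q w ^+ 2)) /\
  \int[P]_w (Q w ^+ 2) <= moment8 * B ^+ 2.
Proof.
pose W w := \sum_(i < n) (B * a i ^+ 4) * tnth (X w) i ^+ 8.
have intW : P.-integrable [set: T] (EFin \o W).
  by apply: integrable_sumr => i; exact: integrableZr_real.
have mQ : measurable_fun [set: T] Q.
  by apply: measurable_sum => i; apply: measurable_funX; exact: measurable_funM.
have QW w : Q w ^+ 2 <= W w.
  have QE : Q w = \sum_(i < n) a i ^+ 4 * tnth (X w) i ^+ 4.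
    by apply: eq_bigr => i _; rewrite exprMn.
  have : 0 <= \sum_(i < n) a i ^+ 4 * (B * tnth (X w) i ^+ 4 - Q w) ^+ 2.
    by apply: sumr_ge0 => i _; rewrite mulr_ge0 ?sqr_ge0// exprn_even_ge0.
  rewrite sum_mulr_sqrB -QE -/B.
  have -> : \sum_(i < n) (B * a i ^+ 4) * (tnth (X w) i ^+ 4) ^+ 2 = W w.
    by apply: eq_bigr => i _; rewrite -exprM.
  have -> : B * W w - 2 * B * Q w * Q w + B * Q w ^+ 2 = B * (W w - Q w ^+ 2) by ring.
  by rewrite pmulr_rge0// subr_ge0.
have intQ2 : P.-integrable [set: T] (EFin \o (fun w => Q w ^+ 2)).
  apply: (le_integrable measurableT _ _ intW).
    by apply/measurable_EFinP; exact: measurable_funX.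
  move=> w _ /=; rewrite lee_fin ger0_norm ?sqr_ge0//.
  by apply: le_trans (QW w) _; exact: ler_norm.
split => //.
apply: le_trans (le_Rintegral measurableT intQ2 intW (fun w _ => QW w)) _.
rewrite /W Rintegral_sum; last by move=> i; exact: integrableZr_real.
have BE : B = \sum_(i < n) a i ^+ 4 by [].
rewrite expr2 mulrA [X in _ <= _ * X]BE mulr_sumr; apply: ler_sum => i _.
rewrite RintegralZl// -[leRHS]mulrA [leRHS]mulrC ler_wpM2l//.
by rewrite mulr_ge0 ?(ltW B0)// exprn_even_ge0.
Qed.

(** The error 4 Q q is split as 2 (b/B) Q^2 + 2 (B/b) q^2 with b = exp(beta), the balance for which
    both expectations are of order B b. *)
Let Rintp_ge : expR (- A / 2) - 2 * (moment8 + 1) * B * expR beta <= \int[P]_w p w.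
Proof.
have [intQ2 EQ2] := RintQ2.
pose c1 := 2 * B^-1 * expR beta; pose c2 := 2 * B * expR (- beta).
have : \int[P]_w (q w - p w) <= 2 * (moment8 + 1) * B * expR beta.
  apply: (@le_trans _ _ (\int[P]_w (c1 * Q w ^+ 2 + c2 * expR (- (2 * M (X w)))))).
    apply: le_Rintegral => //.
    - exact: integrableB_real.
    - by apply: integrableD_real; exact: integrableZr_real.
    move=> w _; apply: le_trans (sub_p_le w) _; rewrite q2E /c1 /c2 expRN.
    set b := expR beta; have b0 : 0 < b := expR_gt0 _.
    rewrite -subr_ge0.
    have -> : 2 / B * b * Q w ^+ 2 + 2 * B / b * q w ^+ 2 - 4 * Q w * q w =
        2 * (b * Q w - B * q w) ^+ 2 / (B * b).
      by field; rewrite !gt_eqF.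
    by rewrite divr_ge0// mulr_ge0// ?sqr_ge0// ltW.
  rewrite RintegralD//; [|exact: integrableZr_real..].
  rewrite !RintegralZl//.
  have c10 : 0 <= c1 by rewrite !mulr_ge0 ?invr_ge0 ?expR_ge0// ltW.
  have c20 : 0 <= c2 by rewrite !mulr_ge0 ?expR_ge0// ltW.
  apply: le_trans (lerD (ler_wpM2l c10 EQ2) (ler_wpM2l c20 Rintq2)) _.
  rewrite /c1 /c2 expRN (expRD beta beta); set b := expR beta; have b0 : 0 < b := expR_gt0 _.
  rewrite le_eqVlt; apply/orP; left; apply/eqP.
  by field; rewrite !gt_eqF.
rewrite RintegralB//; have := Rintq_ge; lra.
Qed.

Lemma Rintegral_sign_change (delta : 'I_n -> R) (phi : n.-tuple R -> R) (c : R) :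
  (forall i, delta i = 1 \/ delta i = -1) ->
  measurable_fun [set: n.-tuple R] phi -> (forall x, `|phi x| <= c) ->
  \int[P]_w phi (sign_change delta (X w)) = \int[P]_w phi (X w).
Proof.
move=> hdelta mphi phic.
have mphid : measurable_fun [set: n.-tuple R] (phi \o sign_change delta).
  by apply: measurableT_comp => //; exact: measurable_sign_change.
have H (psi : n.-tuple R -> R) : measurable_fun [set: n.-tuple R] psi ->
    (forall x, `|psi x| <= c) ->
    \int[P]_w psi (X w) = fine (\int[P]_w (psi (X w) + c)%:E)%E - c.
  move=> mpsi psic.
  have -> : fine (\int[P]_w (psi (X w) + c)%:E)%E = \int[P]_w (psi (X w) + c) by [].
  rewrite RintegralD//; last exact: integrable_cstr.
    by rewrite Rintegral_cst1 addrK.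
  by apply: (@bounded_integrable _ _ _ _ _ c) => //; exact: measurableT_comp.
rewrite (H _ mphid)//; last by move=> x; exact: phic.
rewrite (H _ mphi)//; congr (fine _ - _).
apply: (integral_sign_change Xf uf hdelta (phi := fun x => (phi x + c)%:E)).
  by apply/measurable_EFinP; exact: measurable_funD.
move=> x; rewrite lee_fin -lerBlDr sub0r.
by have := phic x; rewrite ler_norml => /andP[].
Qed.

(** Averaging over the sign of one coordinate turns cos(u + s) into cos u cos s. In [F k] the first
    k coordinates have been split off. *)
Let RintS : \int[P]_w cos (S w) = \int[P]_w p w.
Proof.
pose u (i : 'I_n) (x : n.-tuple R) := a i * tnth x i.
pose F (k : nat) (x : n.-tuple R) := cos (\sum_(i < n | (k <= i)%N) u i x) *
  \prod_(i < n | (i < k)%N) cos (u i x).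
have mcos : measurable_fun [set: R] (@cos R).
  by apply: continuous_measurable_fun; exact: continuous_cos.
have mF k : measurable_fun [set: n.-tuple R] (F k).
  apply: measurable_funM.
    apply: (measurableT_comp mcos).
    have -> : (fun x => \sum_(i < n | (k <= i)%N) u i x) =
        (fun x => \sum_(i < n) if (k <= i)%N then u i x else 0).
      by apply/funext => x; rewrite big_mkcond.
    apply: measurable_sum => i; case: (k <= i)%N; last exact: measurable_cst.
    exact: mtnth.
  have -> : (fun x => \prod_(i < n | (i < k)%N) cos (u i x)) =
      (fun x => \prod_(i < n) if (i < k)%N then cos (u i x) else 1).
    by apply/funext => x; rewrite big_mkcond.
  apply: measurable_prod => i _; case: (i < k)%N; last exact: measurable_cst.
  by apply: (measurableT_comp mcos); exact: mtnth.
have F1 k x : `|F k x| <= 1.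
  rewrite normrM mulr_ile1//; first exact: cos_max.
  by rewrite normr_prod; apply: prodr_ile1 => i _; rewrite normr_ge0 cos_max.
have intF k : P.-integrable [set: T] (EFin \o (fun w => F k (X w))).
  by apply: (@bounded_integrable _ _ _ _ _ 1) => //; exact: measurableT_comp.
suff FE k : (k <= n)%N -> \int[P]_w F k (X w) = \int[P]_w F 0%N (X w).
  transitivity (\int[P]_w F 0%N (X w)).
    by apply: eq_Rintegral => w _; rewrite /F [X in _ * X]big_pred0 ?mulr1.
  rewrite -(FE n)//; apply: eq_Rintegral => w _; rewrite /F [X in cos X]big_pred0.
    by rewrite cos0 mul1r /p /u; apply: eq_bigl => i; rewrite ltn_ord.
  by move=> i; rewrite leqNgt ltn_ord.
elim: k => // k IHk kn; rewrite -IHk; last exact: ltnW.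
pose j := Ordinal kn; pose delta (i : 'I_n) : R := if i == j then -1 else 1.
have hdelta i : delta i = 1 \/ delta i = -1 by rewrite /delta; case: ifP; [right|left].
have mFd : measurable_fun [set: n.-tuple R] (F k \o sign_change delta).
  by apply: measurableT_comp => //; exact: measurable_sign_change.
have intFd : P.-integrable [set: T] (EFin \o (fun w => F k (sign_change delta (X w)))).
  apply: (@bounded_integrable _ _ _ _ _ 1) => //.
  exact: (measurableT_comp mFd).
have FS x : F k.+1 x = 2^-1 * (F k x + F k (sign_change delta x)).
  have uj : u j (sign_change delta x) = - u j x.
    by rewrite /u tnth_mktuple /delta eqxx mulN1r mulrN.
  have uN i : i != j -> u i (sign_change delta x) = u i x.
    by move=> /negbTE ij; rewrite /u tnth_mktuple /delta ij mul1r.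
  have sumk y : \sum_(i < n | (k <= i)%N) u i y = u j y + \sum_(i < n | (k < i)%N) u i y.
    rewrite (bigD1 j)//=; congr (_ + _); apply: eq_bigl => i.
    by rewrite ltn_neqAle andbC eq_sym.
  have -> : F k (sign_change delta x) =
      cos (- u j x + \sum_(i < n | (k < i)%N) u i x) * \prod_(i < n | (i < k)%N) cos (u i x).
    rewrite /F sumk uj; congr (cos (_ + _) * _).
      by apply: eq_bigr => i ki; rewrite uN// -val_eqE/= gtn_eqF.
    by apply: eq_bigr => i ki; rewrite uN// -val_eqE/= ltn_eqF.
  rewrite /F sumk [X in _ * X = _](bigD1 j)//=.
  have -> : \prod_(i < n | (i < k.+1)%N && (i != j)) cos (u i x) =
      \prod_(i < n | (i < k)%N) cos (u i x).
    by apply: eq_bigl => i; rewrite [RHS]ltn_neqAle ltnS andbC.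
  set s := \sum_(i < n | _) _; set pr := \prod_(i < n | _) _.
  by rewrite !cosD cosN sinN; field.
under eq_Rintegral do rewrite FS.
rewrite RintegralZl//; last exact: integrableD_real.
rewrite RintegralD// (Rintegral_sign_change hdelta (mF k) (F1 k)).
by field.
Qed.

(** E p lies between the bound of [Rintp_ge] and exp(beta), and exp(beta) exceeds exp(-A/2) by at
    most K moment4 B exp(beta). *)
Lemma characteristic_function_bound :
  `| \int[P]_w cos (\sum_(i < n) a i * tnth (X w) i) - expR (- A / 2) | <=
  (2 * (moment8 + 1) + K * moment4) * B * expR beta.
Proof.
have -> : \int[P]_w cos (\sum_(i < n) a i * tnth (X w) i) = \int[P]_w p w by exact: RintS.
have h1 := Rintp_ge.
have h2 : \int[P]_w p w <= expR beta.
  apply: le_trans Rintq_le; exact: le_Rintegral.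
have KB0 : 0 <= K * moment4 * B.
  by rewrite mulr_ge0 ?(ltW B0)// mulr_ge0// /K /tau_constant ?/moment4; lra.
have h3 : expR beta - expR (- A / 2) <= K * moment4 * B * expR beta.
  have -> : expR (- A / 2) = expR beta * expR (- (K * moment4 * B / 2)).
    by rewrite -expRD; congr expR; rewrite /beta; ring.
  have := expR_ge1Dx (- (K * moment4 * B / 2)); have := expR_gt0 beta.
  set b := expR beta; set e := expR _; set k := K * _ * _ => b0 he.
  have : b * (1 - k / 2) <= b * e by rewrite ler_wpM2l// ltW.
  have : 0 <= k * b by rewrite mulr_ge0// ltW.
  nra.
have h4 : 0 <= K * moment4 * B * expR beta by rewrite mulr_ge0// expR_ge0.
have h5 : 0 <= 2 * (moment8 + 1) * B * expR beta.
  rewrite mulr_ge0 ?expR_ge0// mulr_ge0 ?(ltW B0)// mulr_ge0// addr_ge0//.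
  rewrite /moment8 mulr_ge0// addr_ge0// mulr_ge0// mulr_ge0 ?sqr_ge0//.
have -> : (2 * (moment8 + 1) + K * moment4) * B * expR beta =
  2 * (moment8 + 1) * B * expR beta + K * moment4 * B * expR beta by ring.
move: h1 h2 h3 h4 h5.
set e1 := 2 * _ * _ * _; set e2 := K * _ * _ * _; set I := Rintegral _ _ _.
by move=> h1 h2 h3 h4 h5; rewrite ler_norml; apply/andP; split; lra.
Qed.

End unconditional_characteristic_function.

(** * Fubini's theorem under a product majorant *)

Section dominated_fubini.
Context d1 d2 (T1 : measurableType d1) (T2 : measurableType d2) {R : realType}.
Variables (m1 : {sigma_finite_measure set T1 -> \bar R})
  (m2 : {sigma_finite_measure set T2 -> \bar R}).
Variables (f : T1 * T2 -> R) (g1 : T1 -> R) (g2 : T2 -> R).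
Hypotheses (mf : measurable_fun [set: T1 * T2] f)
  (int1 : m1.-integrable [set: T1] (EFin \o g1))
  (int2 : m2.-integrable [set: T2] (EFin \o g2))
  (f_le : forall x y, `|f (x, y)| <= g1 x * g2 y).

Let mEf : measurable_fun [set: T1 * T2] (EFin \o f).
Proof. exact/measurable_EFinP. Qed.

Let section1 x : m2.-integrable [set: T2] (fun y => (f (x, y))%:E).
Proof.
apply: (le_integrable measurableT _ _ (integrableZl measurableT (g1 x) int2)).
  exact: (measurableT_comp mEf (measurable_pair1 x)).
move=> y _; rewrite /= lee_fin; apply: le_trans (f_le x y) _.
exact: ler_norm.
Qed.

Let section2 y : m1.-integrable [set: T1] (fun x => (f (x, y))%:E).
Proof.
apply: (le_integrable measurableT _ _ (integrableZl measurableT (g2 y) int1)).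
  exact: (measurableT_comp mEf (measurable_pair2 y)).
move=> x _; rewrite /= lee_fin; apply: le_trans (f_le x y) _.
by rewrite mulrC; exact: ler_norm.
Qed.

Let intf : (m1 \x m2)%E.-integrable [set: T1 * T2] (EFin \o f).
Proof.
apply/(integrable12ltyP _ _ mEf).2.
apply: (@le_lt_trans _ _ (\int[m1]_x (`|g1 x|%:E * \int[m2]_y `|g2 y|%:E))%E).
  apply: ge0_le_integral => //.
  - by move=> x _; apply: integral_ge0.
  - apply: (measurable_fun_fubini_tonelli_F (fun p => `|(f p)%:E|%E)) => //.
    exact: measurableT_comp.
  - apply: emeasurable_funM => //; apply/measurable_EFinP.
    by apply: measurableT_comp => //; apply/measurable_EFinP; exact: measurable_int int1.
  move=> x _; rewrite -ge0_integralZl//; last first.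
    apply/measurable_EFinP; apply: measurableT_comp => //.
    by apply/measurable_EFinP; exact: measurable_int int2.
  apply: ge0_le_integral => //.
  - apply: measurableT_comp => //.
    exact: (measurableT_comp mEf (measurable_pair1 x)).
  - apply: emeasurable_funM => //; apply/measurable_EFinP; apply: measurableT_comp => //.
    by apply/measurable_EFinP; exact: measurable_int int2.
  move=> y _; rewrite /= -EFinM lee_fin -normrM.
  by apply: le_trans (f_le x y) _; exact: ler_norm.
rewrite ge0_integralZr//.
- have /integrableP[_ h1] := int1; have /integrableP[_ h2] := int2.
  by apply: lte_mul_pinfty => //; rewrite ?integral_ge0// ge0_fin_numE// integral_ge0.
- apply/measurable_EFinP; apply: measurableT_comp => //.
  by apply/measurable_EFinP; exact: measurable_int int1.
- exact: integral_ge0.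
Qed.

Lemma Rintegral_fubini :
  \int[m1]_x (\int[m2]_y f (x, y)) = \int[m2]_y (\int[m1]_x f (x, y)).
Proof.
have E1 x : (\int[m2]_y f (x, y))%:E = (\int[m2]_y (f (x, y))%:E)%E.
  by rewrite /Rintegral fineK//; exact: integrable_fin_num.
have E2 y : (\int[m1]_x f (x, y))%:E = (\int[m1]_x (f (x, y))%:E)%E.
  by rewrite /Rintegral fineK//; exact: integrable_fin_num.
rewrite {1}/Rintegral [RHS]/Rintegral; congr fine.
under eq_integral do rewrite E1; under [RHS]eq_integral do rewrite E2.
exact: (Fubini intf).
Qed.

Lemma integrable_Rintegral_section :
  m1.-integrable [set: T1] (EFin \o (fun x => \int[m2]_y f (x, y))).
Proof.
have := integrable_fubini_F intf; apply: eq_integrable => // x _.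
by rewrite /fubini_F /= /Rintegral fineK//; exact: integrable_fin_num.
Qed.

End dominated_fubini.

(** * Calculus on the line *)

Section jackson_kernel.
Context {R : realType}.
Local Notation mu := (@lebesgue_measure R).

Lemma Rintegral_FTC2 (f F : R -> R) (a b : R) : a <= b ->
  (forall x, {for x, continuous f}) ->
  (forall x, is_derive x (1 : R) F (f x)) ->
  \int[mu]_(x in `[a, b]) f x = F b - F a.
Proof.
move=> ab cf dF; have cF : continuous F.
  by move=> x; apply: differentiable_continuous; apply/derivable1_diffP.
move: ab; rewrite le_eqVlt => /orP[/eqP <-|ab].
  by rewrite set_itv1 Rintegral_set1 subrr.
rewrite /Rintegral (@continuous_FTC2 _ _ F)//.
- exact: continuous_subspaceT.
- split.
  + by move=> x _; exact: ex_derive.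
  + by apply: cvg_at_right_filter; exact: cF.
  + by apply: cvg_at_left_filter; exact: cF.
- by move=> x _; rewrite derive1E; exact: derive_val.
Qed.

Lemma Rintegral_indic_oc (f F : R -> R) (a b : R) : a <= b ->
  continuous f -> (forall x, is_derive x (1 : R) F (f x)) ->
  \int[mu]_x (\1_`]a, b] x * f x) = F b - F a.
Proof.
move=> ab cf dF; rewrite -(Rintegral_FTC2 ab cf dF).
have mf : measurable_fun [set: R] f by exact: continuous_measurable_fun.
rewrite /Rintegral; congr fine.
rewrite -integral_itv_obnd_cbnd; last first.
  by apply: measurable_funTS; exact/measurable_EFinP.
rewrite [RHS]integral_mkcond; apply: eq_integral => x _.
by rewrite patchE indicE; case: ifP => _; rewrite ?mul1r ?mul0r.
Qed.

Lemma is_derive1D (f g : R -> R) (x df dg : R) :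
  is_derive x 1 f df -> is_derive x 1 g dg ->
  is_derive x (1 : R) (fun t => f t + g t) (df + dg).
Proof. by move=> hf hg; exact: is_deriveD. Qed.

Lemma is_derive1B (f g : R -> R) (x df dg : R) :
  is_derive x 1 f df -> is_derive x 1 g dg ->
  is_derive x (1 : R) (fun t => f t - g t) (df - dg).
Proof. by move=> hf hg; exact: is_deriveB. Qed.

Lemma is_derive1M (f g : R -> R) (x df dg : R) :
  is_derive x 1 f df -> is_derive x 1 g dg ->
  is_derive x (1 : R) (fun t => f t * g t) (f x * dg + g x * df).
Proof. by move=> hf hg; exact: is_deriveM. Qed.

Lemma is_derive1X (f : R -> R) n (x df : R) :
  is_derive x 1 f df ->
  is_derive x (1 : R) (fun t => f t ^+ n.+1) (n.+1%:R * f x ^+ n * df).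
Proof.
move=> hf; have -> : (fun t => f t ^+ n.+1) = (f ^+ n.+1)%R.
  by rewrite exprfctE.
exact: is_deriveX.
Qed.

Lemma is_derive1_compose (f g : R -> R) (x df dg : R) :
  is_derive x 1 f df -> is_derive (f x) 1 g dg ->
  is_derive x (1 : R) (fun t => g (f t)) (dg * df).
Proof. by move=> hf hg; exact: is_derive1_comp. Qed.

Lemma is_derive1_continuous (f : R -> R) (x df : R) :
  is_derive x (1 : R) f df -> {for x, continuous f}.
Proof.
by move=> hf; apply: differentiable_continuous; apply/derivable1_diffP.
Qed.

Lemma is_derive1_cst (c x : R) : is_derive x (1 : R) (fun=> c) 0.
Proof. exact: is_derive_cst. Qed.

Lemma is_derive1_id (x : R) : is_derive x (1 : R) (fun t => t) 1.
Proof. exact: is_derive_id. Qed.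

End jackson_kernel.

Ltac derive1 := repeat first
  [ apply: is_derive1_cst | apply: is_derive1_id
  | apply: is_derive1B | apply: is_derive1D | apply: is_derive1M
  | apply: is_derive1X
  | apply: (is_derive1_compose (g := sin)); [|exact: is_derive_sin]
  | apply: (is_derive1_compose (g := cos)); [|exact: is_derive_cos]
  | apply: (is_derive1_compose (g := expR)); [|exact: is_derive_expR] ].

(** * The Jackson kernel and its Fourier transform *)

Section k.
Context {R : realType}.
Local Notation mu := (@lebesgue_measure R).

Let cube_cos (a z : R) : 0 <= a -> z != 0 ->
  \int[mu]_s (\1_`]0, a] s * ((a - s) ^+ 3 * cos (s * z))) =
  3 * a ^+ 2 / z ^+ 2 - 6 * (1 - cos (a * z)) / z ^+ 4.
Proof.
move=> a0 z0.
(* Antiderivative found by repeated integration by parts. *)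
pose F s := (a - s) ^+ 3 * (sin (s * z) / z) - 3 * (a - s) ^+ 2 * (cos (s * z) / z ^+ 2)
  - 6 * (a - s) * (sin (s * z) / z ^+ 3) + 6 * (cos (s * z) / z ^+ 4).
have cf : continuous (fun s => (a - s) ^+ 3 * cos (s * z)).
  by move=> s; apply: is_derive1_continuous; derive1.
have dF s : is_derive s (1 : R) F ((a - s) ^+ 3 * cos (s * z)).
  apply: is_derive_eq; rewrite /GRing.scale/=.
  by field.
rewrite (Rintegral_indic_oc a0 cf dF) /F !subrr !mul0r subr0 sin0 cos0 !expr0n/= !mulr0 !mul0r.
by field.
Qed.

Lemma integrable_indic_oc (f : R -> R) (a b c : R) :
  measurable_fun [set: R] f -> (forall x, a < x <= b -> `|f x| <= c) ->
  mu.-integrable [set: R] (EFin \o (fun x => \1_`]a, b] x * f x)).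
Proof.
move=> mf fc.
have int1 := @integrable_indic_itv R a b false false.
have mI : measurable_fun [set: R] (fun x : R => \1_`]a, b] x : R).
  exact: measurable_indic.
apply: (le_integrable measurableT _ _ (integrableZl measurableT c int1)).
  by apply/measurable_EFinP; exact: measurable_funM.
move=> x _; rewrite /= lee_fin indicE.
have [|_] := boolP (x \in _); last by rewrite !(mul0r, mulr0) normr0.
rewrite inE/= in_itv/= => /fc fxc; rewrite mul1r mulr1.
by apply: le_trans fxc (ler_norm _).
Qed.

(** On [0, 2] this is the centred cubic B-spline with integer knots. *)
Definition jackson_weight (s : R) : R :=
  ((2 - s) ^+ 3 - 4 * Num.max (1 - s) 0 ^+ 3) / 6.

(** For z != 0 this is half the fourth power of sin(z/2) / (z/2). It is nonnegative and
    band-limited, and its decay in z^-4, unlike that of the Fejer kernel, gives it a finite second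
    moment. *)
Definition jackson_kernel (z : R) : R := 2 * (1 - cos z) ^+ 2 / z ^+ 4.

Lemma measurable_jackson_weight : measurable_fun [set: R] jackson_weight.
Proof.
apply: measurable_funM => //; apply: measurable_funB.
  by apply: measurable_funX; exact: measurable_funB.
apply: measurable_funM => //; apply: measurable_funX.
by apply: measurable_maxr => //; exact: measurable_funB.
Qed.

Lemma measurable_cos : measurable_fun [set: R] (@cos R).
Proof. by apply: continuous_measurable_fun; exact: continuous_cos. Qed.

Lemma measurable_sin : measurable_fun [set: R] (@sin R).
Proof. by apply: continuous_measurable_fun; exact: continuous_sin. Qed.

Lemma measurable_invr : measurable_fun [set: R] (@GRing.inv R).
Proof.
have -> : [set: R] = [set x | x != 0] `|` [set 0].
  apply/seteqP; split => x //= _; have [->|x0] := eqVneq x 0; [by right|by left].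
have op : open [set x : R | x != 0].
  rewrite (_ : [set x | _] = ~` [set 0]); last by apply/seteqP; split => x /=; move/eqP.
  by apply: closed_openC; exact: closed_eq.
apply/measurable_funU => //; first exact: open_measurable.
split; last exact: measurable_fun_set1.
apply: open_continuous_measurable_fun => // x; rewrite inE/= => x0.
exact: inv_continuous.
Qed.

Lemma measurable_jackson_kernel : measurable_fun [set: R] jackson_kernel.
Proof.
apply: measurable_funM.
  apply: measurable_funM => //; apply: measurable_funX.
  by apply: measurable_funB => //; exact: measurable_cos.
by apply: (measurableT_comp measurable_invr); exact: measurable_funX.
Qed.

Lemma jackson_weight_le (s : R) : 0 < s <= 2 -> `|jackson_weight s| <= 2.
Proof.
move=> /andP[s0 s2]; rewrite /jackson_weight.
have h1 : 0 <= (2 - s) ^+ 3 <= 8.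
  rewrite exprn_ge0 ?subr_ge0//= (_ : 8 = 2 ^+ 3); last by rewrite -natrX.
  by apply: lerXn2r; rewrite ?nnegrE ?subr_ge0//; lra.
have h2 : 0 <= Num.max (1 - s) 0 ^+ 3 <= 1.
  rewrite exprn_ge0 ?le_max ?lexx ?orbT//=.
  by apply: exprn_ile1; rewrite ?le_max ?lexx ?orbT// ge_max; apply/andP; split; lra.
by move: h1 h2; set x := (2 - s) ^+ 3; set y := _ ^+ 3 => /andP[? ?] /andP[? ?];
  rewrite ler_norml; apply/andP; split; lra.
Qed.

Lemma Rintegral_jackson_weight_cos (z : R) : z != 0 ->
  \int[mu]_s (\1_`]0, 2] s * (jackson_weight s * cos (s * z))) = jackson_kernel z.
Proof.
move=> z0.
pose f1 s := \1_`]0, 2] s * ((2 - s) ^+ 3 * cos (s * z)).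
pose f2 s := \1_`]0, 1] s * ((1 - s) ^+ 3 * cos (s * z)).
have E s : \1_`]0, 2] s * (jackson_weight s * cos (s * z)) =
    6^-1 * f1 s - (4 / 6) * f2 s.
  rewrite /f1 /f2 /jackson_weight !indicE !mem_setE !in_itv/=.
  have [s1|s1] := leP s 1.
    rewrite max_l ?subr_ge0// (le_trans s1) ?ler1n//.
    by case: (0 < s) => /=; field.
  rewrite max_r ?subr_le0 ?(ltW s1)// ?andbF.
  by case: (_ && _) => /=; field.
under eq_Rintegral do rewrite E.
have mc (b : R) : measurable_fun [set: R] (fun s : R => (b - s) ^+ 3 * cos (s * z)).
  apply: measurable_funM; first by apply: measurable_funX; exact: measurable_funB.
  by apply: (measurableT_comp measurable_cos); exact: measurable_funM.
have int (b : R) : 0 <= b -> mu.-integrable [set: R]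
    (EFin \o (fun s => \1_`]0, b] s * ((b - s) ^+ 3 * cos (s * z)))).
  move=> b0; apply: (@integrable_indic_oc _ _ _ (b ^+ 3)) => // s /andP[s0 sb].
  rewrite normrM -[leRHS]mulr1; apply: ler_pM => //; last exact: cos_max.
  rewrite normrX; apply: lerXn2r; rewrite ?nnegrE//.
  by rewrite ger0_norm ?subr_ge0// gerBl ltW.
have i1 := int 2 (ler0n _ _); have i2 := int 1 ler01.
rewrite RintegralB//; last 2 first.
- by have := integrableZl measurableT (6^-1) i1; apply: eq_integrable.
- by have := integrableZl measurableT (4 / 6) i2; apply: eq_integrable.
rewrite !RintegralZl// !cube_cos//.
rewrite /jackson_kernel (_ : 2 * z = z + z); last by ring.
rewrite mul1r cosD -!expr2 sin2cos2.
by field.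
Qed.

Lemma jackson_kernel_ge0 (z : R) : 0 <= jackson_kernel z.
Proof.
rewrite /jackson_kernel; apply: divr_ge0; last exact: exprn_even_ge0.
by rewrite mulr_ge0// sqr_ge0.
Qed.

Lemma one_sub_cos_bounds (z : R) : 0 <= 1 - cos z <= 2.
Proof. by have := cos_le1 z; have := cos_geN1 z; move=> ? ?; apply/andP; split; lra. Qed.

Lemma jackson_kernel_moment_le (z : R) : 0 < z ->
  (1 + z ^+ 2) * jackson_kernel z <= 64 * (1 + z) ^- 2.
Proof.
move=> z0; have z1 : 0 < 1 + z by rewrite addr_gt0.
have /andP[c0 c2] := one_sub_cos_bounds z.
have c1 : 1 - cos z <= z ^+ 2 / 2 by have := cos_ge_taylor2 z; lra.
rewrite /jackson_kernel mulrA ler_pdivrMr ?exprn_gt0// mulrAC ler_pdivlMr ?exprn_gt0//.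
set c := 1 - cos z in c0 c1 c2 *.
have z20 : 0 <= z ^+ 2 := sqr_ge0 z.
have pz : 0 <= 1 + z ^+ 2 by rewrite addr_ge0.
have pc : 0 <= 2 * c ^+ 2 by rewrite mulr_ge0// sqr_ge0.
have pp : 0 <= (1 + z ^+ 2) * (2 * c ^+ 2) by rewrite mulr_ge0.
have [zle1|zgt1] := leP z 1.
  have h : 2 * c ^+ 2 <= 2 * (z ^+ 2 / 2) ^+ 2.
    by rewrite ler_pM2l// ler_sqr ?nnegrE ?divr_ge0.
  have h1 : 1 + z ^+ 2 <= 2.
    have : z ^+ 2 <= 1 by apply: exprn_ile1 => //; exact: ltW.
    lra.
  have h2 : (1 + z) ^+ 2 <= 2 ^+ 2 by rewrite ler_sqr ?nnegrE ?(ltW z1)//; lra.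
  apply: le_trans (ler_pM pp (sqr_ge0 _) (ler_pM pz pc h1 h) h2) _.
  have : 0 <= z ^+ 4 by rewrite exprn_even_ge0.
  have -> : 2 * (2 * (z ^+ 2 / 2) ^+ 2) * 2 ^+ 2 = 4 * z ^+ 4 by field.
  lra.
have h : 2 * c ^+ 2 <= 2 * 2 ^+ 2 by rewrite ler_pM2l// ler_sqr ?nnegrE.
have h1 : 1 + z ^+ 2 <= 2 * z ^+ 2.
  have : 1 <= z ^+ 2 by rewrite exprn_ege1// ltW.
  lra.
have h2 : (1 + z) ^+ 2 <= (2 * z) ^+ 2.
  rewrite ler_sqr ?nnegrE ?(ltW z1)//; first lra.
  by rewrite mulr_ge0// ltW.
apply: le_trans (ler_pM pp (sqr_ge0 _) (ler_pM pz pc h1 h) h2) _.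
by rewrite le_eqVlt; apply/orP; left; apply/eqP; ring.
Qed.

End k.

(** * Integrability of an inverse-square majorant of the kernel *)

Section jackson_kernel_integrals.
Context {R : realType}.
Local Notation mu := (@lebesgue_measure R).

Definition half_kernel (z : R) : R := \1_`]0, +oo[ z * jackson_kernel z.

Lemma half_kernel_ge0 z : 0 <= half_kernel z.
Proof. by rewrite mulr_ge0// jackson_kernel_ge0. Qed.

Lemma measurable_half_kernel : measurable_fun [set: R] half_kernel.
Proof.
by apply: measurable_funM; [exact: measurable_indic|exact: measurable_jackson_kernel].
Qed.

Lemma integrable_inv_sqr :
  mu.-integrable [set: R] (EFin \o (fun z => \1_`]0, +oo[ z * (1 + z) ^- 2)).
Proof.
have mf : measurable_fun [set: R] (fun z : R => (1 + z) ^- 2).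
  apply: (measurableT_comp measurable_invr); apply: measurable_funX.
  exact: measurable_funD.
apply/integrableP; split.
  by apply/measurable_EFinP; apply: measurable_funM => //; exact: measurable_indic.
have -> : (\int[mu]_z `|(\1_`]0%R, +oo[ z * (1 + z) ^- 2)%:E| =
    \int[mu]_(z in `[0%R, +oo[) ((1 + z) ^- 2)%:E)%E.
  rewrite -integral_itv_obnd_cbnd; last first.
    by apply: measurable_funTS; exact/measurable_EFinP.
  rewrite [RHS]integral_mkcond; apply: eq_integral => z _.
  rewrite patchE indicE; case: ifP => _; last by rewrite mul0r /= normr0.
  by rewrite mul1r /= ger0_norm// invr_ge0 sqr_ge0.
have nz (x : R) : 0 <= x -> 1 + x != 0.
  by move=> x0; rewrite gt_eqF// ltr_pwDl.
have dF (z : R) : 0 <= z -> is_derive z (1 : R) (fun t => - (1 + t)^-1) ((1 + z) ^- 2).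
  move=> z0; have d1 : is_derive z (1 : R) (fun t : R => 1 + t) 1.
    by have := is_derive1D (is_derive1_cst 1 z) (is_derive1_id z); rewrite add0r.
  have dV : derivable (fun t : R => (1 + t)^-1) z 1 by apply: derivableV => //; exact: nz.
  have := derivableP dV; rewrite deriveV//; last exact: nz.
  rewrite (derive_val (is_derive := d1)) => h.
  have := is_derive1B (is_derive1_cst 0 z) h.
  under eq_fun do rewrite sub0r.
  by rewrite sub0r /GRing.scale/= mulr1 opprK.
have cF (z : R) : 0 <= z -> {for z, continuous (fun t : R => - (1 + t)^-1)}.
  by move=> z0; apply: is_derive1_continuous; exact: dF.
rewrite (@ge0_continuous_FTC2y _ _ (fun t => - (1 + t)^-1) 0 0)//.
- by rewrite -EFinB ltry.
- by move=> z z0; rewrite invr_ge0 sqr_ge0.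
- apply: continuous_in_subspaceT => z; rewrite inE/= in_itv/= andbT => z0.
  apply: (@continuous_comp _ _ _ (fun t : R => (1 + t) ^+ 2) (@GRing.inv R)); last first.
    by apply: inv_continuous; rewrite expf_neq0// nz.
  by apply: is_derive1_continuous; derive1.
- rewrite -[X in _ --> X]oppr0.
  apply: cvgN; apply/gtr0_cvgV0; last first.
    exact: cvg_addrl.
  near=> z; rewrite ltr_pwDl//; near: z; exact: nbhs_pinfty_ge.
- by move=> z z0; have := dF z (ltW z0) => h; exact: ex_derive.
- by apply: cvg_at_right_filter; exact: cF.
- move=> z; rewrite in_itv/= andbT => z0.
  by have h' := dF z (ltW z0); rewrite derive1E; exact: derive_val.
Unshelve. all: by end_near. Qed.

End jackson_kernel_integrals.

(** * Mass and second moment of the kernel, and the smoothed sign function *)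

Section jackson_sign.
Context {R : realType}.
Local Notation mu := (@lebesgue_measure R).
Local Notation half_kernel := (@half_kernel R).

Let integrable_inv_sqr64 : mu.-integrable [set: R]
  (EFin \o (fun z => 64 * (\1_`]0, +oo[ z * (1 + z) ^- 2))).
Proof.
by have := integrableZl measurableT 64 (@integrable_inv_sqr R); apply: eq_integrable.
Qed.

Let half_kernel_le z : (1 + z ^+ 2) * half_kernel z <=
  64 * (\1_`]0, +oo[ z * (1 + z) ^- 2).
Proof.
rewrite /half_kernel indicE mem_setE in_itv/= andbT; case: ltP => z0.
  by rewrite !mul1r; exact: jackson_kernel_moment_le.
by rewrite !mul0r !mulr0.
Qed.

Lemma integrable_half_kernel : mu.-integrable [set: R] (EFin \o half_kernel).
Proof.
apply: (le_integrable measurableT _ _ integrable_inv_sqr64).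
  by apply/measurable_EFinP; exact: measurable_half_kernel.
move=> z _; rewrite /= lee_fin ger0_norm ?half_kernel_ge0//.
apply: le_trans (ler_norm _); apply: le_trans (half_kernel_le z).
by rewrite ler_peMl ?half_kernel_ge0// lerDl sqr_ge0.
Qed.

Lemma integrable_sqr_half_kernel :
  mu.-integrable [set: R] (EFin \o (fun z => half_kernel z * z ^+ 2)).
Proof.
apply: (le_integrable measurableT _ _ integrable_inv_sqr64).
  apply/measurable_EFinP; apply: measurable_funM => //.
  exact: measurable_half_kernel.
move=> z _; rewrite /= lee_fin ger0_norm; last first.
  by rewrite mulr_ge0 ?half_kernel_ge0// sqr_ge0.
apply: le_trans (ler_norm _); apply: le_trans (half_kernel_le z).
by rewrite mulrC ler_wpM2r ?half_kernel_ge0// lerDr.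
Qed.

Definition kernel_mass : R := \int[mu]_z half_kernel z.
Definition kernel_moment2 : R := \int[mu]_z (half_kernel z * z ^+ 2).

Lemma kernel_moment2_ge0 : 0 <= kernel_moment2.
Proof.
by apply: Rintegral_ge0 => z _; rewrite mulr_ge0 ?half_kernel_ge0// sqr_ge0.
Qed.

(** The kernel is at least 1/8 on ]0, 1/2]. *)
Lemma kernel_mass_gt0 : 0 < kernel_mass.
Proof.
apply: (@lt_le_trans _ _ (2^-1 * 8^-1)); first by rewrite mulr_gt0.
have dF (x : R) : is_derive x (1 : R) (fun t => t * 8^-1) 8^-1.
  by have := is_derive1M (is_derive1_id x) (is_derive1_cst 8^-1 x); rewrite mulr0 mulr1 add0r.
have cf : continuous (fun _ : R => 8^-1 : R) by move=> x; exact: cvg_cst.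
have h0 : 0 <= 2^-1 :> R by rewrite invr_ge0.
have := Rintegral_indic_oc h0 cf dF; rewrite mul0r subr0 => <-.
apply: le_Rintegral => //.
- apply: (@integrable_indic_oc _ (cst 8^-1) _ _ 8^-1) => // x _.
  by rewrite ger0_norm// invr_ge0.
- exact: integrable_half_kernel.
move=> z _; rewrite /half_kernel !indicE !mem_setE !in_itv/= andbT.
have [z0|z0] := ltP 0 z; last by rewrite /= !mul0r.
have [z2|z2] := leP z 2^-1; last by rewrite /= mul0r mul1r jackson_kernel_ge0.
rewrite /= !mul1r /jackson_kernel ler_pdivlMr ?exprn_gt0//.
have z14 : z ^+ 2 <= 4^-1.
  have -> : 4^-1 = 2^-1 ^+ 2 :> R by field.
  by rewrite ler_sqr ?nnegrE// ltW.
have c1 : z ^+ 2 / 4 <= 1 - cos z.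
  have : z ^+ 2 < 2^-1 by lra.
  move=> /cos_le_taylor4; have -> : z ^+ 4 = z ^+ 2 * z ^+ 2 by rewrite -exprD.
  have := sqr_ge0 z; nra.
have c2 : (z ^+ 2 / 4) ^+ 2 <= (1 - cos z) ^+ 2.
  have c3 : 0 <= z ^+ 2 / 4 by rewrite divr_ge0// sqr_ge0.
  by rewrite ler_sqr ?nnegrE//; apply: le_trans c1.
have -> : z ^+ 4 = (z ^+ 2) ^+ 2 by rewrite -exprM.
have -> : (z ^+ 2) ^+ 2 = 16 * (z ^+ 2 / 4) ^+ 2 by field.
lra.
Qed.

Definition le_indic (z y : R) : R := if z <= y then 1 else 0.

Lemma le_indic_ge0 z y : 0 <= le_indic z y.
Proof. by rewrite /le_indic; case: ifP. Qed.

Lemma le_indic_le1 z y : le_indic z y <= 1.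
Proof. by rewrite /le_indic; case: ifP. Qed.

Lemma measurable_le_indic d (T : measurableType d) (f g : T -> R) :
  measurable_fun [set: T] f -> measurable_fun [set: T] g ->
  measurable_fun [set: T] (fun x => le_indic (f x) (g x)).
Proof.
by move=> mf mg; apply: measurable_fun_if => //; exact: measurable_fun_ler.
Qed.

Let Rintegral_eq0 (f : R -> R) : (forall x, f x = 0) -> \int[mu]_x f x = 0.
Proof.
move=> f0; rewrite (_ : f = cst 0); first by rewrite Rintegral_cst// mul0r.
by apply/funext => x; rewrite f0.
Qed.

(** Fubini's theorem after inserting the cosine representation of the kernel; integrating cos(s z)
    over 0 < z <= y produces sin(s y) / s. *)
Let sign_pos (y : R) : 0 < y ->
  \int[mu]_z (half_kernel z * le_indic z y) =
  \int[mu]_s (\1_`]0, 2] s * (jackson_weight s / s * sin (s * y))).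
Proof.
move=> y0.
pose f (p : measurableTypeR R * measurableTypeR R) : R :=
  \1_`]0, y] (p.1 : R) * (\1_`]0, 2] (p.2 : R) * (jackson_weight p.2 * cos ((p.2 : R) * p.1))).
have mfst : measurable_fun [set: measurableTypeR R * measurableTypeR R] (fun p => p.1 : R).
  exact: measurable_fst.
have msnd : measurable_fun [set: measurableTypeR R * measurableTypeR R] (fun p => p.2 : R).
  exact: measurable_snd.
have mf : measurable_fun [set: measurableTypeR R * measurableTypeR R] f.
  apply: measurable_funM.
    by apply: (measurableT_comp _ mfst); exact: measurable_indic.
  apply: measurable_funM.
    by apply: (measurableT_comp _ msnd); exact: measurable_indic.
  apply: measurable_funM.
    by apply: (measurableT_comp _ msnd); exact: measurable_jackson_weight.
  by apply: (measurableT_comp measurable_cos); exact: measurable_funM.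
have i1 := @integrable_indic_itv R 0 y false false.
have i2 : mu.-integrable [set: R] (EFin \o (fun s => 2 * \1_`]0, 2] s)).
  by have := integrableZl measurableT 2 (@integrable_indic_itv R 0 2 false false); apply: eq_integrable.
have f_le (x s : R) : `|f (x, s)| <= \1_`]0, y] x * (2 * \1_`]0, 2] s).
  rewrite /f/= normrM ger0_norm// ler_wpM2l// normrM ger0_norm// mulrC.
  rewrite indicE mem_setE in_itv/=; have [/jackson_weight_le w2|_] := boolP ((0 < s) && (s <= 2)); last by rewrite !mulr0.
  rewrite !mulr1 normrM -[leRHS]mulr1.
  by apply: ler_pM => //; exact: cos_max.
have F := Rintegral_fubini mf i1 i2 f_le.
transitivity (\int[mu]_x \int[mu]_s f (x, s)).
  apply: eq_Rintegral => x _; rewrite /f/= /half_kernel.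
  rewrite !indicE !mem_setE !in_itv/= andbT.
  have [x0|x0] := ltP 0 x; last first.
    by rewrite !mul0r Rintegral_eq0// => s; rewrite /= mul0r.
  rewrite mul1r/= mulrC /le_indic; case: (x <= y); last first.
    by rewrite mul0r Rintegral_eq0// => s; rewrite /= mul0r.
  rewrite mul1r -Rintegral_jackson_weight_cos ?gt_eqF//.
  by apply: eq_Rintegral => s _; rewrite mul1r.
rewrite [LHS]F; apply: eq_Rintegral => s _; rewrite /f/=.
rewrite [\1_`]0, 2] s]indicE mem_setE in_itv/=; have [s0|s0] := ltP 0 s; last first.
  by rewrite Rintegral_eq0 ?mul0r// => x; rewrite /= mul0r mulr0.
case: (s <= 2) => /=; last first.
  by rewrite Rintegral_eq0 ?mul0r// => x; rewrite /= mul0r mulr0.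
have dF x : is_derive x (1 : R) (fun t => jackson_weight s / s * sin (s * t))
    (1%:R * (jackson_weight s * cos (s * x))).
  have h : is_derive x (1 : R) (fun t => s * t) s.
    by have := is_derive1M (is_derive1_cst s x) (is_derive1_id x); rewrite mulr1 mulr0 addr0.
  have h2 := is_derive1_compose h (is_derive_sin (s * x)).
  have h3 := is_derive1M (is_derive1_cst (jackson_weight s / s) x) h2.
  apply: (is_derive_eq h3); rewrite mulr0 addr0 mul1r; field.
  by rewrite gt_eqF.
have cf : continuous (fun x => 1%:R * (jackson_weight s * cos (s * x))).
  by move=> x; apply: is_derive1_continuous; derive1.
rewrite (Rintegral_indic_oc (ltW y0) cf dF).
by rewrite mulr0 sin0 mulr0 subr0 mul1r.
Qed.

(** The odd primitive of the kernel, a smoothed sign function; by [jackson_signE] it contains only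
    frequencies up to 2. *)
Definition jackson_sign (y : R) : R :=
  \int[mu]_z (half_kernel z * (le_indic z y - le_indic z (- y))).

Lemma jackson_signE y : jackson_sign y =
  \int[mu]_s (\1_`]0, 2] s * (jackson_weight s / s * sin (s * y))).
Proof.
have neg (r : R) z : r <= 0 -> half_kernel z * le_indic z r = 0.
  move=> r0; rewrite /half_kernel indicE mem_setE in_itv/= andbT.
  have [z0|z0] := ltP 0 z; last by rewrite !mul0r.
  by rewrite /le_indic leNgt (le_lt_trans r0 z0) mulr0.
rewrite /jackson_sign; have [y0|y0|y0] := ltgtP 0 y.
- rewrite -sign_pos//; apply: eq_Rintegral => z _.
  by rewrite mulrBr [X in _ - X]neg ?subr0// oppr_le0 ltW.
- have y0' : 0 < - y by rewrite oppr_gt0.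
  transitivity (- \int[mu]_z (half_kernel z * le_indic z (- y))).
    rewrite -[RHS]mulN1r -RintegralZl//.
      apply: eq_Rintegral => z _.
      by rewrite mulrBr [X in X - _]neg ?(ltW y0)// sub0r mulN1r.
    apply: (le_integrable measurableT _ _ integrable_half_kernel).
      apply/measurable_EFinP; apply: measurable_funM; first exact: measurable_half_kernel.
      exact: measurable_le_indic.
    move=> z _; rewrite /= lee_fin normrM -[leRHS]mulr1 ler_wpM2l//.
    by rewrite ger0_norm ?le_indic_ge0 ?le_indic_le1.
  rewrite sign_pos// -mulN1r -RintegralZl//.
    by apply: eq_Rintegral => s _; rewrite mulrN sinN; ring.
  apply: (@integrable_indic_oc _ _ _ _ (2 * - y)).
    apply: measurable_funM; last by apply: (measurableT_comp measurable_sin); exact: measurable_funM.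
    by apply: measurable_funM; [exact: measurable_jackson_weight|exact: measurable_invr].
  move=> s hs; have /andP[s0 _] := hs.
  have [c cs ->] := sin_mvt (s * - y).
  have -> : jackson_weight s / s * (s * - y * cos c) = jackson_weight s * (- y * cos c).
    by field; rewrite gt_eqF.
  rewrite normrM; apply: ler_pM => //; first exact: jackson_weight_le.
  by rewrite normrM ger0_norm ?(ltW y0')// ler_piMr ?(ltW y0') ?cos_max.
- rewrite -y0 oppr0 !Rintegral_eq0// => z; first by rewrite mulr0 sin0 !mulr0.
  by rewrite subrr mulr0.
Qed.

End jackson_sign.

(** * Smoothed distribution functions in terms of characteristic functions *)

Section smoothed_distribution.
Context d (T : measurableType d) {R : realType} (P : probability T R).
Variable Y : T -> R.
Hypotheses (mY : measurable_fun [set: T] Y)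
  (intY : P.-integrable [set: T] (EFin \o Y)).
Local Notation mu := (@lebesgue_measure R).
Local Notation half_kernel := (@half_kernel R).

Definition real_cdf (x : R) : R := \int[P]_w le_indic (Y w) x.

Hypothesis Y_diffuse : forall x, \int[P]_w le_indic x (Y w) = 1 - real_cdf x.
Hypothesis Y_sin : forall t, \int[P]_w sin (t * Y w) = 0.

Variables (h : R) (x : R).
Hypothesis h0 : 0 < h.

Let y w := (Y w - x) / h.

Let my : measurable_fun [set: T] y.
Proof. by apply: measurable_funM => //; exact: measurable_funB. Qed.

Let inty : P.-integrable [set: T] (EFin \o (fun w => `|y w|)).
Proof.
have i1 : P.-integrable [set: T] (EFin \o y).
  have := integrableZr_real (h^-1) (integrableB_real intY (integrable_cstr P x)).
  by apply: eq_integrable => // w _; rewrite /= mulrC.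
exact: (integrable_norm i1).
Qed.

Let f (p : measurableTypeR R * T) : R :=
  half_kernel p.1 * (le_indic p.1 (y p.2) - le_indic p.1 (- y p.2)).

Let mf : measurable_fun [set: measurableTypeR R * T] f.
Proof.
have mfst : measurable_fun [set: measurableTypeR R * T] (fun p => p.1 : R).
  exact: measurable_fst.
have msnd : measurable_fun [set: measurableTypeR R * T] (fun p => y p.2).
  exact: (measurableT_comp my measurable_snd).
apply: measurable_funM.
  exact: (measurableT_comp (@measurable_half_kernel R) mfst).
apply: measurable_funB; apply: measurable_le_indic => //.
exact: measurable_funN.
Qed.

Let f_le z w : `|f (z, w)| <= half_kernel z * cst 1 w.
Proof.
rewrite /f /= normrM ger0_norm ?half_kernel_ge0// ler_wpM2l ?half_kernel_ge0//.
have := le_indic_ge0 z (y w); have := le_indic_le1 z (y w).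
have := le_indic_ge0 z (- y w); have := le_indic_le1 z (- y w).
by move=> *; rewrite ler_norml; apply/andP; split; lra.
Qed.

Let f_section z :
  \int[P]_w f (z, w) = half_kernel z * (1 - real_cdf (x + h * z) - real_cdf (x - h * z)).
Proof.
have intl (g1 g2 : T -> R) : measurable_fun [set: T] g1 -> measurable_fun [set: T] g2 ->
    P.-integrable [set: T] (EFin \o (fun w => le_indic (g1 w) (g2 w))).
  move=> m1 m2; apply: (@bounded_integrable _ _ _ _ _ 1).
    exact: measurable_le_indic.
  by move=> w; rewrite ger0_norm ?le_indic_ge0 ?le_indic_le1.
have i1 : P.-integrable [set: T] (EFin \o (fun w => le_indic z (y w))) by exact: intl.
have i2 : P.-integrable [set: T] (EFin \o (fun w => le_indic z (- y w))).
  by apply: intl => //; exact: measurable_funN.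
rewrite /f/= RintegralZl//; last exact: integrableB_real.
congr (_ * _); rewrite RintegralB//; congr (_ - _).
  rewrite -Y_diffuse; apply: eq_Rintegral => w _; rewrite /le_indic /y.
  by rewrite ler_pdivlMr// lerBrDl mulrC.
apply: eq_Rintegral => w _; rewrite /le_indic /y -mulNr ler_pdivlMr//.
by rewrite opprB lerBrDr -lerBrDl mulrC.
Qed.

Lemma integrable_smoothed_cdf : mu.-integrable [set: R] (EFin \o
  (fun z => half_kernel z * (1 - real_cdf (x + h * z) - real_cdf (x - h * z)))).
Proof.
have := integrable_Rintegral_section mf (@integrable_half_kernel R) (integrable_cstr P 1) f_le.
by apply: eq_integrable => // z _; rewrite /= f_section.
Qed.

(** Both sides are the expectation of [jackson_sign] at (Y - x) / h: Fubini's theorem over z gives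
    the left one, the sine representation gives the right one, where [Y_sin] cancels the sine
    transform of Y. *)
Lemma smoothed_cdfE :
  \int[mu]_z (half_kernel z * (1 - real_cdf (x + h * z) - real_cdf (x - h * z))) =
  \int[mu]_s (\1_`]0, 2] s * (- (jackson_weight s / s) * sin (s * x / h) *
    \int[P]_w cos (s / h * Y w))).
Proof.
transitivity (\int[mu]_z \int[P]_w f (z, w)).
  by apply: eq_Rintegral => z _; rewrite f_section.
rewrite (Rintegral_fubini mf (@integrable_half_kernel R) (integrable_cstr P 1) f_le).
transitivity (\int[P]_w \int[mu]_s
    (\1_`]0, 2] s * (jackson_weight s / s * sin (s * y w)))).
  by apply: eq_Rintegral => w _; rewrite -jackson_signE.
pose g (p : T * measurableTypeR R) : R :=
  \1_`]0, 2] (p.2 : R) * (jackson_weight p.2 / (p.2 : R) * sin ((p.2 : R) * y p.1)).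
have mg : measurable_fun [set: T * measurableTypeR R] g.
  have mfst : measurable_fun [set: T * measurableTypeR R] (fun p => y p.1).
    exact: (measurableT_comp my measurable_fst).
  have msnd : measurable_fun [set: T * measurableTypeR R] (fun p => p.2 : R).
    exact: measurable_snd.
  apply: measurable_funM.
    by apply: (measurableT_comp _ msnd); exact: measurable_indic.
  apply: measurable_funM.
    apply: measurable_funM.
      by apply: (measurableT_comp _ msnd); exact: measurable_jackson_weight.
    by apply: (measurableT_comp _ msnd); exact: measurable_invr.
  by apply: (measurableT_comp measurable_sin); exact: measurable_funM.
have i2 : mu.-integrable [set: R] (EFin \o (fun s => 2 * \1_`]0, 2] s)).
  by have := integrableZl measurableT 2 (@integrable_indic_itv R 0 2 false false); apply: eq_integrable.
have g_le w (s : R) : `|g (w, s)| <= `|y w| * (2 * \1_`]0, 2] s).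
  rewrite /g/= normrM ger0_norm// indicE mem_setE in_itv/=.
  have [hs|_] := boolP ((0 < s) && (s <= 2)); last by rewrite mul0r !mulr0.
  have /andP[s0 _] := hs; have w2 := jackson_weight_le hs.
  rewrite mul1r mulr1; have [c _ ->] := sin_mvt (s * y w).
  have -> : jackson_weight s / s * (s * y w * cos c) = jackson_weight s * (y w * cos c).
    by field; rewrite gt_eqF.
  rewrite normrM mulrC; apply: ler_pM => //.
  by rewrite normrM ler_piMr ?cos_max.
rewrite [LHS](Rintegral_fubini mg inty i2 g_le).
apply: eq_Rintegral => s _; rewrite /g/=.
have ic : P.-integrable [set: T] (EFin \o (fun w => cos (s / h * Y w))).
  apply: (@bounded_integrable _ _ _ _ _ 1) => [|w]; last exact: cos_max.
  by apply: (measurableT_comp measurable_cos); exact: measurable_funM.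
have is' : P.-integrable [set: T] (EFin \o (fun w => sin (s / h * Y w))).
  apply: (@bounded_integrable _ _ _ _ _ 1) => [|w]; last exact: sin_max.
  by apply: (measurableT_comp measurable_sin); exact: measurable_funM.
have E w : \1_`]0, 2] s * (jackson_weight s / s * sin (s * y w)) =
    (\1_`]0, 2] s * (jackson_weight s / s) * cos (s * x / h)) * sin (s / h * Y w) -
    (\1_`]0, 2] s * (jackson_weight s / s) * sin (s * x / h)) * cos (s / h * Y w).
  have -> : s * y w = s / h * Y w - s * x / h by rewrite /y; field; rewrite gt_eqF.
  by rewrite sinB; ring.
under eq_Rintegral do rewrite E.
rewrite RintegralB//; [|exact: integrableZr_real..].
by rewrite !RintegralZl// Y_sin; ring.
Qed.

Lemma integrable_smoothed_cdf_fourier : mu.-integrable [set: R] (EFin \o (fun s =>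
  \1_`]0, 2] s * (- (jackson_weight s / s) * sin (s * x / h) *
    \int[P]_w cos (s / h * Y w)))).
Proof.
pose g (p : measurableTypeR R * T) : R :=
  \1_`]0, 2] (p.1 : R) * cos ((p.1 : R) / h * Y p.2).
have mg : measurable_fun [set: measurableTypeR R * T] g.
  have mfst : measurable_fun [set: measurableTypeR R * T] (fun p => p.1 : R).
    exact: measurable_fst.
  have msnd : measurable_fun [set: measurableTypeR R * T] (fun p => Y p.2).
    exact: (measurableT_comp mY measurable_snd).
  apply: measurable_funM.
    by apply: (measurableT_comp _ mfst); exact: measurable_indic.
  apply: (measurableT_comp measurable_cos); apply: measurable_funM => //.
  exact: measurable_funM.
have g_le (s : R) w : `|g (s, w)| <= \1_`]0, 2] s * cst 1 w.
  by rewrite /g/= normrM ger0_norm// ler_wpM2l// cos_max.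
have i1 := @integrable_indic_itv R 0 2 false false.
have gE s : \int[P]_w g (s, w) = \1_`]0, 2] s * \int[P]_w cos (s / h * Y w).
  rewrite /g/= RintegralZl//.
  apply: (@bounded_integrable _ _ _ _ _ 1) => [|w]; last exact: cos_max.
  by apply: (measurableT_comp measurable_cos); exact: measurable_funM.
have := integrable_Rintegral_section mg i1 (integrable_cstr P 1) g_le.
move=> ig.
have {}ig : mu.-integrable [set: R] (EFin \o (fun s => \1_`]0, 2] s * \int[P]_w cos (s / h * Y w))).
  by apply: eq_integrable ig => // s _; rewrite /= gE.
apply: (le_integrable measurableT _ _ (integrableZl measurableT (2 * `|x / h|) ig)).
  have := measurable_int _ ig => /measurable_EFinP mgg.
  apply/measurable_EFinP.
  rewrite (_ : (fun s => _) = (fun s => (- (jackson_weight s / s) * sin (s * x / h)) *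
    (\1_`]0, 2] s * \int[P]_w cos (s / h * Y w)))); last first.
    by apply/funext => s; ring.
  apply: measurable_funM => //; apply: measurable_funM.
    apply: measurable_funN; apply: measurable_funM; first exact: measurable_jackson_weight.
    exact: measurable_invr.
  by apply: (measurableT_comp measurable_sin); apply: measurable_funM => //; exact: measurable_funM.
move=> s _; rewrite /= lee_fin indicE mem_setE in_itv/=.
have [hs|_] := boolP ((0 < s) && (s <= 2)); last by rewrite !mul0r mulr0 !normr0.
have /andP[s0 _] := hs; have w2 := jackson_weight_le hs.
rewrite !mul1r normrM [leRHS]normrM ler_wpM2r// [leRHS]ger0_norm ?mulr_ge0//.
have [c _ e] := sin_mvt (s * x / h); rewrite e.
have -> : - (jackson_weight s / s) * (s * x / h * cos c) =
    - (jackson_weight s * (x / h * cos c)).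
  by field; rewrite !gt_eqF.
rewrite normrN normrM; apply: ler_pM => //.
by rewrite normrM ler_piMr ?cos_max.
Qed.

End smoothed_distribution.

(** Only frequencies t = s/h <= 2/h enter. Since the weight is at most 2 and the sine at most 1, the
    difference is at most the integral of 2 D t^3 exp(-t^2/4) over t > 0, which equals 16 D. *)
Lemma smoothed_cdf_diff d1 (T1 : measurableType d1) d2 (T2 : measurableType d2)
    (R : realType) (P1 : probability T1 R) (P2 : probability T2 R)
    (Y1 : T1 -> R) (Y2 : T2 -> R) (h x D : R) :
  measurable_fun [set: T1] Y1 -> P1.-integrable [set: T1] (EFin \o Y1) ->
  (forall x, \int[P1]_w le_indic x (Y1 w) = 1 - real_cdf P1 Y1 x) ->
  (forall t, \int[P1]_w sin (t * Y1 w) = 0) ->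
  measurable_fun [set: T2] Y2 -> P2.-integrable [set: T2] (EFin \o Y2) ->
  (forall x, \int[P2]_w le_indic x (Y2 w) = 1 - real_cdf P2 Y2 x) ->
  (forall t, \int[P2]_w sin (t * Y2 w) = 0) ->
  0 < h -> 0 <= D ->
  (forall t, 0 < t -> t <= 2 / h ->
    `|\int[P1]_w cos (t * Y1 w) - \int[P2]_w cos (t * Y2 w)| <=
    D * t ^+ 4 * expR (- t ^+ 2 / 4)) ->
  `|\int[lebesgue_measure]_z (half_kernel z *
      (1 - real_cdf P1 Y1 (x + h * z) - real_cdf P1 Y1 (x - h * z))) -
    \int[lebesgue_measure]_z (half_kernel z *
      (1 - real_cdf P2 Y2 (x + h * z) - real_cdf P2 Y2 (x - h * z)))| <= 16 * D.
Proof.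
move=> mY1 iY1 Y1d Y1s mY2 iY2 Y2d Y2s h0 D0 cfD.
rewrite (smoothed_cdfE mY1 iY1 Y1d Y1s x h0) (smoothed_cdfE mY2 iY2 Y2d Y2s x h0).
have i1 := integrable_smoothed_cdf_fourier P1 mY1 x h0.
have i2 := integrable_smoothed_cdf_fourier P2 mY2 x h0.
rewrite -RintegralB//.
apply: le_trans (le_normr_Rintegral _ _) _ => //.
  by have := integrableB measurableT i1 i2; apply: eq_integrable.
(* A primitive of the majorant [g], nonpositive, with value -16 D at 0. *)
pose G s := - (4 * D) * (((s / h) ^+ 2 + 4) * expR (- (s / h) ^+ 2 / 4)).
pose g s := 2 * D * (s ^+ 3 / h ^+ 4) * expR (- (s / h) ^+ 2 / 4).
have dG s : is_derive s (1 : R) G (g s).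
  rewrite /G; apply: is_derive_eq; rewrite /GRing.scale/=.
  rewrite /g; set e := expR _.
  field; rewrite gt_eqF//.
have cg : continuous g.
  move=> s; apply: is_derive1_continuous; rewrite /g; derive1.
have := Rintegral_indic_oc (ler0n R 2) cg dG => E.
apply: (@le_trans _ _ (G 2 - G 0)); last first.
  have : 0 <= 4 * D * (((2 / h) ^+ 2 + 4) * expR (- (2 / h) ^+ 2 / 4)).
    by rewrite !mulr_ge0 ?expR_ge0// addr_ge0// sqr_ge0.
  have -> : G 0 = - (16 * D).
    rewrite /G mul0r expr0n/= (_ : - 0 / 4 = 0 :> R) ?expR0; last by lra.
    by lra.
  by rewrite /G mulNr; lra.
rewrite -E; apply: le_Rintegral => //.
- exact: integrable_norm (integrableB measurableT i1 i2).
- apply: (@integrable_indic_oc _ g 0 2 (2 * D * (8 / h ^+ 4))).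
    exact: continuous_measurable_fun.
  move=> s /andP[s0 s2]; rewrite /g normrM -[leRHS]mulr1; apply: ler_pM => //.
    have h4 : 0 < h ^+ 4 by rewrite exprn_gt0.
    rewrite ger0_norm; last first.
      by rewrite mulr_ge0 ?mulr_ge0// ?invr_ge0 ?exprn_ge0 ?(ltW s0) ?(ltW h4)// ltW.
    rewrite ler_wpM2l ?mulr_ge0// ler_wpM2r ?invr_ge0 ?(ltW h4)//.
    rewrite (_ : 8 = 2 ^+ 3 :> R); last by ring.
    by rewrite lerXn2r ?nnegrE// ltW.
  rewrite ger0_norm ?expR_ge0// -expR0 ler_expR.
  by rewrite mulNr oppr_le0 mulr_ge0// sqr_ge0.
move=> s _; rewrite -mulrBr normrM ger0_norm// indicE mem_setE in_itv/=.
have [hs|_] := boolP ((0 < s) && (s <= 2)); last by rewrite !mul0r.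
have /andP[s0 s2] := hs; have w2 := jackson_weight_le hs.
rewrite !mul1r -mulrBr normrM.
have t0 : 0 < s / h by rewrite divr_gt0.
have th : s / h <= 2 / h by rewrite ler_pM2r ?invr_gt0.
have := cfD _ t0 th.
set c := `|_ - _| => hc.
have hb : `|- (jackson_weight s / s) * sin (s * x / h)| <= 2 / s.
  rewrite normrM normrN -[leRHS]mulr1; apply: ler_pM => //; last exact: sin_max.
  by rewrite normrM (gtr0_norm (_ : 0 < s^-1)) ?invr_gt0// ler_pM2r ?invr_gt0.
apply: le_trans (ler_pM (normr_ge0 _) (normr_ge0 _) hb hc) _.
rewrite /g le_eqVlt; apply/orP; left; apply/eqP; field.
by rewrite !gt_eqF.
Qed.

(** * Distribution functions of real random variables *)

Section cumulative_distribution.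
Context d (T : measurableType d) {R : realType} (P : probability T R).
Variable Y : T -> R.
Hypothesis mY : measurable_fun [set: T] Y.

Let measurable_itv (i : interval R) : measurable (Y @^-1` [set` i]).
Proof. by rewrite -[X in measurable X]setTI; exact: mY. Qed.

Let le_indicE1 x w : le_indic (Y w) x = \1_(Y @^-1` `]-oo, x]) w.
Proof.
rewrite /le_indic indicE; case: ifPn => h.
  by rewrite mem_set//= in_itv.
by rewrite memNset//= in_itv/=; exact/negP.
Qed.

Let le_indicE2 x w : le_indic x (Y w) = \1_(Y @^-1` `[x, +oo[) w.
Proof.
rewrite /le_indic indicE; case: ifPn => h.
  by rewrite mem_set//= in_itv/= andbT.
by rewrite memNset//= in_itv/= andbT; exact/negP.
Qed.

Let PU A B : measurable A -> measurable B -> A `&` B = set0 ->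
  P (A `|` B) = (P A + P B)%E.
Proof. exact: measureU. Qed.

Lemma real_cdfE x : (real_cdf P Y x)%:E = P (Y @^-1` `]-oo, x]).
Proof.
rewrite /real_cdf; under eq_Rintegral do rewrite le_indicE1.
by rewrite /Rintegral integral_indic// setIT fineK// fin_num_measure.
Qed.

Lemma real_cdf_ge0 x : 0 <= real_cdf P Y x.
Proof. by rewrite -lee_fin real_cdfE. Qed.

Lemma real_cdf_le1 x : real_cdf P Y x <= 1.
Proof. by rewrite -lee_fin real_cdfE probability_le1. Qed.

Lemma le_real_cdf x1 x2 : x1 <= x2 -> real_cdf P Y x1 <= real_cdf P Y x2.
Proof.
move=> x12; rewrite -lee_fin !real_cdfE le_measure ?inE// => w /=.
by rewrite !in_itv/= => /le_trans; exact.
Qed.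

Lemma Rintegral_le_indicr x : P (Y @^-1` [set x]) = 0%E ->
  \int[P]_w le_indic x (Y w) = 1 - real_cdf P Y x.
Proof.
move=> Px; under eq_Rintegral do rewrite le_indicE2.
rewrite /Rintegral integral_indic// setIT.
rewrite -[LHS]/(fine (P (Y @^-1` `[x, +oo[))).
apply: EFin_inj; rewrite EFinB real_cdfE fineK ?fin_num_measure//.
have m1 : measurable (Y @^-1` [set x]).
  by rewrite -[X in measurable X]setTI; exact: mY.
have <- : P [set: T] = 1%E by exact: probability_setT.
have -> : [set: T] = Y @^-1` `]-oo, x] `|` Y @^-1` `]x, +oo[.
  apply/seteqP; split => // w _; rewrite /= !in_itv/= andbT.
  by have [|] := leP (Y w) x; [left|right].
have -> : Y @^-1` `[x, +oo[ = Y @^-1` [set x] `|` Y @^-1` `]x, +oo[.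
  apply/seteqP; split => w; rewrite /= !in_itv/= !andbT.
    by rewrite le_eqVlt => /predU1P[->|]; [left|right].
  by case=> [->//|/ltW].
rewrite !PU//.
- by rewrite Px add0e addeAC subee ?add0e// fin_num_measure.
- by apply/seteqP; split => // w [] /=; rewrite !in_itv/= andbT => h1 h2; have := le_lt_trans h1 h2; rewrite ltxx.
- by apply/seteqP; split => // w [] /=; rewrite !in_itv/= andbT => ->; rewrite ltxx.
Qed.

Lemma probability_itv_cdf a b : a <= b -> P (Y @^-1` [set a]) = 0%E ->
  P [set w | a <= Y w <= b] = (real_cdf P Y b - real_cdf P Y a)%:E.
Proof.
move=> ab Pa.
have m1 : measurable (Y @^-1` [set a]).
  by rewrite -[X in measurable X]setTI; exact: mY.
have -> : [set w | a <= Y w <= b] = Y @^-1` [set a] `|` Y @^-1` `]a, b].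
  apply/seteqP; split => w; rewrite /= !in_itv/=.
    move=> /andP[h1 h2]; have [e|ne] := eqVneq (Y w) a; first by left.
    by right; rewrite lt_neqAle eq_sym ne h1 h2.
  by case=> [->|/andP[/ltW -> ->]//]; rewrite lexx.
rewrite PU//; last first.
  by apply/seteqP; split => // w [] /=; rewrite !in_itv/= => ->; rewrite ltxx.
rewrite Pa add0e EFinB !real_cdfE.
have -> : Y @^-1` `]-oo, b] = Y @^-1` `]-oo, a] `|` Y @^-1` `]a, b].
  apply/seteqP; split => w; rewrite /= !in_itv/=.
    by have [|] := leP (Y w) a => h1 h2; [left|right].
  by case=> [h|/andP[]//]; exact: le_trans ab.
rewrite PU//; last first.
  by apply/seteqP; split => // w [] /=; rewrite !in_itv/= => h1 /andP[h2 _]; have := le_lt_trans h1 h2; rewrite ltxx.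
by rewrite addeAC subee ?add0e// fin_num_measure.
Qed.

End cumulative_distribution.

(** * The standard Gaussian measure *)

Section gaussian.
Context {R : realType}.
Local Notation mu := (@lebesgue_measure R).

Definition gauss_density (x : R) : R :=
  (Num.sqrt (2 * pi))^-1 * expR (- x ^+ 2 / 2).

Lemma normal_pdf01 : normal_pdf 0 1 = gauss_density.
Proof.
apply/funext => x; rewrite normal_pdfE ?oner_neq0// /gauss_density /normal_peak /normal_fun.
by rewrite subr0 !expr1n !mul1r mulr_natl.
Qed.

Definition gauss : probability (measurableTypeR R) R := normal_prob (0 : R) 1.

Lemma gaussE A : gauss A = (\int[mu]_(x in A) (gauss_density x)%:E)%E.
Proof. by rewrite -normal_pdf01. Qed.

Lemma gauss_density_gt0 x : 0 < gauss_density x.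
Proof. by rewrite mulr_gt0 ?expR_gt0// invr_gt0 sqrtr_gt0 mulr_gt0// pi_gt0. Qed.

Lemma gauss_densityN x : gauss_density (- x) = gauss_density x.
Proof. by rewrite /gauss_density sqrrN. Qed.

Lemma is_derive_gauss_density x :
  is_derive x (1 : R) gauss_density (- x * gauss_density x).
Proof.
apply: is_derive_eq; rewrite /GRing.scale/= /gauss_density; set e := expR _.
set c := _^-1; have : True by []; move=> _.
by field.
Qed.

Lemma continuous_gauss_density : continuous gauss_density.
Proof. by move=> x; exact: is_derive1_continuous (is_derive_gauss_density x). Qed.

Lemma measurable_gauss_density : measurable_fun [set: R] gauss_density.
Proof. exact: continuous_measurable_fun continuous_gauss_density. Qed.

Lemma gauss_density_le x : gauss_density x <= 2^-1 * expR (- x ^+ 2 / 2).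
Proof.
rewrite ler_wpM2r ?expR_ge0// lef_pV2 ?posrE ?sqrtr_gt0 ?mulr_gt0 ?pi_gt0//.
rewrite -[leLHS]ger0_norm// -sqrtr_sqr ler_wsqrtr// expr2 ler_wpM2l//.
exact: pi_ge2.
Qed.

Lemma integrable_gauss_density : mu.-integrable [set: R] (EFin \o gauss_density).
Proof.
by have := @integrable_normal_pdf R 0 1; rewrite normal_pdf01.
Qed.

Lemma measurable_gauss_dist (f : R -> R) :
  measurable_fun [set: R] f -> measurable_fun [set: measurableTypeR R] f.
Proof. by []. Qed.

Lemma integral_gauss (f : R -> \bar R) : measurable_fun [set: R] f ->
  (forall x, 0 <= f x)%E ->
  (\int[gauss]_x f x = \int[mu]_x (f x * (gauss_density x)%:E))%E.
Proof.
move=> mf f0; apply: (@ge0_integral_density _ _ _ mu gauss_density _ _ gauss) => //.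
- exact: measurable_gauss_density.
- by move=> x; exact/ltW/gauss_density_gt0.
- by move=> A _; exact: gaussE.
Qed.

Lemma integrable_gaussP (f : R -> R) : measurable_fun [set: R] f ->
  mu.-integrable [set: R] (EFin \o (fun x => f x * gauss_density x)) ->
  gauss.-integrable [set: measurableTypeR R] (EFin \o f).
Proof.
move=> mf /integrableP[_ h]; apply/integrableP; split; first exact/measurable_EFinP.
rewrite integral_gauss//; last by apply/measurable_EFinP; exact: measurableT_comp.
apply: le_lt_trans h; rewrite le_eqVlt; apply/orP; left; apply/eqP.
apply: eq_integral => x _; rewrite /= -EFinM normrM (gtr0_norm (gauss_density_gt0 _))//.
Qed.

Lemma gauss_integrable_density (f : R -> R) : measurable_fun [set: R] f ->
  gauss.-integrable [set: measurableTypeR R] (EFin \o f) ->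
  mu.-integrable [set: R] (EFin \o (fun x => f x * gauss_density x)).
Proof.
move=> mf /integrableP[_]; rewrite integral_gauss//; last first.
  by apply/measurable_EFinP; exact: measurableT_comp.
move=> h; apply/integrableP; split.
  by apply/measurable_EFinP; apply: measurable_funM => //; exact: measurable_gauss_density.
apply: le_lt_trans h; rewrite le_eqVlt; apply/orP; left; apply/eqP.
by apply: eq_integral => x _; rewrite /= normrM (gtr0_norm (gauss_density_gt0 _))// EFinM.
Qed.

Lemma gauss_sym (f : R -> \bar R) : measurable_fun [set: R] f ->
  (\int[gauss]_x f (- (x : R))%R = \int[gauss]_x f x)%E.
Proof.
move=> mf.
have sym (g : R -> \bar R) : measurable_fun [set: R] g -> (forall x, 0 <= g x)%E ->
    (\int[gauss]_x g (- (x : R))%R = \int[gauss]_x g x)%E.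
  move=> mg g0; have mgN : measurable_fun [set: R] (fun x => g (- x)).
    by apply: measurableT_comp => //; exact: measurable_oppr.
  rewrite !integral_gauss//.
  have mgd : measurable_fun [set: R] (fun x => (g x * (gauss_density x)%:E)%E).
    apply: emeasurable_funM => //; apply/measurable_EFinP.
    exact: measurable_gauss_density.
  rewrite -(ge0_integral_lebesgueN mgd); last first.
    by move=> x; rewrite mule_ge0// lee_fin; exact/ltW/gauss_density_gt0.
  by apply: eq_integral => x _; rewrite gauss_densityN.
rewrite integralE [RHS]integralE; congr (_ - _)%E.
  rewrite -(sym _ (measurable_funepos mf) (funepos_ge0 f)).
  by apply: eq_integral => x _; rewrite !funeposE.
rewrite -(sym _ (measurable_funeneg mf) (funeneg_ge0 f)).
by apply: eq_integral => x _; rewrite !funenegE.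
Qed.

Lemma Rintegral_gauss (f : R -> R) : measurable_fun [set: R] f ->
  \int[gauss]_x f x = \int[mu]_x (f x * gauss_density x).
Proof.
move=> mf; have mfE : measurable_fun [set: R] (EFin \o f) by exact/measurable_EFinP.
rewrite /Rintegral; congr fine; rewrite integralE [RHS]integralE.
congr (_ - _)%E; rewrite integral_gauss//.
- by apply: eq_integral => x _; rewrite !funeposE EFinM maxe_pMl ?mul0e//.
- exact: measurable_funepos.
- apply: eq_integral => x _; rewrite !funenegE maxe_pMl ?mul0e//.
    by rewrite -[X in maxe X _]/((- f x * gauss_density x)%:E) mulNr.
  by rewrite lee_fin ltW// gauss_density_gt0.
- exact: measurable_funeneg.
Qed.

Lemma sqr_gauss_density_le x :
  x ^+ 2 * gauss_density x <= 4 * expR (- x ^+ 2 / (2 *+ 2)).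
Proof.
apply: le_trans (ler_wpM2l (sqr_ge0 x) (gauss_density_le x)) _.
have -> : - x ^+ 2 / 2 = - x ^+ 2 / (2 *+ 2) + - x ^+ 2 / (2 *+ 2) by rewrite mulr2n; field.
rewrite expRD; set e := expR _.
have e0 : 0 < e by exact: expR_gt0.
have : x ^+ 2 * e <= 4.
  rewrite -ler_pdivlMr// /e -expRN -mulNr opprK.
  have := @expR_ge1Dx R (x ^+ 2 / (2 *+ 2)); rewrite mulr2n (_ : 2 + 2 = 4); [set E := expR _; lra|lra].
nra.
Qed.

Lemma integrable_gauss_sqr :
  gauss.-integrable [set: measurableTypeR R] (EFin \o (fun x => (x : R) ^+ 2)).
Proof.
apply: integrable_gaussP; first exact: measurable_funX.
have s0 : Num.sqrt 2 != 0 :> R by rewrite gt_eqF// sqrtr_gt0.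
have i1 := @integrable_normal_pdf R 0 (Num.sqrt 2).
rewrite (normal_pdfE _ s0) in i1.
have p0 := normal_peak_gt0 s0.
apply: (le_integrable measurableT _ _ (integrableZl measurableT (4 / normal_peak (Num.sqrt 2)) i1)).
  apply/measurable_EFinP; apply: measurable_funM; first exact: measurable_funX.
  exact: measurable_gauss_density.
move=> x _; rewrite /= lee_fin [X in _ <= `|X|]mulrA divfK ?gt_eqF// /normal_fun subr0 sqr_sqrtr//.
have gd := gauss_density_gt0 x.
rewrite ger0_norm; last by rewrite mulr_ge0 ?sqr_ge0 ?(ltW gd).
rewrite ger0_norm ?mulr_ge0 ?expR_ge0//.
exact: sqr_gauss_density_le.
Qed.

Lemma integrable_gauss_id :
  gauss.-integrable [set: measurableTypeR R] (EFin \o (fun x => x : R)).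
Proof.
apply: (le_integrable measurableT _ _ (integrableD_real (integrable_cstr gauss 1) integrable_gauss_sqr)).
  exact/measurable_EFinP.
move=> x _; rewrite /= lee_fin [leRHS]ger0_norm ?addr_ge0 ?sqr_ge0//.
rewrite ler_norml; have := sqr_ge0 ((x : R) - 1); have := sqr_ge0 ((x : R) + 1).
by rewrite !expr2; nra.
Qed.

End gaussian.

(** * The Gaussian characteristic function *)

Section gaussian_characteristic_function.
Context {R : realType}.
Local Notation mu := (@lebesgue_measure R).

Lemma cvg_gauss_density_nat : gauss_density n%:R @[n --> \oo] --> (0 : R).
Proof.
apply: (squeeze_cvgr (f := fun=> 0) (h := @harmonic R)); [|exact: cvg_cst|exact: cvg_harmonic].
near=> n; rewrite ltW ?gauss_density_gt0//=.
apply: le_trans (gauss_density_le _) _.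
rewrite mulNr expRN -invfM lef_pV2 ?posrE ?mulr_gt0 ?expR_gt0//.
have := @expR_ge1Dx R (n%:R ^+ 2 / 2); set E := expR _ => h.
rewrite -natr1; have := sqr_ge0 (n%:R - 1 : R); rewrite !expr2 in h *; nra.
Unshelve. all: by end_near. Qed.

(** Integration by parts: the difference of the two sides is the integral of the derivative of sin(t
    x) times the density, obtained as a limit over ]-n, n]. *)
Lemma Rintegral_gauss_sin t :
  \int[@gauss R]_x (x * sin (t * x)) = t * \int[@gauss R]_x cos (t * x).
Proof.
have mc : measurable_fun [set: R] (fun x => cos (t * x)).
  by apply: (measurableT_comp measurable_cos); exact: measurable_funM.
have ms : measurable_fun [set: R] (fun x => sin (t * x)).
  by apply: (measurableT_comp measurable_sin); exact: measurable_funM.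
have mxs : measurable_fun [set: R] (fun x => x * sin (t * x)).
  by apply: measurable_funM.
have ic : (@gauss R).-integrable [set: measurableTypeR R] (EFin \o (fun x => cos (t * (x : R)))).
  by apply: (@bounded_integrable _ _ _ _ _ 1) => // x; exact: cos_max.
have ix : (@gauss R).-integrable [set: measurableTypeR R] (EFin \o (fun x => (x : R) * sin (t * x))).
  apply: (le_integrable measurableT _ _ integrable_gauss_id).
    exact/measurable_EFinP.
  by move=> x _; rewrite /= lee_fin normrM ler_piMr// sin_max.
apply/esym/eqP; rewrite -subr_eq0 -RintegralZl// -RintegralB//; last exact: integrableZr_real.
pose k0 (x : R) := t * cos (t * x) - x * sin (t * x).
pose k (x : R) := k0 x * gauss_density x.
have mk0 : measurable_fun [set: R] k0.
  by apply: measurable_funB => //; exact: measurable_funM.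
have ik : mu.-integrable [set: R] (EFin \o k).
  apply: gauss_integrable_density => //.
  by apply: integrableB_real => //; exact: integrableZr_real.
rewrite (Rintegral_gauss mk0) -/k.
pose g (x : R) := sin (t * x) * gauss_density x.
have dg x : is_derive x (1 : R) g (k x).
  have := is_derive_gauss_density x => h.
  apply: is_derive_eq; rewrite /GRing.scale/= /k /k0; by ring.
have ck : continuous k.
  move=> x; apply: continuousM; last exact: continuous_gauss_density.
  by apply: is_derive1_continuous; rewrite /k0; derive1.
pose f_ n (x : R) := \1_`](- n%:R), n%:R] x * k x.
have f_E n : \int[mu]_x f_ n x = g n%:R - g (- n%:R).
  by apply: Rintegral_indic_oc => //; rewrite ge0_cp// ler0n.
have mf_ n : measurable_fun [set: R] (f_ n).
  by apply: measurable_funM; [exact: measurable_indic|exact: continuous_measurable_fun].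
have f_k x : f_ ^~ x @ \oo --> k x.
  apply: (@cvg_near_cst _ _ _ _ _ _); near=> n; rewrite /f_ indicE mem_setE in_itv/=.
  have hn : `|x| < n%:R by near: n; exact: nbhs_infty_gtr.
  move: hn; rewrite ltr_norml => /andP[-> /ltW ->].
  by rewrite mul1r.
have [_ _] : [/\ mu.-integrable [set: R] (EFin \o k),
    [sequence \int[mu]_x `|(f_ n x)%:E - (k x)%:E|]_n @ \oo --> 0 &
    [sequence \int[mu]_x (f_ n x)%:E]_n @ \oo --> \int[mu]_x (k x)%:E]%E.
  apply: (@dominated_convergence _ _ _ mu [set: R] measurableT
      (fun n => EFin \o f_ n) (EFin \o k) (fun x => `|k x|%:E)).
  - by move=> n; apply/measurable_EFinP; exact: mf_.
  - exact: measurable_int ik.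
  - by apply: aeW => x _; apply: cvg_EFin; [exact: nearW|exact: f_k].
  - exact: integrable_norm ik.
  - apply: aeW => x n _; rewrite /= lee_fin /f_ normrM ler_piMl// ger0_norm//.
rewrite -(fineK (integrable_fin_num measurableT ik)).
move=> /fine_cvgP[_]; rewrite /= -/(Rintegral _ _ _).
have -> : fine \o [sequence (\int[mu]_x (f_ n x)%:E)%E]_n = (fun n => g n%:R - g (- n%:R)).
  by apply/funext => n; rewrite -f_E.
move=> lim1.
have lim0 : g n%:R - g (- n%:R) @[n --> \oo] --> (0 : R).
  have g_le x : `|g x| <= `|gauss_density x| by rewrite /g normrM ler_piMl// sin_max.
  rewrite -[0]subr0; apply: cvgB; apply/cvgr0Pnorm_le => e e0.
    have /cvgr0_norm_le /(_ e e0) := cvg_gauss_density_nat.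
    by apply: filterS => n; exact: le_trans.
  have /cvgr0_norm_le /(_ e e0) := cvg_gauss_density_nat.
  by apply: filterS => n; rewrite -gauss_densityN; exact: le_trans.
by apply/eqP; exact: cvg_unique lim1 lim0.
Unshelve. all: by end_near. Qed.

Lemma is_derive_gauss_cos t :
  is_derive t (1 : R) (fun t => \int[@gauss R]_x cos (t * x))
    (- (t * \int[@gauss R]_x cos (t * x))).
Proof.
pose f (s : R) (x : measurableTypeR R) := cos (s * (x : R)).
have df s x : is_derive s (1 : R) (f ^~ x) (- sin (s * x) * x).
  by apply: is_derive_eq; rewrite /GRing.scale/=; ring.
have dfE s x : (partial1of2 f) s x = - sin (s * x) * x by rewrite /partial1of2 derive1E; exact: derive_val.
have mf s : measurable_fun [set: R] (f s).
  by apply: (measurableT_comp measurable_cos); exact: measurable_funM.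
have intf s : `]t - 1, t + 1[%classic s -> (@gauss R).-integrable [set: measurableTypeR R] (EFin \o f s).
  by move=> _; apply: (@bounded_integrable _ _ _ _ _ 1) => [|x]; [exact: mf|exact: cos_max].
have It : `]t - 1, t + 1[%classic t by rewrite /= in_itv/=; apply/andP; split; lra.
have derf s y : `]t - 1, t + 1[%classic s -> [set: measurableTypeR R] y -> derivable (f ^~ y) s 1.
  by move=> _ _; exact: (@ex_derive _ _ _ _ _ _ _ (df s y)).
have G_ub s y : `]t - 1, t + 1[%classic s -> [set: measurableTypeR R] y -> `|(partial1of2 f) s y| <= `|y : R|.
  by move=> _ _; rewrite dfE normrM normrN ler_piMl// sin_max.
have iG : (@gauss R).-integrable [set: measurableTypeR R] (EFin \o (fun y => `|y : R|)).
  exact: (integrable_norm integrable_gauss_id).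
have h1 := @derivable_under_integral _ _ _ _ f _ measurableT t _ _ It intf derf _ (fun=> normr_ge0 _) iG G_ub.
have h2 := @differentiation_under_integral _ _ _ _ f _ measurableT t _ _ It intf derf _ (fun=> normr_ge0 _) iG G_ub.
apply: (@DeriveDef _ _ _ _ _ _ _ h1); rewrite -derive1E h2 -Rintegral_gauss_sin.
under eq_Rintegral do rewrite dfE.
transitivity (\int[@gauss R]_x (- 1 * ((x : R) * sin (t * (x : R))))).
  by apply: eq_Rintegral => x _; ring.
rewrite RintegralZl ?mulN1r//.
apply: (le_integrable measurableT _ _ integrable_gauss_id).
  by apply/measurable_EFinP; apply: measurable_funM => //; apply: (measurableT_comp measurable_sin); exact: measurable_funM.
by move=> x _; rewrite /= lee_fin normrM ler_piMr// sin_max.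
Qed.

(** The left side c solves c' = -t c with c(0) = 1, so c(t) exp(t^2/2) has zero derivative. *)
Lemma Rintegral_gauss_cos t : \int[@gauss R]_x cos (t * x) = expR (- t ^+ 2 / 2).
Proof.
pose c t := \int[@gauss R]_x cos (t * x).
have dc t' : is_derive t' (1 : R) (fun t => c t * expR (t ^+ 2 / 2)) 0.
  have := is_derive_gauss_cos t'; rewrite -/(c t') => h.
  apply: is_derive_eq; rewrite /GRing.scale/=; by field.
have := is_derive_0_is_cst t 0 dc => /=.
rewrite expr0n/= mul0r expR0 mulr1 {2}/c.
under eq_Rintegral do rewrite mul0r cos0.
rewrite Rintegral_cst1 mulNr expRN => e.
by rewrite -[LHS](mulfK (lt0r_neq0 (expR_gt0 (t ^+ 2 / 2)))) -/(c t) e mul1r.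
Qed.

End gaussian_characteristic_function.

(** * Regularity and tails of the Gaussian distribution function *)

Section gaussian_distribution.
Context {R : realType}.
Local Notation mu := (@lebesgue_measure R).

Definition gauss_id (x : measurableTypeR R) : R := x.

Lemma measurable_gauss_id : measurable_fun [set: measurableTypeR R] gauss_id.
Proof. exact: measurable_id. Qed.

Definition gauss_cdf : R -> R := real_cdf (@gauss R) gauss_id.

Lemma gauss_set1 x : @gauss R (gauss_id @^-1` [set x]) = 0%E.
Proof. by rewrite gaussE integral_set1. Qed.

Lemma gauss_diffuse x : \int[@gauss R]_w le_indic x (gauss_id w) = 1 - gauss_cdf x.
Proof. exact: (Rintegral_le_indicr measurable_gauss_id (gauss_set1 x)). Qed.

Lemma gauss_sin t : \int[@gauss R]_w sin (t * gauss_id w) = 0.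
Proof.
have ms s : measurable_fun [set: R] (fun x => sin (s * x)).
  by apply: (measurableT_comp measurable_sin); exact: measurable_funM.
have is_ s : (@gauss R).-integrable [set: measurableTypeR R] (EFin \o (fun x => sin (s * (x : R)))).
  by apply: (@bounded_integrable _ _ _ _ _ 1) => [|x]; [exact: ms|exact: sin_max].
have : \int[@gauss R]_w sin (t * gauss_id w) = - \int[@gauss R]_w sin (t * gauss_id w).
  rewrite {1}/Rintegral -(gauss_sym (f := fun x => (sin (t * x))%:E)); last first.
    exact/measurable_EFinP.
  rewrite -[LHS]/(\int[@gauss R]_x sin (t * - (x : R))).
  transitivity (\int[@gauss R]_x (- 1 * sin (t * (x : R)))).
    by apply: eq_Rintegral => x _; rewrite mulrN sinN mulN1r.
  by rewrite RintegralZl ?mulN1r//; exact: is_.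
lra.
Qed.

Lemma gauss_cdfN x : gauss_cdf (- x) = 1 - gauss_cdf x.
Proof.
rewrite -gauss_diffuse /gauss_cdf /real_cdf.
rewrite {1}/Rintegral -(gauss_sym (f := fun y => (le_indic y (- x))%:E)); last first.
  apply/measurable_EFinP; apply: measurable_le_indic => //.
by congr fine; apply: eq_integral => y _; rewrite /le_indic lerN2.
Qed.

Lemma gauss_cdf_ge0 x : 0 <= gauss_cdf x.
Proof. exact: (real_cdf_ge0 _ measurable_gauss_id). Qed.

Lemma le_gauss_cdf x y : x <= y -> gauss_cdf x <= gauss_cdf y.
Proof. exact: (le_real_cdf _ measurable_gauss_id). Qed.

Lemma gauss_massE (a b : R) : a <= b -> gauss_mass a b = (gauss_cdf b - gauss_cdf a)%:E.
Proof.
move=> ab; rewrite -(probability_itv_cdf measurable_gauss_id ab (gauss_set1 a)) gaussE.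
have -> : [set w | a <= gauss_id w <= b] = `[a, b]%classic.
  by apply/seteqP; split => x; rewrite /= in_itv.
rewrite /gauss_mass -ge0_integralZl//.
- apply/measurable_EFinP; apply: measurable_funTS; apply: measurableT_comp => //.
  by apply: measurable_funM => //; apply: measurable_funN; exact: measurable_funX.
Qed.

Lemma is_derive_gauss_cdf x : is_derive x (1 : R) gauss_cdf (gauss_density x).
Proof.
have ig u : mu.-integrable `]-oo, u] (EFin \o gauss_density).
  exact: integrableS (@integrable_gauss_density R).
have [d1 d2] := @continuous_FTC1 R gauss_density -oo%O x (x + 1)
   (ltac:(by rewrite ltrDl)) (ig _) (ltNyr _) (@continuous_gauss_density R x).
have E : gauss_cdf = (fun y => \int[mu]_(t in `]-oo, y]) gauss_density t).
  apply/funext => y; apply: EFin_inj; rewrite (real_cdfE _ measurable_gauss_id) gaussE.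
  by rewrite /Rintegral fineK//; exact: integrable_fin_num.
by rewrite E -d2 derive1E; exact: DeriveDef.
Qed.

Lemma derive_mvt (f df : R -> R) (a b : R) : a <= b ->
  (forall x, is_derive x (1 : R) f (df x)) ->
  exists c, [/\ a <= c, c <= b & f b - f a = df c * (b - a)].
Proof.
move=> ab dff.
have [|c] := @MVT_segment _ f df a b ab (fun x _ => dff x).
  by apply: continuous_subspaceT => x; exact: is_derive1_continuous (dff x).
by rewrite in_itv/= => /andP[? ?] ?; exists c.
Qed.

Lemma gauss_density_le2V x : gauss_density x <= 2^-1 :> R.
Proof.
apply: le_trans (gauss_density_le x) _; rewrite ler_piMr// -expR0 ler_expR.
by rewrite mulNr oppr_le0 divr_ge0// sqr_ge0.
Qed.

(** Up to the factor [gauss_mills], an upper bound for the ratio of the density to the distribution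
    function, which grows linearly as x tends to -oo. *)
Definition gauss_rho (x : R) : R := 1 + Num.max 0 (- x).

Lemma gauss_rho_ge1 x : 1 <= gauss_rho x.
Proof. by rewrite lerDl le_max lexx. Qed.

Definition gauss_mills : R := expR (3 / 2).

(** On the interval of length v = 1/rho to the left of x the density is at least exp(-3/2) times its
    value at x, because (x - v)^2 <= x^2 + 3. Its integral there bounds the distribution function
    from below. *)
Lemma gauss_density_le_cdf x : x <= 0 ->
  gauss_density x <= gauss_mills * gauss_rho x * gauss_cdf x.
Proof.
move=> x0; have r1 := gauss_rho_ge1 x.
have rE : gauss_rho x = 1 - x by rewrite /gauss_rho max_r ?oppr_ge0.
have r0 : 0 < gauss_rho x by lra.
pose v := (gauss_rho x)^-1; have v0 : 0 < v by rewrite invr_gt0.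
have vx : v * (1 - x) = 1 by rewrite -rE mulVf// gt_eqF.
have v1 : v <= 1 by rewrite invf_le1.
have [c [c1 c2 e]] := derive_mvt (ltac:(lra) : x - v <= x) is_derive_gauss_cdf.
have hc : gauss_density x <= gauss_mills * gauss_density c.
  rewrite /gauss_density mulrCA ler_wpM2l ?invr_ge0 ?sqrtr_ge0// -expRD ler_expR.
  have : c ^+ 2 <= (x - v) ^+ 2 by rewrite !expr2; nra.
  by rewrite !expr2; nra.
have := gauss_cdf_ge0 (x - v); have g0 := gauss_density_gt0 c.
have m0 : 0 < gauss_mills by exact: expR_gt0.
move=> h; apply: le_trans hc _; rewrite -mulrA ler_wpM2l ?(ltW m0)//.
have : v * gauss_density c <= gauss_cdf x.
  have ev : x - (x - v) = v by ring.
  by rewrite mulrC -[X in _ * X]ev -e; lra.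
move=> h2; have vr : gauss_rho x * v = 1 by rewrite mulfV// gt_eqF.
by rewrite -[leLHS]mul1r -vr -mulrA ler_wpM2l// ltW.
Qed.

Lemma gauss_cdf_left x u : 0 <= u ->
  gauss_cdf x - gauss_cdf (x - u) <= gauss_mills * u * gauss_rho x * gauss_cdf x.
Proof.
move=> u0; have r1 := gauss_rho_ge1 x; have g0 := gauss_cdf_ge0 x.
have m1 : 1 <= gauss_mills by rewrite -expR0 ler_expR; lra.
have [c [c1 c2]] := derive_mvt (ltac:(lra) : x - u <= x) is_derive_gauss_cdf.
move=> ->; have -> : x - (x - u) = u by ring.
have -> : gauss_mills * u * gauss_rho x * gauss_cdf x =
  (gauss_mills * gauss_rho x * gauss_cdf x) * u by ring.
rewrite ler_wpM2r//.
have [x0|x0] := leP x 0.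
  apply: le_trans (gauss_density_le_cdf x0).
  rewrite /gauss_density ler_wpM2l ?invr_ge0 ?sqrtr_ge0// ler_expR.
  have : x ^+ 2 <= c ^+ 2 by rewrite !expr2; nra.
  by lra.
apply: le_trans (gauss_density_le2V c) _.
have : 2^-1 <= gauss_cdf x.
  have : gauss_cdf (- x) <= gauss_cdf x by apply: le_gauss_cdf; lra.
  by rewrite gauss_cdfN; lra.
have : 1 <= gauss_mills * gauss_rho x by rewrite -[1]mulr1 ler_pM.
set a := _ * gauss_rho x; nra.
Qed.

(** Two uses of the mean value theorem, the derivative of the density being at most 1/2 in absolute
    value. *)
Lemma gauss_cdf_second_diff x u : 0 <= u ->
  `|gauss_cdf (x + u) + gauss_cdf (x - u) - 2 * gauss_cdf x| <= u ^+ 2.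
Proof.
move=> u0.
pose D (t : R) := gauss_cdf (x + t) + gauss_cdf (x - t).
have dD t : is_derive t (1 : R) D (gauss_density (x + t) - gauss_density (x - t)).
  have e1 : is_derive t (1 : R) (fun t => x + t) 1.
    by have := is_derive1D (is_derive1_cst x t) (is_derive1_id t); rewrite add0r.
  have e2 : is_derive t (1 : R) (fun t => x - t) (- 1).
    by have := is_derive1B (is_derive1_cst x t) (is_derive1_id t); rewrite sub0r.
  have := is_derive1D (is_derive1_compose e1 (is_derive_gauss_cdf (x + t)))
    (is_derive1_compose e2 (is_derive_gauss_cdf (x - t))).
  by rewrite mulr1 mulrN1.
have [c [c0 cu]] := derive_mvt u0 dD.
rewrite /D addr0 !subr0 => e.
have -> : gauss_cdf (x + u) + gauss_cdf (x - u) - 2 * gauss_cdf x =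
  (gauss_density (x + c) - gauss_density (x - c)) * u by rewrite -e; ring.
have [y [_ _ ->]] := derive_mvt (ltac:(lra) : x - c <= x + c) (@is_derive_gauss_density R).
have hy : `|- y * gauss_density y| <= 2^-1.
  rewrite normrM normrN (gtr0_norm (gauss_density_gt0 y)).
  apply: le_trans (ler_wpM2l (normr_ge0 y) (gauss_density_le y)) _.
  rewrite mulrCA ler_piMr// mulNr expRN ler_pdivrMr ?expR_gt0// mul1r.
  apply: le_trans (expR_ge1Dx _).
  have key (a : R) : a <= 1 + a ^+ 2 / 2 by have := sqr_ge0 (a - 1); rewrite !expr2; nra.
  by rewrite -(real_normK (num_real y)).
have -> : x + c - (x - c) = 2 * c by ring.
rewrite normrM (ger0_norm u0) expr2 ler_wpM2r//.
rewrite normrM (ger0_norm (_ : 0 <= 2 * c)) ?mulr_ge0//.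
have := normr_ge0 (- y * gauss_density y); move: hy; set a := `|_|.
by nra.
Qed.

Definition gauss_tail : R := \int[@gauss R]_y (2 * (1 + (y : R) ^+ 2)).

(** Markov's inequality: for y <= x, rho(x)^2 is at most (1 + |y|)^2 <= 2 (1 + y^2). *)
Lemma gauss_cdf_tail x : gauss_cdf x * gauss_rho x ^+ 2 <= gauss_tail.
Proof.
have i1 := integrable_cstr (@gauss R) 1.
have i2 := integrableZr_real 2 (integrableD_real i1 (@integrable_gauss_sqr R)).
have mi : measurable_fun [set: measurableTypeR R] (fun y => le_indic (gauss_id y) x).
  by apply: measurable_le_indic => //; exact: measurable_gauss_id.
have i3 : (@gauss R).-integrable [set: measurableTypeR R] (EFin \o (fun y => le_indic (gauss_id y) x)).
  apply: (@bounded_integrable _ _ _ _ _ 1) => [//|w].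
  by rewrite ger0_norm ?le_indic_ge0 ?le_indic_le1.
rewrite /gauss_cdf /real_cdf mulrC -RintegralZl//.
apply: le_Rintegral => //; first exact: integrableZr_real.
move=> y _; rewrite /le_indic /gauss_id; case: ifPn => h; last first.
  by rewrite mulr0 mulr_ge0// addr_ge0// sqr_ge0.
rewrite mulr1 /gauss_rho.
have : Num.max 0 (- x) <= `|y : R|.
  by rewrite ge_max normr_ge0 -normrN (le_trans _ (ler_norm _))// lerN2.
have : 0 <= Num.max 0 (- x) by rewrite le_max lexx.
set m := Num.max 0 _ => m0 my.
rewrite -(real_normK (num_real (y : R))) !expr2.
by have := sqr_ge0 (m - 1); rewrite expr2; nra.
Qed.

End gaussian_distribution.

Ltac nneg := repeat first
  [ exact: ler0n | assumption | exact: ltW | exact: ler01 | exact: sqr_ge0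
  | apply: mulr_ge0 | apply: addr_ge0 ].

(** * From smoothed to uniform distance, with a loss of order h^2 *)

Section kolmogorov_distance.
Context {R : realType}.
Variables (F G : R -> R) (I0 I2 h D B1 B2 : R) (rho : R -> R).
Hypotheses (I0_gt0 : 0 < I0) (I2_ge0 : 0 <= I2) (h_gt0 : 0 < h) (D_ge0 : 0 <= D).
Hypotheses (B1_gt0 : 0 < B1) (rho_ge1 : forall x, 1 <= rho x).
Hypotheses (F_ge0 : forall x, 0 <= F x) (G_ge0 : forall x, 0 <= G x).
Hypotheses (FN : forall x, F (- x) = 1 - F x) (GN : forall x, G (- x) = 1 - G x).
Hypotheses (le_F : forall x y, x <= y -> F x <= F y).
Hypotheses (le_G : forall x y, x <= y -> G x <= G y).
Hypothesis F_log_concave : forall x u, F (x + u) * F (x - u) <= F x ^+ 2.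
Hypothesis G_left : forall x u, 0 <= u -> G x - G (x - u) <= B1 * u * rho x * G x.
Hypothesis G_second : forall x u, 0 <= u ->
  `|G (x + u) + G (x - u) - 2 * G x| <= u ^+ 2.
Hypothesis G_tail : forall x, G x * rho x ^+ 2 <= B2.

Let Delta x := F x - G x.

(** What the smoothing estimate provides: a parabola above the symmetric sums of [Delta] around a
    point is averaged against the kernel, of mass [I0] and second moment [I2]. *)
Hypothesis smoothing : forall x a b, 0 <= b ->
  (forall u, 0 < u -> Delta (x + u) + Delta (x - u) <= a + b * u ^+ 2) ->
  - (16 * D) <= a * I0 + b * h ^+ 2 * I2.

Let DeltaN x : Delta (- x) = - Delta x.
Proof. by rewrite /Delta FN GN; ring. Qed.

Let C1 := (8 * B1 ^+ 2 * B2 + 1) * I2.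
(** Covers [large_scale] at K = 24, the larger of the two values 4 and 24 at which it is applied. *)
Let C2 := 64 * 24 * B1 ^+ 2 * B2 * I2.

Let B2_ge0 : 0 <= B2.
Proof. by apply: le_trans (G_tail 0); rewrite mulr_ge0// sqr_ge0. Qed.

Section near_extremum.
Variables (M e x0 : R).
Hypotheses (e0 : 0 < e) (Delta_le : forall x, `|Delta x| <= M).
Hypothesis Delta_x0 : Delta x0 < - (M - e).

Let r := rho x0.
(** The scale on which [G] keeps at least 7/8 of its value to the left of [x0]. *)
Let s := (8 * B1 * r)^-1.

Let r_gt0 : 0 < r. Proof. by apply: lt_le_trans (rho_ge1 x0). Qed.

Let s_gt0 : 0 < s. Proof. by rewrite invr_gt0 !mulr_gt0. Qed.

Let Delta_leM x : Delta x <= M. Proof. exact: le_trans (ler_norm _) _. Qed.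

Let Delta_geM x : - M <= Delta x.
Proof. by have := Delta_le x; rewrite ler_norml => /andP[]. Qed.

Let M_ge0 : 0 <= M. Proof. exact: le_trans (normr_ge0 _) (Delta_le 0). Qed.

Let sV2 : s ^- 2 = 64 * B1 ^+ 2 * r ^+ 2.
Proof. by rewrite /s; field; rewrite !gt_eqF. Qed.

Ltac hyps := have I0p := I0_gt0; have I2p := I2_ge0; have Dp := D_ge0; have ep := e0;
  have rp := r_gt0; have Mp := M_ge0; have sp := s_gt0; have B2p := B2_ge0;
  have Dx : F x0 - G x0 < - (M - e) := Delta_x0.

Let left_small u : 0 <= u -> u <= s -> G x0 - G (x0 - u) <= G x0 / 8.
Proof.
move=> u0 us; apply: le_trans (G_left x0 u0) _.
have : B1 * u * r <= 8^-1.
  have := ler_wpM2l (ltW (mulr_gt0 B1_gt0 r_gt0)) us.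
  have -> : B1 * r * s = 8^-1 by rewrite /s; field; rewrite !gt_eqF.
  by rewrite mulrAC.
have := G_ge0 x0; rewrite -/r; set a := B1 * u * r; nra.
Qed.

(** If h is not small compared with [s], the tail alone suffices: M <= e + G x0, while G x0 <= B2 /
    r^2 is then of order h^2. *)
Let large_scale (K : R) : 0 <= K -> I0 < K * (64 * B1 ^+ 2 * r ^+ 2) * h ^+ 2 * I2 ->
  I0 * M <= I0 * e + 64 * K * B1 ^+ 2 * B2 * I2 * h ^+ 2.
Proof.
hyps; move=> K0 hK.
have Mle : M <= e + G x0.
  by have := F_ge0 x0; lra.
apply: (@le_trans _ _ (I0 * e + I0 * G x0)).
  by rewrite -mulrDr ler_wpM2l// ltW.
rewrite lerD2l; apply: le_trans (ler_wpM2r (G_ge0 x0) (ltW hK)) _.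
have := G_tail x0; rewrite -/r => t.
have k0 : 0 <= 64 * K * B1 ^+ 2 * I2 * h ^+ 2.
  by nneg.
have := ler_wpM2l k0 t; lra.
Qed.

(** Log-concavity bounds the second difference of F by the squared left increment of F divided by F;
    near-minimality of [Delta] bounds that increment by the one of G plus e. So the symmetric sums
    of [Delta] around [x0] stay below -2M + 3e + O(u^2) at scales up to [s]. *)
Let case_large : G x0 / 2 <= F x0 ->
  I0 * M <= 32 * D + 9 * I0 * e + (C1 + C2) * h ^+ 2.
Proof.
hyps; move=> FG.
have C1_0 : 0 <= C1 by rewrite /C1; nneg.
have C2_0 : 0 <= C2 by rewrite /C2; nneg.
have h2 : 0 <= h ^+ 2 := sqr_ge0 h.
have c1h : 0 <= C1 * h ^+ 2 by rewrite mulr_ge0.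
have c2h : 0 <= C2 * h ^+ 2 by rewrite mulr_ge0.
have Ie : 0 < I0 * e by rewrite mulr_gt0.
have [Me|Me] := leP M (9 * e).
  by have := ler_wpM2l (ltW I0_gt0) Me; lra.
have G8 : 8 * e < G x0.
  by have := F_ge0 x0; lra.
have G0 : 0 < G x0 by lra.
have F0 : 0 < F x0 by lra.
pose L := 8 * B1 ^+ 2 * B2 + 1.
have L0 : 0 <= L by nneg.
have small u : 0 < u -> u <= s ->
    Delta (x0 + u) + Delta (x0 - u) <= - 2 * M + 3 * e + L * u ^+ 2.
  move=> u0 us; have l8 := left_small (ltW u0) us.
  have l1 := G_left x0 (ltW u0); rewrite -/r in l1.
  have gu := le_G (ltac:(lra) : x0 - u <= x0).
  pose alpha := G x0 - G (x0 - u).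
  have al0 : 0 <= alpha by rewrite /alpha; lra.
  have al8 : alpha <= G x0 / 8 by [].
  (* [Delta] is at least -M everywhere and below -M + e at x0, so F drops by at most e more than
     G. *)
  have v1 : F x0 - (alpha + e) <= F (x0 - u).
    by have := Delta_geM (x0 - u); rewrite /alpha /Delta; lra.
  have v2 : F (x0 - u) <= F x0 by apply: le_F; lra.
  have v0 : F x0 / 2 <= F (x0 - u) by lra.
  have vp : 0 < F (x0 - u) by lra.
  have lc := F_log_concave x0 u.
  (* From w v <= (F x0)^2 follows (w + v - 2 F x0) v <= (F x0 - v)^2, and v >= F x0 / 2 >= G x0 /
     4. *)
  have step1 : F (x0 + u) + F (x0 - u) - 2 * F x0 <= 4 * (alpha + e) ^+ 2 / G x0.
    set v := F (x0 - u) in v1 v2 v0 vp lc *; set w := F (x0 + u) in lc *.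
    rewrite ler_pdivlMr//.
    have h1 : (w + v - 2 * F x0) * v <= (F x0 - v) ^+ 2.
      by rewrite !expr2 in lc *; nra.
    have h3 : (F x0 - v) ^+ 2 <= (alpha + e) ^+ 2.
      by rewrite ler_sqr ?nnegrE; lra.
    have [neg|pos] := leP (w + v - 2 * F x0) 0.
      by apply: le_trans (_ : 0 <= _); [rewrite mulr_le0_ge0// ltW|rewrite mulr_ge0// sqr_ge0].
    have : (w + v - 2 * F x0) * G x0 <= (w + v - 2 * F x0) * (4 * v).
      by rewrite ler_wpM2l ?(ltW pos)//; lra.
    by lra.
  (* The growth of rho is paid by the tail bound, which makes the coefficient of u^2 independent of
     x0. *)
  have step2 : 4 * (alpha + e) ^+ 2 / G x0 <= 8 * B1 ^+ 2 * B2 * u ^+ 2 + e.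
    rewrite ler_pdivrMr//.
    have a2 : (alpha + e) ^+ 2 <= 2 * alpha ^+ 2 + 2 * e ^+ 2.
      by have := sqr_ge0 (alpha - e); rewrite !expr2; lra.
    have a3 : alpha ^+ 2 <= B1 ^+ 2 * u ^+ 2 * (G x0 * r ^+ 2) * G x0.
      have := ler_pM al0 al0 l1 l1; rewrite -expr2 => /le_trans; apply.
      by rewrite le_eqVlt; apply/orP; left; apply/eqP; ring.
    have a4 : B1 ^+ 2 * u ^+ 2 * (G x0 * r ^+ 2) * G x0 <= B1 ^+ 2 * u ^+ 2 * B2 * G x0.
      rewrite ler_wpM2r ?(ltW G0)// ler_wpM2l ?G_tail//.
      by rewrite mulr_ge0 ?sqr_ge0.
    have a5 : 8 * e ^+ 2 <= e * G x0.
      by rewrite expr2 mulrCA ler_wpM2l// ltW.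
    by lra.
  have := G_second x0 (ltW u0); rewrite ler_norml => /andP[gs _].
  by rewrite /L /Delta; lra.
(* Beyond the scale [s], the trivial bound 2M is below -2M + 4M (u/s)^2. *)
pose b := L + 4 * M * (64 * B1 ^+ 2 * r ^+ 2).
have b0 : 0 <= b by nneg.
have all_u u : 0 < u -> Delta (x0 + u) + Delta (x0 - u) <= - 2 * M + 3 * e + b * u ^+ 2.
  move=> u0; have u2 : 0 <= u ^+ 2 := sqr_ge0 u.
  have w0 : 0 <= 4 * M * (64 * B1 ^+ 2 * r ^+ 2) * u ^+ 2.
    by nneg.
  have Lu : 0 <= L * u ^+ 2 by rewrite mulr_ge0.
  rewrite /b mulrDl; have [us|us] := leP u s; first by have := small u u0 us; lra.
  have w1 : 1 <= 64 * B1 ^+ 2 * r ^+ 2 * u ^+ 2.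
    rewrite -sV2 mulrC ler_pdivlMr ?exprn_gt0// mul1r.
    by rewrite ler_sqr ?nnegrE ltW.
  have := ler_wpM2l (mulr_ge0 (ler0n R 4) M_ge0) w1; rewrite mulr1.
  by have := Delta_leM (x0 + u); have := Delta_leM (x0 - u); lra.
have S := smoothing b0 all_u.
(* For h small relative to [s], the term of [b] containing M costs at most I0 M, half of the gain 2
   I0 M. *)
have [ok|bad] := leP (4 * (64 * B1 ^+ 2 * r ^+ 2) * h ^+ 2 * I2) I0.
  have := ler_wpM2l M_ge0 ok.
  move: S; rewrite /b /C1 -/L => S.
  by move: c1h c2h; rewrite /C1 -/L; lra.
have := large_scale (ler0n R 4) bad.
by move: c1h c2h; rewrite /C2; lra.
Qed.

(** Here F x0 may be too small to divide by, but G x0 <= 2M, so monotonicity of F and the slow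
    decrease of G keep [Delta] below -M/2 on all of [x0 - s, x0]. The smoothing is centred at the
    midpoint of this interval. *)
Let case_small : F x0 < G x0 / 2 ->
  I0 * M <= 32 * D + 9 * I0 * e + (C1 + C2) * h ^+ 2.
Proof.
hyps; move=> FG.
have C1_0 : 0 <= C1 by rewrite /C1; nneg.
have C2_0 : 0 <= C2 by rewrite /C2; nneg.
have h2 : 0 <= h ^+ 2 := sqr_ge0 h.
have c1h : 0 <= C1 * h ^+ 2 by rewrite mulr_ge0.
have c2h : 0 <= C2 * h ^+ 2 by rewrite mulr_ge0.
have Ie : 0 < I0 * e by rewrite mulr_gt0.
have [Me|Me] := leP M (9 * e).
  by have := ler_wpM2l (ltW I0_gt0) Me; lra.
have GM : G x0 <= 2 * M.
  by have := Delta_geM x0; rewrite /Delta; lra.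
pose xc := x0 - s / 2.
pose b := 12 * M * (64 * B1 ^+ 2 * r ^+ 2).
have b0 : 0 <= b by rewrite /b; nneg.
have near_le w : 0 <= w -> w <= s -> Delta (x0 - w) <= - (M / 2).
  move=> w0 ws; have := left_small w0 ws.
  have := le_F (ltac:(lra) : x0 - w <= x0).
  by rewrite /Delta; lra.
have all_u u : 0 < u -> Delta (xc + u) + Delta (xc - u) <= - M + b * u ^+ 2.
  move=> u0; have u2 : 0 <= u ^+ 2 := sqr_ge0 u.
  have bu : 0 <= b * u ^+ 2 by rewrite mulr_ge0.
  have [us|us] := leP u (s / 2).
    have e1 : xc + u = x0 - (s / 2 - u) by rewrite /xc; ring.
    have e2 : xc - u = x0 - (s / 2 + u) by rewrite /xc; ring.
    rewrite e1 e2.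
    have := near_le (s / 2 - u) (ltac:(lra)) (ltac:(lra)).
    have := near_le (s / 2 + u) (ltac:(lra)) (ltac:(lra)).
    by lra.
  have w1 : 1 <= 4 * (64 * B1 ^+ 2 * r ^+ 2 * u ^+ 2).
    rewrite -sV2 [X in 4 * X]mulrC mulrA ler_pdivlMr ?exprn_gt0// mul1r.
    rewrite (_ : 4 * u ^+ 2 = (2 * u) ^+ 2); last by ring.
    by rewrite ler_sqr ?nnegrE; lra.
  have := ler_wpM2l (mulr_ge0 (ler0n R 3) M_ge0) w1; rewrite mulr1 /b.
  by have := Delta_leM (xc + u); have := Delta_leM (xc - u); lra.
have S := smoothing b0 all_u.
have [ok|bad] := leP (24 * (64 * B1 ^+ 2 * r ^+ 2) * h ^+ 2 * I2) I0.
  have := ler_wpM2l M_ge0 ok.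
  by move: S; rewrite /b; lra.
have := large_scale (ler0n R 24) bad.
by move: c1h c2h; rewrite /C2; lra.
Qed.

Lemma near_extremum_le : I0 * M <= 32 * D + 9 * I0 * e + (C1 + C2) * h ^+ 2.
Proof. by have [/case_large|/case_small] := leP (G x0 / 2) (F x0). Qed.

End near_extremum.

(** The slack [e] stands in for attainment of the supremum of |Delta|; oddness of [Delta] turns a
    near-maximum into a near-minimum. *)
Lemma kolmogorov_distance_le x (e : R) : 0 < e ->
  I0 * `|F x - G x| <= 32 * D + 9 * I0 * e + (C1 + C2) * h ^+ 2.
Proof.
move=> e0.
have le1 (H : R -> R) y : (forall x, 0 <= H x) -> (forall x, H (- x) = 1 - H x) -> H y <= 1.
  by move=> H0 HN; have := H0 (- y); rewrite HN; lra.
pose A := range (fun y => `|Delta y|).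
have bA : has_sup A.
  split; first by exists `|Delta 0|; exists 0.
  exists 1 => _ [y _ <-]; rewrite /Delta ler_norml.
  have := F_ge0 y; have := G_ge0 y; have := le1 F y F_ge0 FN; have := le1 G y G_ge0 GN.
  by move=> *; apply/andP; split; lra.
have M_ub y : `|Delta y| <= sup A.
  by apply: ub_le_sup; [case: bA|exists y].
have [_ [y _ <-] hy] := sup_adherent e0 bA.
have [x0 hx0] : exists x0, Delta x0 < - (sup A - e).
  have [d0|d0] := leP 0 (Delta y).
    by exists (- y); rewrite DeltaN; move: hy; rewrite ger0_norm; lra.
  by exists y; move: hy; rewrite ltr0_norm; lra.
apply: le_trans (near_extremum_le e0 M_ub hx0).
by rewrite ler_wpM2l ?(ltW I0_gt0)//; exact: M_ub.
Qed.

End kolmogorov_distance.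

(** * Comparison of a symmetric law having a log-concave distribution function with the Gaussian
    law *)

Section comparison_with_gaussian.
Context d (T : measurableType d) {R : realType} (P : probability T R).
Variables (Y : T -> R) (h D : R).
Hypotheses (mY : measurable_fun [set: T] Y)
  (intY : P.-integrable [set: T] (EFin \o Y)).
Hypothesis Y_diffuse : forall x, \int[P]_w le_indic x (Y w) = 1 - real_cdf P Y x.
Local Notation F := (real_cdf P Y).
Hypothesis Y_sym : forall x, F (- x) = 1 - F x.
Hypothesis Y_log_concave : forall x u, F (x + u) * F (x - u) <= F x ^+ 2.
Hypothesis Y_sin : forall t, \int[P]_w sin (t * Y w) = 0.
Hypotheses (h0 : 0 < h) (D0 : 0 <= D).
Hypothesis Y_cos : forall t, 0 < t -> t <= 2 / h ->
  `|\int[P]_w cos (t * Y w) - expR (- t ^+ 2 / 2)| <= D * t ^+ 4 * expR (- t ^+ 2 / 4).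
Local Notation mu := (@lebesgue_measure R).
Local Notation half_kernel := (@half_kernel R).

(** Averages the assumed bound at u = h z against the kernel; by [smoothed_cdf_diff] the average of
    the left side is at least -16 D. *)
Lemma smoothed_cdf_lower x a b : 0 <= b ->
  (forall u, 0 < u -> (F (x + u) - gauss_cdf (x + u)) +
    (F (x - u) - gauss_cdf (x - u)) <= a + b * u ^+ 2) ->
  - (16 * D) <= a * kernel_mass + b * h ^+ 2 * kernel_moment2.
Proof.
move=> b0 hab.
have := smoothed_cdf_diff x mY intY Y_diffuse Y_sin (@measurable_gauss_id R)
  (@integrable_gauss_id R) (@gauss_diffuse R) (@gauss_sin R) h0 D0.
have cf t : 0 < t -> t <= 2 / h -> `|\int[P]_w cos (t * Y w) -
    \int[@gauss R]_w cos (t * gauss_id w)| <= D * t ^+ 4 * expR (- t ^+ 2 / 4).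
  by rewrite (Rintegral_gauss_cos t); exact: Y_cos.
move=> /(_ cf) {cf}; rewrite -/gauss_cdf.
have i1 := integrable_smoothed_cdf mY Y_diffuse x h0.
have i2 := integrable_smoothed_cdf (@measurable_gauss_id R) (@gauss_diffuse R) x h0.
rewrite -/gauss_cdf in i2.
rewrite distrC -RintegralB// => /ler_normlP[H _].
have ik := @integrable_half_kernel R; have ik2 := @integrable_sqr_half_kernel R.
have iZ k (f : R -> R) : mu.-integrable [set: R] (EFin \o f) ->
    mu.-integrable [set: R] (EFin \o (fun z => k * f z)).
  by move=> /(integrableZl measurableT k); apply: eq_integrable.
have i3 := iZ a _ ik; have i4 := iZ (b * h ^+ 2) _ ik2.
move: H; set J := Rintegral _ _ _ => H.
suff : J <= a * kernel_mass + b * h ^+ 2 * kernel_moment2 by move: H; lra.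
rewrite /kernel_mass /kernel_moment2 -RintegralZl// -RintegralZl// -RintegralD//.
apply: le_Rintegral => //.
- by have := integrableB measurableT i2 i1; apply: eq_integrable.
- by have := integrableD measurableT i3 i4; apply: eq_integrable.
move=> z _; rewrite /half_kernel; set k := jackson_kernel z.
have k0 : 0 <= k := jackson_kernel_ge0 z.
rewrite indicE mem_setE in_itv/= andbT; case: ltP => z0; last by rewrite !mul0r !mulr0 subr0 addr0.
have := hab _ (mulr_gt0 h0 z0).
set f1 := F _; set f2 := F _; set g1 := gauss_cdf _; set g2 := gauss_cdf _ => hz.
have := ler_wpM2l k0 hz; rewrite exprMn !mul1r; lra.
Qed.

Lemma gaussian_approximation x (e : R) : 0 < e ->
  kernel_mass * `|F x - gauss_cdf x| <= 32 * D + 9 * kernel_mass * e +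
    ((8 * gauss_mills ^+ 2 * gauss_tail + 1) * kernel_moment2 +
     64 * 24 * gauss_mills ^+ 2 * gauss_tail * kernel_moment2) * h ^+ 2.
Proof.
apply: (@kolmogorov_distance_le _ F gauss_cdf _ _ _ _ _ _ gauss_rho) => //.
- exact: kernel_mass_gt0.
- exact: kernel_moment2_ge0.
- exact: expR_gt0.
- exact: gauss_rho_ge1.
- by move=> y; exact: real_cdf_ge0.
- exact: gauss_cdf_ge0.
- exact: gauss_cdfN.
- by move=> y z; exact: le_real_cdf.
- exact: le_gauss_cdf.
- exact: gauss_cdf_left.
- exact: gauss_cdf_second_diff.
- exact: gauss_cdf_tail.
- exact: smoothed_cdf_lower.
Qed.

End comparison_with_gaussian.

(** * Linear forms and hyperplanes *)

Section linear_forms.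
Context {R : realType}.

Definition linear_form n (theta : 'I_n -> R) (x : n.-tuple R) : R :=
  \sum_(i < n) theta i * tnth x i.

Lemma measurable_linear_form n (theta : 'I_n -> R) :
  measurable_fun [set: n.-tuple R] (linear_form theta).
Proof.
apply: measurable_sum => i; apply: measurable_funM => //.
exact: measurable_coordinate.
Qed.

Lemma linear_form_sign_change n (theta : 'I_n -> R) (x : n.-tuple R) :
  linear_form theta (sign_change (fun=> -1) x) = - linear_form theta x.
Proof.
rewrite /linear_form -sumrN; apply: eq_bigr => i _.
by rewrite tnth_mktuple mulN1r mulrN.
Qed.

Lemma linear_form_consT n (theta : 'I_n.+1 -> R) (a : R) (t : n.-tuple R) :
  linear_form theta (consT (a, t)) =
  theta ord0 * a + linear_form (fun i => theta (lift ord0 i)) t.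
Proof.
rewrite /linear_form big_ord_recl; congr (_ * _ + _).
apply: eq_bigr => i _; by rewrite tnth_consT_lift.
Qed.

(** If a coefficient after the first is nonzero, each section is a hyperplane in one dimension less;
    otherwise the set is a single point times the whole space. *)
Lemma lebesgue_tuple_hyperplane n (theta : 'I_n -> R) (c : R) :
  (exists i, theta i != 0) ->
  (lebesgue_tuple n [set x | linear_form theta x = c] = 0)%E.
Proof.
elim: n theta c => [|n IHn] theta c [i ti]; first by case: i ti.
have mH m (th : 'I_m -> R) r : measurable [set x | linear_form th x = r].
  have := measurable_linear_form th measurableT (measurable_set1 r).
  by rewrite setTI.
have [[j tj]|all0] := pselect (exists j, theta (lift ord0 j) != 0).
  pose f (x : n.+1.-tuple R) : \bar R := (\1_[set x | linear_form theta x = c] x)%:E.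
  transitivity (\int[lebesgue_tuple n.+1]_x f x)%E.
    by rewrite integral_indic ?setIT//; exact: mH.
  rewrite (ge0_integral_lebesgue_tupleS (f := f)); last 2 first.
  - by apply/measurable_EFinP; apply: measurable_indic; exact: mH.
  - by move=> x; rewrite /f lee_fin.
  rewrite integral0_eq// => a _; rewrite /f.
  pose th i := theta (lift ord0 i).
  transitivity (\int[lebesgue_tuple n]_t (\1_[set t | linear_form th t = c - theta ord0 * a] t)%:E)%E.
    apply: eq_integral => t _; congr _%:E; rewrite !indicE.
    congr (nat_of_bool _)%:R.
    apply/idP/idP; rewrite !inE/= linear_form_consT; first by move=> <-; rewrite addrC addKr.
    by move=> ->; rewrite addrC subrK.
  by rewrite integral_indic ?setIT; [apply: IHn; exists j|by []|exact: mH].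
have {}all0 j : theta (lift ord0 j) = 0.
  by apply/eqP; apply: contrapT => h; apply: all0; exists j; exact/negP.
have t0 : theta ord0 != 0.
  by case: (unliftP ord0 i) ti => [j ->|->//]; rewrite all0 eqxx.
have -> : [set x | linear_form theta x = c] =
    [set x : n.+1.-tuple R | [set c / theta ord0] (thead x) /\ setT [tuple of behead x]].
  apply/seteqP; split => x /=; rewrite /linear_form big_ord_recl big1 ?addr0; try by move=> j _; rewrite all0 mul0r.
    by move=> <-; split => //; rewrite mulrC mulKf.
  by move=> [+ _]; rewrite /thead => ->; rewrite mulrC divfK.
have := lebesgue_consE (lebesgue_tuple n) (measurable_set1 (c / theta ord0)) measurableT.
by rewrite lebesgue_measure_set1 mul0e.
Qed.

End linear_forms.

(** * The absolute constants *)

Section moment_constants.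
Context {R : realType}.

Lemma moment4_gt0 : 0 < moment4 :> R.
Proof.
by rewrite /moment4 mulr_gt0 ?exprn_gt0// addr_gt0 ?exprn_gt0// expr1n mulr1 mulr_gt0 ?divr_gt0 ?exprn_gt0.
Qed.

Lemma moment8_gt0 : 0 < moment8 :> R.
Proof.
rewrite /moment8 mulr_gt0 ?exprn_gt0// addr_gt0 ?exprn_gt0// mulr_gt0 ?divr_gt0//.
by rewrite mulr_gt0 ?exprn_gt0// moment4_gt0.
Qed.

Definition exponent_constant : R := (tau_constant + 2) * moment4.

Lemma exponent_constant_gt0 : 0 < exponent_constant.
Proof. by rewrite mulr_gt0 ?moment4_gt0// /tau_constant; lra. Qed.

Definition cosine_constant : R := 2 * (moment8 + 1) + exponent_constant.

Lemma cosine_constant_gt0 : 0 < cosine_constant.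
Proof.
rewrite /cosine_constant; move: exponent_constant_gt0 moment8_gt0.
set a := exponent_constant; set b := moment8; lra.
Qed.

(** The bound of [gaussian_approximation] at D = cosine_constant kappa, e = kappa and h^2 = 8
    exponent_constant kappa, divided by kappa and by the kernel mass. *)
Definition normal_approximation_constant : R :=
  (32 * cosine_constant + 9 * kernel_mass +
   ((8 * gauss_mills ^+ 2 * gauss_tail + 1) * kernel_moment2 +
    64 * 24 * gauss_mills ^+ 2 * gauss_tail * kernel_moment2) *
   (8 * exponent_constant)) / kernel_mass.

Lemma normal_approximation_constant_gt0 : 0 < normal_approximation_constant.
Proof.
have I0 := @kernel_mass_gt0 R; have I2 := @kernel_moment2_ge0 R.
have c0 := cosine_constant_gt0; have k0 := exponent_constant_gt0.
have m0 : 0 <= @gauss_mills R ^+ 2 := sqr_ge0 _.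
have t0 : 0 <= @gauss_tail R.
  by apply: le_trans (gauss_cdf_tail 0); rewrite mulr_ge0 ?gauss_cdf_ge0 ?sqr_ge0.
rewrite /normal_approximation_constant; move: I0 I2 c0 k0 m0 t0.
set i0 := kernel_mass; set i2 := kernel_moment2; set c := cosine_constant.
set k := exponent_constant; set m := gauss_mills ^+ 2; set t := gauss_tail.
move: i0 i2 c k m t => i0 i2 c k m t *.
apply: divr_gt0 => //; apply: ltr_wpDr; first by nneg.
by apply: addr_gt0; exact: mulr_gt0.
Qed.

End moment_constants.

(** * Normal approximation of a linear form of the random vector *)

Section linear_form_of_random_vector.
Context d (T : measurableType d) {R : realType} (P : probability T R) {n : nat}.
Variables (X : {RV P >-> n.-tuple R}) (f : n.-tuple R -> R).
Hypotheses (Xf : has_density X f) (lcf : log_concave f) (uf : unconditional f).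
Hypothesis E2 : forall i, (\int[P]_w (tnth (X w) i ^+ 2)%:E = 1)%E.
Variable theta : 'I_n -> R.
Local Notation S := (fun w => linear_form theta (X w)).
Local Notation F := (real_cdf P (fun w => linear_form theta (X w))).

Lemma measurable_linear_form_RV : measurable_fun [set: T] S.
Proof. by apply: (measurableT_comp (measurable_linear_form theta)). Qed.

Lemma integrable_linear_form_RV : P.-integrable [set: T] (EFin \o S).
Proof.
apply: integrable_sumr => i; apply: integrableZr_real.
have mX : measurable_fun [set: T] (fun w => tnth (X w) i).
  by apply: (measurableT_comp (measurable_coordinate i)).
have i2 : P.-integrable [set: T] (EFin \o (fun w => tnth (X w) i ^+ 2)).
  apply: (@ge0_integrable _ _ _ _ _ 1); rewrite ?E2//.
    exact: measurable_funX.
  by move=> w; exact: sqr_ge0.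
apply: (le_integrable measurableT _ _ (integrableD_real (integrable_cstr P 1) i2)).
  exact/measurable_EFinP.
move=> w _; rewrite /= lee_fin [leRHS]ger0_norm ?addr_ge0 ?sqr_ge0//.
set x := tnth _ _; rewrite ler_norml.
have := sqr_ge0 (x - 1); have := sqr_ge0 (x + 1).
by rewrite !expr2; nra.
Qed.

Lemma linear_form_RV_atomless c : (exists i, theta i != 0) ->
  P (S @^-1` [set c]) = 0%E.
Proof.
move=> th0.
have mH : measurable [set x : n.-tuple R | linear_form theta x = c].
  have := measurable_linear_form theta measurableT (measurable_set1 c).
  by rewrite setTI.
have [mf f0 /(_ _ mH) e] := Xf.
have <- : distribution P X [set x | linear_form theta x = c] = P (S @^-1` [set c]) by [].
rewrite e; apply: null_set_integral => //.
  by apply/measurable_EFinP; exact: measurable_funTS.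
exact: lebesgue_tuple_hyperplane.
Qed.

Lemma Rintegral_linear_formN (phi : R -> R) (c : R) :
  measurable_fun [set: R] phi -> (forall x, `|phi x| <= c) ->
  \int[P]_w phi (- S w) = \int[P]_w phi (S w).
Proof.
move=> mphi phic.
have := Rintegral_sign_change Xf uf (delta := fun=> -1) (phi := phi \o linear_form theta) (fun=> or_intror erefl)
  (measurableT_comp mphi (measurable_linear_form theta)) (fun x => phic _).
by move=> <-; apply: eq_Rintegral => w _; rewrite /= linear_form_sign_change.
Qed.

Lemma linear_form_RV_cdfN x : (exists i, theta i != 0) -> F (- x) = 1 - F x.
Proof.
move=> th0.
rewrite -(Rintegral_le_indicr measurable_linear_form_RV (linear_form_RV_atomless x th0)).
rewrite /real_cdf -(@Rintegral_linear_formN (fun y => le_indic y (- x)) 1).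
- by apply: eq_Rintegral => w _; rewrite /le_indic lerN2.
- exact: measurable_le_indic.
- by move=> y; rewrite ger0_norm ?le_indic_ge0 ?le_indic_le1.
Qed.

Lemma linear_form_RV_sin t : \int[P]_w sin (t * S w) = 0.
Proof.
have ms : measurable_fun [set: R] (fun x => sin (t * x)).
  by apply: (measurableT_comp measurable_sin); exact: measurable_funM.
have := @Rintegral_linear_formN (fun y => sin (t * y)) 1 ms (fun x => sin_max _).
have -> : \int[P]_w sin (t * - S w) = \int[P]_w (- 1 * sin (t * S w)).
  by apply: eq_Rintegral => w _; rewrite mulrN sinN mulN1r.
rewrite RintegralZl//; first lra.
apply: (@bounded_integrable _ _ _ _ _ 1) => [|w]; last exact: sin_max.
exact: (measurableT_comp ms measurable_linear_form_RV).
Qed.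

(** The midpoint of a point with S <= x + u and a point with S <= x - u has S <= x, so
    Prekopa-Leindler applies to the three indicators. *)
Lemma linear_form_RV_cdf_log_concave x u : F (x + u) * F (x - u) <= F x ^+ 2.
Proof.
have ml y : measurable_fun [set: n.-tuple R] (fun x => le_indic (linear_form theta x) y).
  by apply: measurable_le_indic => //; exact: measurable_linear_form.
have l0 y (z : n.-tuple R) : 0 <= le_indic (linear_form theta z) y by exact: le_indic_ge0.
have := expectation_midpoint Xf lcf (ml (x + u)) (ml (x - u)) (ml x)
   (l0 (x + u)) (l0 (x - u)) (l0 x).
have FE y : (\int[P]_w (le_indic (linear_form theta (X w)) y)%:E = (F y)%:E)%E.
  rewrite RintegralEFin//.
  apply: (@bounded_integrable _ _ _ _ _ 1) => [|w].
    by apply: measurable_le_indic => //; exact: measurable_linear_form_RV.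
  by rewrite ger0_norm ?le_indic_ge0 ?le_indic_le1.
rewrite !FE -!EFinM lee_fin -expr2; apply => y z v vyz.
have -> : linear_form theta v = (linear_form theta y + linear_form theta z) / 2.
  rewrite /linear_form -big_split/= mulr_suml; apply: eq_bigr => i _.
  by rewrite vyz; ring.
rewrite /le_indic; case: ifPn => hy; last by rewrite mul0r sqr_ge0.
case: ifPn => hz; last by rewrite mulr0 sqr_ge0.
case: ifPn => [_|/negP]; first by rewrite mul1r expr1n.
by case; lra.
Qed.

Hypothesis theta2 : \sum_(i < n) theta i ^+ 2 = 1.

Let K : R := exponent_constant.
Let kappa := \sum_(i < n) theta i ^+ 4.

Lemma theta_neq0 : exists i, theta i != 0.
Proof.
apply: contrapT => h; have : \sum_(i < n) theta i ^+ 2 = 0.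
  rewrite big1// => i _; have [->|hi] := eqVneq (theta i) 0; first by rewrite expr0n.
  by exfalso; apply: h; exists i.
by rewrite theta2 => /eqP; rewrite oner_eq0.
Qed.

Lemma sum_theta4_gt0 : 0 < kappa.
Proof.
have [i ti] := theta_neq0; rewrite /kappa (bigD1 i)//= ltr_wpDr//.
  by apply: sumr_ge0 => j _; rewrite exprn_even_ge0.
by rewrite exprn_even_gt0.
Qed.

(** On this range the correction K kappa t^4 / 2 in the exponent is at most t^2 / 4, half of the
    Gaussian exponent. *)
Lemma characteristic_function_linear_form t : 0 < t -> K * kappa * t ^+ 2 <= 2^-1 ->
  `|\int[P]_w cos (t * S w) - expR (- t ^+ 2 / 2)| <=
  cosine_constant * kappa * t ^+ 4 * expR (- t ^+ 2 / 4).
Proof.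
move=> t0 ht; have k0 := sum_theta4_gt0.
pose a i := t * theta i.
have A4 : \sum_(i < n) a i ^+ 4 = t ^+ 4 * kappa.
  by rewrite mulr_sumr; apply: eq_bigr => i _; rewrite exprMn.
have A2 : \sum_(i < n) a i ^+ 2 = t ^+ 2.
  rewrite -[RHS]mulr1 -theta2 mulr_sumr; apply: eq_bigr => i _; by rewrite exprMn.
have t2 : 0 < t ^+ 2 by rewrite exprn_gt0.
have t4 : 0 < t ^+ 4 by rewrite exprn_gt0.
have := characteristic_function_bound Xf lcf uf E2 (a := a).
rewrite A4 A2 => /(_ (mulr_gt0 t4 k0)).
have -> : \int[P]_w cos (\sum_(i < n) a i * tnth (X w) i) = \int[P]_w cos (t * S w).
  apply: eq_Rintegral => w _; rewrite /linear_form mulr_sumr; congr cos.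
  by apply: eq_bigr => i _; rewrite mulrA.
move=> /le_trans; apply.
rewrite -/exponent_constant -/cosine_constant -/K [t ^+ 4 * kappa]mulrC mulrA ler_wpM2l//.
  exact: ltW (mulr_gt0 (mulr_gt0 cosine_constant_gt0 k0) t4).
rewrite ler_expR.
have : K * kappa * t ^+ 2 * t ^+ 2 <= 2^-1 * t ^+ 2 by rewrite ler_wpM2r// ltW.
rewrite (_ : t ^+ 4 = t ^+ 2 * t ^+ 2); last by ring.
set y := t ^+ 2; lra.
Qed.

Lemma real_cdf_linear_form_gauss x :
  `|F x - gauss_cdf x| <= normal_approximation_constant * kappa.
Proof.
have k0 := sum_theta4_gt0; have K0 : 0 < K := exponent_constant_gt0.
have c0 : 0 < cosine_constant := @cosine_constant_gt0 R.
have I0 := @kernel_mass_gt0 R.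
(* With this choice t <= 2/h amounts, for t > 0, to K kappa t^2 <= 1/2, while h^2 is of order
   kappa. *)
pose h := Num.sqrt (8 * K * kappa).
have p0 : 0 < 8 * K * kappa by apply: mulr_gt0 => //; exact: mulr_gt0.
have h2 : h ^+ 2 = 8 * K * kappa by rewrite sqr_sqrtr// ltW.
have h0 : 0 < h by rewrite sqrtr_gt0.
have Ycos t : 0 < t -> t <= 2 / h -> `|\int[P]_w cos (t * S w) - expR (- t ^+ 2 / 2)| <=
    cosine_constant * kappa * t ^+ 4 * expR (- t ^+ 2 / 4).
  move=> t0 th; apply: characteristic_function_linear_form => //.
  have : t * h <= 2 by rewrite -ler_pdivlMr.
  have th0 : 0 <= t * h by rewrite mulr_ge0 ?(ltW t0) ?(ltW h0).
  move=> th2; have := ler_pM th0 th0 th2 th2.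
  have -> : t * h * (t * h) = t ^+ 2 * h ^+ 2 by ring.
  rewrite h2; lra.
have := gaussian_approximation measurable_linear_form_RV integrable_linear_form_RV
  (fun x => Rintegral_le_indicr measurable_linear_form_RV (linear_form_RV_atomless x theta_neq0))
  (fun x => linear_form_RV_cdfN x theta_neq0) linear_form_RV_cdf_log_concave
  linear_form_RV_sin h0 (ltW (mulr_gt0 c0 k0)) Ycos x k0.
rewrite h2 => H; rewrite -(ler_pM2l I0); apply: le_trans H _.
rewrite le_eqVlt; apply/orP; left; apply/eqP.
rewrite /normal_approximation_constant -/K.
by field; rewrite gt_eqF.
Qed.

(** Without atoms, the probability of an interval is a difference of two values of the distribution
    function, whence the factor 2. *)
Lemma gauss_discrepancy_linear_form :
  (gauss_discrepancy P S <= (2 * normal_approximation_constant * kappa)%:E)%E.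
Proof.
apply: ge_ereal_sup => _ [[a b] /= ab <-].
rewrite (probability_itv_cdf measurable_linear_form_RV ab (linear_form_RV_atomless a theta_neq0)).
rewrite gauss_massE// -EFinB lee_fin.
have := real_cdf_linear_form_gauss a; have := real_cdf_linear_form_gauss b.
rewrite !ler_norml => /andP[h1 h2] /andP[h3 h4].
by apply/andP; split; lra.
Qed.

End linear_form_of_random_vector.

Theorem theorem1 (R : realType) :
  exists C : R, 0 < C /\
    forall (n : nat) (d : measure_display) (T : measurableType d)
      (P : probability T R) (X : {RV P >-> n.-tuple R}) (f : n.-tuple R -> R),
    (0 < n)%N ->
    has_density X f ->
    log_concave f ->
    unconditional f ->
    (forall i : 'I_n, ('E_P[fun w => (tnth (X w) i ^+ 2)%R] = 1)%E) ->
    (gauss_discrepancy P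
       (fun w => ((Num.sqrt n%:R)^-1 * \sum_(i < n) tnth (X w) i)%R)
     <= (C / n%:R)%:E)%E /\
    (forall theta : 'I_n -> R, \sum_(i < n) theta i ^+ 2 = 1 ->
      (gauss_discrepancy P (fun w => (\sum_(i < n) theta i * tnth (X w) i)%R)
       <= (C * \sum_(i < n) theta i ^+ 4)%:E)%E).
Proof.
exists (2 * normal_approximation_constant); split.
  by rewrite mulr_gt0// normal_approximation_constant_gt0.
move=> n d T P X f n0 Xf lcf uf E2'.
have E2 i : (\int[P]_w (tnth (X w) i ^+ 2)%:E = 1)%E.
  by rewrite -(E2' i) unlock.
have main (theta : 'I_n -> R) : \sum_(i < n) theta i ^+ 2 = 1 ->
    (gauss_discrepancy P (fun w => (\sum_(i < n) theta i * tnth (X w) i)%R)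
       <= (2 * normal_approximation_constant * \sum_(i < n) theta i ^+ 4)%:E)%E.
  by move=> theta2; exact: (gauss_discrepancy_linear_form Xf lcf uf E2 theta2).
split; last exact: main.
have nR : 0 < n%:R :> R by rewrite ltr0n.
have s2 : Num.sqrt n%:R ^- 2 = n%:R^-1 :> R by rewrite sqr_sqrtr// ltW.
(* Equal coefficients make the sum of fourth powers equal to 1/n. *)
pose theta (i : 'I_n) : R := (Num.sqrt n%:R)^-1.
have theta2 : \sum_(i < n) theta i ^+ 2 = 1.
  by rewrite /theta sumr_const card_ord exprVn s2 -[LHS]mulr_natr mulVf// gt_eqF.
have theta4 : \sum_(i < n) theta i ^+ 4 = n%:R^-1.
  rewrite /theta sumr_const card_ord exprVn -[4%N]/(2 * 2)%N exprM -exprVn s2.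
  by rewrite -[LHS]mulr_natr expr2 -mulrA mulVf ?mulr1// gt_eqF.
have := main theta theta2; rewrite theta4; congr (_ <= _)%E.
by congr (gauss_discrepancy P _); apply/funext => w; rewrite mulr_sumr.
Qed.
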